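(* Let $G$ be a finite, compact, connected metric graph with edges $I_1,\dots,I_r$ and vertices $v_1,\dots,v_s$, let $q_j\in L^1(I_j)$ be real-valued for $j=1,\dots,r$, and let $B\subset\partial G$ be nonempty. Moreover, let $\alpha\in\mathbb{R}^s$, let $A_\alpha$ be the selfadjoint Schrödinger operator in $L^2(G)$ with $\delta$-type vertex conditions of strength $\alpha$, and let $M_{B,\alpha}$ be the corresponding Titchmarsh--Weyl function. Then the following assertions hold for each $\lambda\in\mathbb{R}$. (i) If $\lambda$ is a pole of $M_{B,\alpha}$ then $\lambda$ is an eigenvalue of $A_\alpha$. (ii) If $\lambda$ is an eigenvalue of $A_\alpha$ with $\dim\ker(A_\alpha-\lambda)>2\operatorname{cyc}(G)+|\partial G|-|B|-1$ then $\lambda$ is a pole of $M_{B,\alpha}$. (iii) If $\operatorname{cyc}(G)=0$, i.e., $G$ is a tree, and $B=\partial G$ then $$\dim\ker(A_\alpha-\lambda)=\operatorname{rank}\operatorname{Res}_\lambda M_{B,\alpha}.$$ Otherwise the estimate $$\operatorname{rank}\operatorname{Res}_\lambda M_{B,\alpha}\le\dim\ker(A_\alpha-\lambda)\le\operatorname{rank}\operatorname{Res}_\lambda M_{B,\alpha}+2\operatorname{cyc}(G)+|\partial G|-|B|-1$$ holds.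
   Context: A finite, compact metric graph $G$ is a collection of finitely many compact intervals $I_j=[0,L_j]$, $L_j>0$, $j=1,\dots,r$ (the edges), together with an equivalence relation on the set of endpoints of these intervals; the equivalence classes $v_1,\dots,v_s$ are the vertices. Write $o(I_j)$ for the vertex containing the endpoint $0$ of $I_j$ and $t(I_j)$ for the vertex containing the endpoint $L_j$. Loops and multiple edges are allowed. The degree of a vertex is the cardinality of the equivalence class (a loop counts twice). The boundary $\partial G$ is the set of vertices of degree one. For connected $G$, the cyclomatic number is $\operatorname{cyc}(G)=1+r-s$; $G$ is a tree (has no cycles) if and only if $\operatorname{cyc}(G)=0$. A function $f:G\to\mathbb{C}$ is a collection of functions $f_j:I_j\to\mathbb{C}$, $j=1,\dots,r$, and $L^2(G)=\bigoplus_{j=1}^r L^2(I_j)$. The function $f$ is continuous on $G$ if each $f_j$ is continuous on $I_j$ and, at each vertex, the values of all components at the endpoints belonging to this vertex coincide; $f(v_i)$ denotes this common value. $AC^2(G)$ is the set of $f:G\to\mathbb{C}$ such that $f_j$ and $f_j'$ are absolutely continuous on $(0,L_j)$ for all $j$ (so that the values of $f_j,f_j'$ at $0$ and $L_j$ are defined). The differential expression $\mathcal{L}$ acts as $(\mathcal{L}f)_j=-f_j''+q_jf_j$ on $I_j$, $j=1,\dots,r$. For a vertex $v_i$, $$\partial_\nu f(v_i)=\sum_{t(I_j)=v_i}f_j'(L_j)-\sum_{o(I_j)=v_i}f_j'(0).$$ The operator $A_\alpha$ in $L^2(G)$ is given by $A_\alpha f=\mathcal{L}f$ with domain consisting of all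 $f\in L^2(G)\cap AC^2(G)$ such that $\mathcal{L}f\in L^2(G)$, $f$ is continuous on $G$, and $\partial_\nu f(v_i)-\alpha_if(v_i)=0$ for $i=1,\dots,s$. It is selfadjoint, semibounded below, and has compact resolvent; $\sigma(A_\alpha)$ denotes its spectrum, which consists of isolated eigenvalues of finite multiplicity. Titchmarsh--Weyl function: let $B=\{v_{i_1},\dots,v_{i_m}\}$ be a nonempty set of (distinct) vertices and $\mu\in\mathbb{C}\setminus\sigma(A_\alpha)$. For $l=1,\dots,m$ let $f^{(l)}\in L^2(G)\cap AC^2(G)$ be the unique function that is continuous on $G$, satisfies $\mathcal{L}f^{(l)}=\mu f^{(l)}$, $\partial_\nu f^{(l)}(v_{i_l})-\alpha_{i_l}f^{(l)}(v_{i_l})=1$, and $\partial_\nu f^{(l)}(v_i)-\alpha_if^{(l)}(v_i)=0$ for all $i\in\{1,\dots,s\}$ with $i\neq i_l$. Then $M_{B,\alpha}(\mu)\in\mathbb{C}^{m\times m}$ is the matrix with entries $(M_{B,\alpha}(\mu))_{k,l}=f^{(l)}(v_{i_k})$, $k,l=1,\dots,m$. Equivalently, $M_{B,\alpha}(\mu)$ maps $(\partial_\nu f(v_{i_k})-\alpha_{i_k}f(v_{i_k}))_{k=1}^m$ to $(f(v_{i_k}))_{k=1}^m$ for every continuous $f\in L^2(G)\cap AC^2(G)$ with $\mathcal{L}f=\mu f$ and $\partial_\nu f(v_i)-\alpha_if(v_i)=0$ for all $i\notin\{i_1,\dots,i_m\}$. The function $M_{B,\alpha}$ is analytic on $\mathbb{C}\setminus\sigma(A_\alpha)$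 and meromorphic on $\mathbb{C}$; ''pole'' means a non-removable singularity. $\operatorname{Res}_\lambda M_{B,\alpha}$ is the residue (an $m\times m$ matrix) of $M_{B,\alpha}$ at $\lambda$, with the convention $\operatorname{Res}_\lambda M_{B,\alpha}=0$ if $M_{B,\alpha}$ is analytic at $\lambda$ or can be continued analytically into $\lambda$. *)

(* Defs.v *)
From HB Require Import structures.
From mathcomp Require Import all_boot all_order all_algebra.
From mathcomp Require Import complex.
From mathcomp Require Import all_classical all_reals all_analysis.

Set Implicit Arguments.
Unset Strict Implicit.
Unset Printing Implicit Defensive.

Import Order.TTheory GRing.Theory Num.Theory.
Import numFieldNormedType.Exports.

Local Open Scope ring_scope.

(* The endpoint 0 of the edge j is (j, false), the endpoint L_j is (j, true). *)
Record metric_graph (R : realType) := MetricGraph {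
  nedges : nat;
  len : 'I_nedges -> R;
  len_gt0 : forall j, 0 < len j;
  same_vertex : rel ('I_nedges * bool)%type;
  same_vertexP : equivalence_rel same_vertex
}.

Section Graph.
Variables (R : realType) (G : metric_graph R).

Definition endpoint : finType := ('I_(nedges G) * bool)%type.

Definition eq_class (p : endpoint) : {set endpoint} :=
  [set p' | same_vertex p p']%SET.

Definition vertex : finType :=
  {v : {set endpoint} | v \in [set eq_class p | p : endpoint]%SET}.

Definition vertex_of (p : endpoint) : vertex :=
  exist _ (eq_class p) (imset_f eq_class (isT : p \in endpoint)).

Lemma vertex_inhab (v : vertex) : exists p, p \in val v.
Proof.
case: v => _ /= /imsetP[p _ ->]; exists p; rewrite inE.
by have [] := same_vertexP p p p.
Qed.

Definition vertex_repr (v : vertex) : endpoint := xchoose (vertex_inhab v).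

Definition org (j : 'I_(nedges G)) : vertex := vertex_of (j, false).
Definition ter (j : 'I_(nedges G)) : vertex := vertex_of (j, true).

Definition degree (v : vertex) : nat := #|val v|.
Definition boundary : {set vertex} := [set v | degree v == 1%N]%SET.

Definition adjacent : rel vertex := fun u v =>
  [exists j, ((org j == u) && (ter j == v)) || ((org j == v) && (ter j == u))].
Definition graph_connected : Prop := forall u v, connect adjacent u v.

Definition cyc : int := 1 + (nedges G)%:Z - #|{: vertex}|%:Z.

End Graph.

(* Differentiation, continuity, absolute continuity and measurability of
   complex-valued functions of a real variable are taken componentwise. *)
Section OneInterval.
Variable R : realType.
Local Notation C := R[i].
Local Notation mu := (@lebesgue_measure R).

Definition rpart (f : R -> C) : R -> R := fun x => complex.Re (f x).
Definition ipart (f : R -> C) : R -> R := fun x => complex.Im (f x).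

Definition abs_continuous (a b : R) (f : R -> R) : Prop :=
  forall e : R, 0 < e -> exists2 d : R, 0 < d &
    forall (n : nat) (u v : 'I_n -> R),
      (forall i, a < u i /\ u i <= v i /\ v i < b) ->
      (forall i j, i != j -> v i <= u j \/ v j <= u i) ->
      \sum_i (v i - u i) < d -> \sum_i `|f (v i) - f (u i)| < e.

Definition c_abs_continuous (a b : R) (f : R -> C) : Prop :=
  abs_continuous a b (rpart f) /\ abs_continuous a b (ipart f).

Definition c_derivable (f : R -> C) (x : R) : Prop :=
  derivable (rpart f) x 1 /\ derivable (ipart f) x 1.

Definition c_der (f : R -> C) : R -> C :=
  fun x => Complex (derive1 (rpart f) x) (derive1 (ipart f) x).

Definition c_lim (F : set_system R) (f : R -> C) : C :=
  Complex (lim (rpart f @ F)%classic) (lim (ipart f @ F)%classic).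

Definition c_continuous_on (a b : R) (f : R -> C) : Prop :=
  ({within `[a, b], continuous (rpart f)})%classic /\
  ({within `[a, b], continuous (ipart f)})%classic.

Definition sqnorm_on (a b : R) (f : R -> C) : \bar R :=
  (\int[mu]_(x in `[a, b]%classic) (rpart f x ^+ 2 + ipart f x ^+ 2)%:E)%E.

Definition square_integrable (a b : R) (f : R -> C) : Prop :=
  [/\ measurable_fun `[a, b]%classic (rpart f),
      measurable_fun `[a, b]%classic (ipart f) &
      (sqnorm_on a b f < +oo)%E].

End OneInterval.

Section SchroedingerOperator.
Variables (R : realType) (G : metric_graph R).
Local Notation C := R[i].
Local Notation mu := (@lebesgue_measure R).

(* Only the values of f j on [0, L_j] are relevant. *)
Definition gfun : Type := 'I_(nedges G) -> R -> C.
HB.instance Definition _ := gen_eqMixin gfun.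
HB.instance Definition _ := gen_choiceMixin gfun.

Definition gfun0 : gfun := fun _ _ => 0.

Definition eq_on_graph (f g : gfun) : Prop :=
  forall j x, 0 <= x <= len j -> f j x = g j x.

Definition L2 (f : gfun) : Prop :=
  forall j, square_integrable 0 (len j) (f j).

Definition sqnorm (f : gfun) : \bar R :=
  (\sum_j sqnorm_on 0 (len j) (f j))%E.

Definition AC2 (f : gfun) : Prop :=
  forall j, [/\ c_abs_continuous 0 (len j) (f j),
    forall x, 0 < x < len j -> c_derivable (f j) x &
    c_abs_continuous 0 (len j) (c_der (f j))].

Definition end_val (f : gfun) (p : endpoint G) : C :=
  f p.1 (if p.2 then len p.1 else 0).

Definition graph_continuous (f : gfun) : Prop :=
  (forall j, c_continuous_on 0 (len j) (f j)) /\
  (forall p q, vertex_of p = vertex_of q -> end_val f p = end_val f q).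

(* The choice of the endpoint in the class v is irrelevant if f is continuous
   on the graph. *)
Definition vertex_val (f : gfun) (v : vertex G) : C := end_val f (vertex_repr v).

(* f_j' is absolutely continuous on the open edge only: its values at the
   endpoints are those of its continuous extension. *)
Definition der_at_org (f : gfun) (j : 'I_(nedges G)) : C :=
  c_lim (0^'+)%classic (c_der (f j)).
Definition der_at_ter (f : gfun) (j : 'I_(nedges G)) : C :=
  c_lim ((len j)^'-)%classic (c_der (f j)).

Definition dnu (f : gfun) (v : vertex G) : C :=
  \sum_(j | ter j == v) der_at_ter f j - \sum_(j | org j == v) der_at_org f j.

Variables (q : 'I_(nedges G) -> R -> R) (alpha : vertex G -> R).

Definition L1_potential : Prop :=
  forall j, mu.-integrable `[0, len j]%classic (fun x => (q j x)%:E).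

Definition L_eq (f g : gfun) : Prop :=
  forall j, {ae mu, forall x, 0 < x < len j ->
    c_derivable (c_der (f j)) x /\
    - c_der (c_der (f j)) x + (q j x)%:C%C * f j x = g j x}.

Definition delta_val (f : gfun) (v : vertex G) : C :=
  dnu f v - (alpha v)%:C%C * vertex_val f v.

(* The graph of the operator: f is in the domain and A f = g. *)
Definition A_graph (f g : gfun) : Prop :=
  [/\ L2 f /\ AC2 f, L2 g /\ L_eq f g, graph_continuous f &
      forall v, delta_val f v = 0].

(* (A - z) f = h *)
Definition A_shift (z : C) (f h : gfun) : Prop :=
  A_graph f (fun j x => h j x + z * f j x).

Definition A_ker (z : C) (f : gfun) : Prop := A_shift z f gfun0.

Definition A_eigenvalue (z : C) : Prop :=
  exists2 f, A_ker z f & ~ eq_on_graph f gfun0.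

Definition resolvent_set (z : C) : Prop :=
  [/\ forall f, A_ker z f -> eq_on_graph f gfun0,
      forall h, L2 h -> exists f, A_shift z f h &
      exists c : R, forall f h, L2 h -> A_shift z f h ->
        (sqnorm f <= c%:E * sqnorm h)%E].

Definition spectrum (z : C) : Prop := ~ resolvent_set z.

Definition has_dim (K : gfun -> Prop) (d : nat) : Prop :=
  exists b : 'I_d -> gfun,
  [/\ forall k, K (b k),
      forall c : 'I_d -> C,
        eq_on_graph (fun j x => \sum_k c k * b k j x) gfun0 ->
        forall k, c k = 0 &
      forall f, K f -> exists c : 'I_d -> C,
        eq_on_graph f (fun j x => \sum_k c k * b k j x)].

Definition dim_ker (z : C) : nat :=
  xget 0%N [set d | has_dim (A_ker z) d]%classic.

Definition TW_solution (z : C) (v : vertex G) (f : gfun) : Prop :=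
  [/\ L2 f /\ AC2 f, graph_continuous f,
      L_eq f (fun j x => z * f j x) &
      forall w, delta_val f w = (w == v)%:R].

(* Off the resolvent set the value is a dummy. *)
Definition TW_matrix (B : {set vertex G}) (z : C) : 'M[C]_#|B| :=
  if `[< spectrum z >] then 0 else
  \matrix_(k < #|B|, l < #|B|)
    vertex_val (xget gfun0 [set f | TW_solution z (enum_val l) f]%classic)
      (enum_val k).

End SchroedingerOperator.

Section Singularities.
Variables (R : realType) (m : nat).
Local Notation C := R[i].
Implicit Types (F : C -> 'M[C]_m) (z : C).

Definition mx_analytic_at F z : Prop :=
  forall k l, \forall w \near (z : C^o),
    derivable (fun u : C^o => F u k l : C^o) w 1.

Definition removable F z : Prop :=
  exists2 H, mx_analytic_at H z & \forall w \near (z : C^o)^'%classic, F w = H w.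

Definition pole F z : Prop :=
  (\forall w \near (z : C^o)^'%classic, mx_analytic_at F w) /\ ~ removable F z.

(* Coefficient of (w - z)^-1 in the Laurent expansion of F, which has finite
   principal part; equal to 0 at a removable singularity. *)
Definition is_residue F z (S : 'M[C]_m) : Prop :=
  exists (n : nat) (c : nat -> 'M[C]_m) (H : C -> 'M[C]_m),
  [/\ c 0%N = S, mx_analytic_at H z &
      \forall w \near (z : C^o)^'%classic,
        F w = \sum_(k < n.+1) (w - z) ^- k.+1 *: c k + H w].

Definition residue F z : 'M[C]_m := xget 0 [set S | is_residue F z S]%classic.

End Singularities.

(* Main.v *)
From HB Require Import structures.
Require Import Defs.
From mathcomp Require Import all_boot all_order all_algebra.
From mathcomp Require Import complex ring lra.
From mathcomp Require Import all_classical all_reals all_analysis.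

(** Let [K] be the kernel of [A - lambda]. For [w] near [lambda] the solution with a
    unit datum at a vertex [v] splits into a part orthogonal to [K], which is analytic
    in [w] up to [lambda], and a part in [K]. Green's formula against the elements of
    [K] computes the latter: it is [- (w - lambda)^-1] times the element of [K] that
    represents evaluation at [v] in the [L2] inner product ([bordered_coef],
    [basis_expansion]). Hence the Titchmarsh-Weyl function has at most a simple pole
    at [lambda], with residue [- T P T^*], where [T] restricts functions in [K] to [B]
    and [P] is positive definite ([TW_residue]). The rank of the residue is therefore
    the rank of [T]: it is at most the dimension of [K], and it is zero if and only if
    the singularity is removable.

    What remains is a bound for the dimension of the null space of [T], the functions
    in [K] that vanish on [B]. At a vertex of degree one where such a function has the
    value zero its derivative is zero too, so it vanishes on the whole edge; along a
    spanning tree zero spreads from the leaves to a root, once the function is known to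
    vanish on the edges outside the tree. So it suffices to annihilate two Cauchy data
    on each of the [cyc G] edges outside the tree and the values at the boundary
    vertices outside [B], apart from one of them which serves as the root. If [B] is
    the whole boundary and there is a cycle, the root is taken in [B], and a single
    derivative at the apex of a cycle does the work of two data of its chord
    ([sweep_around]). In both cases the number of conditions is
    [2 cyc G + |boundary G| - |B| - 1], while a tree with [B] its whole boundary needs
    none ([forcing_labels]). This count is the defect in the estimates.

    The analytic basis is the reformulation of the operator domain by integral
    equations, [f' = p] and [p' = q f - g] with [q] merely integrable, which rests on
    the constancy of absolutely continuous functions with derivative zero almost
    everywhere ([abs_continuous_derive0_cst], [second_order_primitive]). Cauchy
    problems on an edge are solved by Picard iteration in a weighted norm
    ([linear_system_exists], [linear_system_bound]). The vertex conditions then form a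
    square linear system for the Cauchy data. Bordered by [K] it is uniquely solvable
    at [lambda], with bounds that persist near [lambda] ([bordered_solvable],
    [bordered_bound_near]); this yields the resolvent near [lambda] as well as the
    analytic part of the expansion. *)

Set Implicit Arguments.
Unset Strict Implicit.
Unset Printing Implicit Defensive.

Import Order.TTheory GRing.Theory Num.Theory.
Import numFieldNormedType.Exports.

Local Open Scope classical_set_scope.
Local Open Scope ring_scope.

(** * Absolutely continuous functions with vanishing derivative *)

Section AC.
Variable R : realType.
Notation mu := (@lebesgue_measure R).

Lemma negligible_open_cover (N : set R) (d : R) : 0 < d -> mu.-negligible N ->
  exists U : set R, [/\ open U, N `<=` U & (mu U < d%:E)%E].
Proof.
move=> d0 [M [mM M0 NM]].
have [|U [oU MU Ud]] := @lebesgue_regularity_outer R M d mM _ d0.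
  exact: (eq_ind_r (fun t => (t < +oo)%E) (ltry 0) M0).
exists U; split => //; first exact: subset_trans MU.
have mU : measurable U by exact: measurable_realfun.open_measurable.
apply: le_lt_trans Ud.
have := measureU2 mu (measurableD mU mM) mM.
rewrite setDKU; last exact: MU.
move=> /le_trans; apply.
by apply: (eq_ind_r (fun t => (mu (U `\` M) + t <= mu (U `\` M))%E) _ M0); rewrite adde0.
Qed.

(** The growth of [f] from [a] to [x] is charged partly to the rate [e] and partly to
    finitely many disjoint intervals whose total length is paid for by the part of
    [U] met so far. *)
Definition chain_upto (U : set R) (f : R -> R) (e a x : R) : Prop :=
  exists (n : nat) (u v : nat -> R),
    [/\ forall i, (i < n)%N -> [/\ a <= u i, u i <= v i & v i <= x],
        forall i j, (i < j < n)%N -> v i <= u j,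
        ((\sum_(i < n) (v i - u i))%:E <= mu (U `&` `]a, x]))%E &
        `|f x - f a| <= e * (x - a) + \sum_(i < n) `|f (v i) - f (u i)|].

Lemma chain_upto_slow (U : set R) f e a x y : a <= x -> x <= y -> measurable U ->
  `|f y - f x| <= e * (y - x) -> chain_upto U f e a x -> chain_upto U f e a y.
Proof.
move=> ax xy mU fxy [n [u [v [H1 H2 H3 H4]]]]; exists n, u, v; split => //.
- by move=> i /H1[? ? ?]; split => //; exact: le_trans xy.
- apply: le_trans H3 _; apply: le_measure; rewrite ?inE//.
  + exact: measurableI.
  + exact: measurableI.
  + by apply: setIS => z /=; rewrite !in_itv/= => /andP[-> /le_trans->].
- have -> : f y - f a = (f y - f x) + (f x - f a) by ring.
  apply: le_trans (ler_normD _ _) _.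
  have -> : e * (y - a) = e * (y - x) + e * (x - a) by ring.
  by rewrite -addrA lerD.
Qed.

Lemma chain_upto_cover (U : set R) f e a x y : 0 <= e -> a <= x -> x <= y ->
  measurable U -> `]x, y] `<=` U -> chain_upto U f e a x -> chain_upto U f e a y.
Proof.
move=> e0 ax xy mU xyU [n [u [v [H1 H2 H3 H4]]]].
pose u' i := if i == n then x else u i.
pose v' i := if i == n then y else v i.
have uu i : (i < n)%N -> u' i = u i by rewrite /u' => /ltn_eqF ->.
have vv i : (i < n)%N -> v' i = v i by rewrite /v' => /ltn_eqF ->.
have un : u' n = x by rewrite /u' eqxx.
have vn : v' n = y by rewrite /v' eqxx.
exists n.+1, u', v'; split.
- move=> i; rewrite ltnS leq_eqVlt => /orP[/eqP ->|iN].
    by rewrite un vn.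
  by rewrite uu// vv//; have [? ? ?] := H1 _ iN; split => //; exact: le_trans xy.
- move=> i j /andP[ij]; rewrite ltnS leq_eqVlt => /orP[/eqP jn|jN].
    move: ij; rewrite jn un => ij; rewrite vv//.
    by have [] := H1 _ ij.
  by rewrite uu// vv ?(ltn_trans ij)// H2// ij.
- rewrite big_ord_recr/= un vn.
  under eq_bigr do rewrite uu// vv//.
  have -> : U `&` `]a, y] = (U `&` `]a, x]) `|` `]x, y].
    apply/seteqP; split => z /=; rewrite !in_itv/=.
      move=> [Uz /andP[az zy]]; have [xz|zx] := ltP x z; [right|left].
        by rewrite zy.
      by rewrite az.
    move=> [[Uz /andP[-> zx]]|/andP[xz zy]]; first by rewrite (le_trans zx).
    split; first by apply: xyU => /=; rewrite in_itv/= xz.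
    by rewrite zy (le_lt_trans ax).
  rewrite measureU//; last 2 first.
  + exact: measurableI.
  + apply/seteqP; split => // z /=; rewrite !in_itv/= => -[[_ /andP[_ zx]] /andP[]].
    by rewrite ltNge zx.
  rewrite EFinD leeD//. rewrite /= lebesgue_measure_itv/=.
  case: ifPn => [_|]; first by rewrite -EFinB.
  by rewrite -leNgt lee_fin => yx; rewrite lee_fin subr_le0.
- rewrite big_ord_recr/= un vn.
  under eq_bigr do rewrite uu// vv//.
  have -> : f y - f a = (f y - f x) + (f x - f a) by ring.
  apply: le_trans (ler_normD _ _) _.
  have -> : e * (y - a) = e * (y - x) + e * (x - a) by ring.
  have : 0 <= e * (y - x) by rewrite mulr_ge0// subr_ge0.
  lra.
Qed.

(** The null set where the derivative fails to vanish is covered by an open set [U]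
    of small measure. Around a point outside [U] the function grows at rate at most
    [e]; a point of [U] has a whole interval of [U] around it, which is added to the
    chain. Hence the supremum of the points reached by chains is [b], and absolute
    continuity makes the increments over the chain small. *)
Lemma abs_continuous_derive0_cst (f : R -> R) (A B : R) :
  abs_continuous A B f ->
  {ae mu, forall x, A < x < B -> is_derive x 1 f 0} ->
  forall a b, A < a -> a <= b -> b < B -> f a = f b.
Proof.
move=> acf aef a b Aa ab bB; apply/eqP; rewrite eq_sym -subr_eq0 -normr_le0.
apply/ler_addgt0Pr => e0 e0_gt0; rewrite add0r.
pose e := e0 / (b - a + 1).
have ba1 : 0 < b - a + 1 by rewrite ltr_wpDl// subr_ge0.
have e_gt0 : 0 < e by rewrite divr_gt0.
have [d d_gt0 Hd] := acf _ e_gt0.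
have [U [oU NU Ud]] := negligible_open_cover d_gt0 aef.
have mU : measurable U by exact: measurable_realfun.open_measurable.
have local s : a <= s <= b -> exists2 r, 0 < r &
    forall x y, a <= x -> s - r < x -> x <= s -> s <= y -> y < s + r ->
    chain_upto U f e a x -> chain_upto U f e a y.
  move=> /andP[as_ sb].
  have [Us|nUs] := pselect (U s).
    have /nbhs_ballP[r /= r0 rU] := open_nbhs_nbhs (conj oU Us).
    exists r => // x y ax sx xs sy ys.
    apply: chain_upto_cover => //; [exact: ltW|exact: le_trans sy|].
    move=> z /=; rewrite in_itv/= => /andP[xz zy]; apply: rU.
    by rewrite /ball/= ltr_distlC; apply/andP; split; lra.
  have : is_derive s 1 f 0.
    apply: contrapT => H; apply: nUs; apply: NU => /= H'; apply: H; apply: H'.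
    by rewrite (lt_le_trans Aa)//= (le_lt_trans sb).
  move=> [df f0].
  have : (h^-1 *: (f (h *: 1 + s) - f s)) @[h --> 0^'] --> 'D_1 f s.
    exact: df.
  rewrite f0; move=> /cvgrPdist_le /(_ _ e_gt0) /nbhs_ballP[r /= r0 rU].
  have loc y : `|y - s| < r -> `|f y - f s| <= e * `|y - s|.
    move=> ysr; have [->|ys] := eqVneq y s; first by rewrite !subrr normr0 mulr0.
    have h0 : y - s != 0 by rewrite subr_eq0.
    have := rU (y - s); rewrite /ball/= sub0r normrN => /(_ ysr h0).
    rewrite sub0r normrN normrZ normfV scaler1 subrK.
    by rewrite ler_pdivrMl ?normr_gt0// mulrC.
  exists r => // x y ax sx xs sy ys.
  apply: chain_upto_slow => //; first exact: le_trans sy.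
  have -> : f y - f x = (f y - f s) - (f x - f s) by ring.
  apply: le_trans (ler_normB _ _) _.
  have -> : e * (y - x) = e * `|y - s| + e * `|x - s|.
    by rewrite ger0_norm ?subr_ge0// ler0_norm ?subr_le0//; ring.
  apply: lerD; apply: loc.
    by rewrite ger0_norm ?subr_ge0//; lra.
  by rewrite ler0_norm ?subr_le0//; lra.
pose S := [set x | a <= x <= b /\ chain_upto U f e a x].
have Sa : S a.
  split; first by rewrite lexx.
  exists 0%N, (fun=> 0), (fun=> 0); split => //.
  - by rewrite big_ord0.
  - by rewrite big_ord0 !subrr mulr0 normr0 addr0.
have hS : has_sup S.
  by split; [exists a|exists b => x [/andP[]]].
set s := sup S.
have as_ : a <= s by apply: sup_upper_bound.
have sb : s <= b by apply: ge_sup => //; [exists a|move=> x [/andP[]]].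
have [|r r0 Hr] := local s; first by rewrite as_.
have [x Sx sx] := sup_adherent r0 hS.
have xs : x <= s by exact: sup_upper_bound.
case: Sx => /andP[ax xb] Cx.
have Sb : chain_upto U f e a b.
  have [bsr|sbr] := ltP b (s + r); first exact: (Hr x).
  have : S (s + r / 2).
    split; first by apply/andP; split; lra.
    by apply: (Hr x) => //; lra.
  by move=> /(sup_upper_bound hS) /=; rewrite -/s; lra.
case: Sb => n [u [v [H1 H2 H3 H4]]].
apply: le_trans H4 _.
have : \sum_(i < n) `|f (v i) - f (u i)| < e.
  apply: (Hd n (fun i => u i) (fun i => v i)).
  - by move=> i; have [] := H1 i => // ? ? ?; split; [lra|split; [|lra]].
  - move=> i j ij; have [lij|lij] := ltnP i j; [left|right].
      by apply: H2; rewrite lij/=.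
    by apply: H2; rewrite ltn_neqAle eq_sym ij lij/=.
  - rewrite -lte_fin; apply: le_lt_trans H3 _; apply: le_lt_trans _ Ud.
    by apply: le_measure; rewrite ?inE//; exact: measurableI.
have : e * (b - a) + e = e0 by rewrite /e; field; lra.
lra.
Qed.

End AC.

(** * Indefinite integrals *)

Section Primitive.
Variable R : realType.
Notation mu := (@lebesgue_measure R).
Implicit Types (F G f g : R -> R) (L a b x y : R).

Lemma within_itv_continuousP f a b :
  {within `[a, b], continuous f} <->
  forall x, a <= x <= b -> forall e, 0 < e -> exists2 d, 0 < d &
    forall y, a <= y <= b -> `|y - x| < d -> `|f y - f x| < e.
Proof.
rewrite subspace_continuousP; split => H x xab.
  move=> e e0; have /cvgrPdist_lt /(_ _ e0) := H x xab.
  rewrite /within/= => /nbhs_ballP[d /= d0 dH]; exists d => // y yab yx.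
  by rewrite distrC; apply: dH => //=; rewrite /ball/= distrC.
apply/cvgrPdist_lt => e e0; have [d d0 dH] := H x xab _ e0.
rewrite /within/=; apply/nbhs_ballP; exists d => //= y xy yab.
by rewrite distrC; apply: dH => //; rewrite distrC.
Qed.

Lemma within_itv_bounded f a b : {within `[a, b], continuous f} ->
  exists2 M, 0 < M & forall x, a <= x <= b -> `|f x| <= M.
Proof.
have [ab|ba] := leP a b => cf; last first.
  by exists 1 => // x /andP[ax xb]; have := le_trans ax xb; rewrite leNgt ba.
have [c _ Hc] := EVT_max ab cf.
have [d _ Hd] := EVT_min ab cf.
exists (`|f c| + `|f d| + 1); first by rewrite ltr_wpDl// addr_ge0.
move=> x xab; have := Hc x; have := Hd x; rewrite !in_itv/= => /(_ xab) h1 /(_ xab) h2.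
rewrite ler_norml; apply/andP; split.
  have := ler_norm (- f d); rewrite normrN; have := normr_ge0 (f c); lra.
have := ler_norm (f c); have := normr_ge0 (f d); lra.
Qed.

Lemma within_itv_measurable f a b : {within `[a, b], continuous f} ->
  measurable_fun `[a, b] f.
Proof. by move=> cf; apply: measurable_realfun.subspace_continuous_measurable_fun. Qed.

Lemma within_itv_integrable f a b : {within `[a, b], continuous f} ->
  mu.-integrable `[a, b] (EFin \o f).
Proof.
by move=> cf; apply: continuous_compact_integrable => //; exact: segment_compact.
Qed.

Lemma integrableM_continuous f g a b : {within `[a, b], continuous f} ->
  mu.-integrable `[a, b] (EFin \o g) ->
  mu.-integrable `[a, b] (EFin \o (fun x => f x * g x)).
Proof.
move=> cf ig.
have [M M0 fM] := within_itv_bounded cf.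
apply: (@integrableMr _ _ _ mu `[a, b] _ f (EFin \o g)) => //.
  exact: within_itv_measurable.
exists M; split; first exact: num_real.
by move=> N MN x /= xab; apply: le_trans (ltW MN); apply: fM; rewrite in_itv in xab.
Qed.

(** Absolute continuity with a prescribed density, in integral form: sums, products
    and initial value problems are then treated through the density, without
    derivatives that exist only almost everywhere. *)
Definition primitive L F f : Prop :=
  mu.-integrable `[0, L] (EFin \o f) /\
  forall x, 0 <= x <= L -> F x = F 0 + \int[mu]_(t in `[0, x]) f t.

Lemma integrable_sub f L x y : 0 <= x -> y <= L ->
  mu.-integrable `[0, L] (EFin \o f) -> mu.-integrable `[x, y] (EFin \o f).
Proof.
move=> x0 yL; apply: integrableS => //.
by apply: subset_itv; rewrite bnd_simp.
Qed.

Lemma integrable_subo f L x y : 0 <= x -> y <= L ->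
  mu.-integrable `[0, L] (EFin \o f) -> mu.-integrable `]x, y] (EFin \o f).
Proof.
move=> x0 yL; apply: integrableS => //.
by apply: subset_itv; rewrite bnd_simp.
Qed.

Lemma Rintegral_sub f L x y : 0 <= x -> x <= y -> y <= L ->
  mu.-integrable `[0, L] (EFin \o f) ->
  \int[mu]_(t in `[0, y]) f t - \int[mu]_(t in `[0, x]) f t =
  \int[mu]_(t in `]x, y]) f t.
Proof.
move=> x0 xy yL fL; apply: Rintegral_itvB; rewrite ?bnd_simp//.
exact: integrable_sub fL.
Qed.

Lemma primitive_increment L F f x y : primitive L F f ->
  0 <= x -> x <= y -> y <= L -> F y - F x = \int[mu]_(t in `]x, y]) f t.
Proof.
move=> [fL H] x0 xy yL; rewrite -(Rintegral_sub x0 xy yL fL).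
by rewrite H ?(le_trans x0)// [F x]H ?x0 ?(le_trans xy)//; ring.
Qed.

Lemma integral_abs_continuous f L : mu.-integrable `[0, L] (EFin \o f) ->
  forall e, 0 < e -> exists2 d, 0 < d &
    forall (n : nat) (u v : 'I_n -> R),
      (forall i, 0 <= u i /\ u i <= v i /\ v i <= L) ->
      (forall i j, i != j -> v i <= u j \/ v j <= u i) ->
      \sum_i (v i - u i) < d ->
      \sum_i \int[mu]_(t in `]u i, v i]) `|f t| < e.
Proof.
move=> fL e e0; pose g := f \_ `[0, L].
have ig : mu.-integrable setT (EFin \o g).
  by rewrite -restrict_EFin; apply/integrable_restrict => //=; rewrite setTI.
have [d [d0 Hd]] := integral_normr_continuous ig e0.
exists d => // n u v H1 H2 H3.
pose F (i : 'I_n) := [set` `]u i, v i]].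
have mF i : measurable (F i) by exact: measurable_itv.
have tF : trivIset setT F.
  apply/trivIsetP => i j _ _ ij; apply/seteqP; split => // z /=.
  rewrite /F/= !in_itv/= => -[/andP[z1 z2] /andP[z3 z4]].
  by have [] := H2 _ _ ij; lra.
have muF i : mu (F i) = (v i - u i)%:E.
  rewrite /F lebesgue_measure_itv/= lte_fin; case: ltP => [//|vu].
  have [_ [uv _]] := H1 i; have -> : v i = u i by apply: le_anti; rewrite uv vu.
  by rewrite subrr.
set D := \big[setU/set0]_(i < n) F i.
have mD : measurable D by exact: bigsetU_measurable.
have muD : mu D = (\sum_(i < n) (v i - u i))%:E.
  rewrite /D measure_bigsetU_ord// -sumEFin; apply: eq_bigr => i _.
  exact: muF.
have : (mu D < d%:E)%E by rewrite muD lte_fin; exact: H3.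
move=> /(Hd D mD); apply: le_lt_trans.
rewrite /Rintegral [in leRHS]/D.
rewrite (@ge0_integral_bigsetU _ _ _ mu _ F _ (index_enum 'I_n)) //; last 3 first.
- exact: index_enum_uniq.
- by apply: sub_trivIset tF.
- have : mu.-integrable D (abse \o (EFin \o g)).
    by apply: integrable_abse; apply: integrableS ig.
  exact: measurable_int.
rewrite -sum_fine; last first.
  move=> i _; apply: integrable_fin_num; first exact: mF.
  have : mu.-integrable (F i) (abse \o (EFin \o g)).
    by apply: integrable_abse; apply: integrableS ig => //; exact: mF.
  exact.
rewrite le_eqVlt; apply/orP; left; apply/eqP; apply: eq_bigr => i _; congr fine.
apply: eq_integral => x; rewrite inE /F/= in_itv/= => /andP[ux xv].
rewrite /g patchE ifT//= inE/= in_itv/=.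
have [u0 [_ vL]] := H1 i; apply/andP; split; lra.
Qed.

Lemma primitive_ac L F f : primitive L F f -> abs_continuous 0 L F.
Proof.
move=> pF e e0; have [d d0 Hd] := integral_abs_continuous pF.1 e0.
exists d => // n u v H1 H2 H3.
have H1' i : 0 <= u i /\ u i <= v i /\ v i <= L.
  by have [? [? ?]] := H1 i; split; [|split]; lra.
apply: le_lt_trans (Hd n u v H1' H2 H3); apply: ler_sum => i _.
have [u0 [uv vL]] := H1' i.
rewrite (primitive_increment pF u0 uv vL); apply: le_normr_Rintegral => //.
exact: integrable_subo pF.1.
Qed.

Lemma primitive_continuous L F f : primitive L F f ->
  {within `[0, L], continuous F}.
Proof.
move=> pF; apply/within_itv_continuousP => x /andP[x0 xL] e e0.
have [d d0 Hd] := integral_abs_continuous pF.1 e0.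
exists d => // y /andP[y0 yL] yx.
have main s t : 0 <= s -> s <= t -> t <= L -> t - s < d -> `|F t - F s| < e.
  move=> s0 st tL tsd.
  have := Hd 1%N (fun=> s) (fun=> t); rewrite !big_ord1 => /(_ _ _ tsd) H.
  apply: le_lt_trans (H _ _) => //; last by move=> i j; rewrite !ord1 eqxx.
  rewrite (primitive_increment pF s0 st tL); apply: le_normr_Rintegral => //.
  exact: integrable_subo pF.1.
have [yx'|xy] := leP y x.
  by rewrite distrC; apply: main => //; move: yx; rewrite distrC ger0_norm ?subr_ge0.
by apply: main => //; [exact: ltW|move: yx; rewrite ger0_norm ?subr_ge0// ltW].
Qed.

Lemma itv_oo_near (P : R -> Prop) a b x : a < x < b ->
  (forall y, a < y < b -> P y) -> \near x, P x.
Proof.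
move=> xab H; have : x \in `]a, b[%R by rewrite in_itv.
move=> /(near_in_itvoo) ; apply: filterS => y; rewrite in_itv/=; exact: H.
Qed.

Lemma primitive_derive_pt L F f x : primitive L F f -> 0 < x < L ->
  {for x, continuous f} -> is_derive x 1 F (f x).
Proof.
move=> [fL H] /andP[x0 xL] fx.
have [d1 d2] := @continuous_FTC1 R f (BLeft 0) x L xL fL x0 fx.
have D1 : is_derive x 1 (fun y => \int[mu]_(t in `[0, y]) f t) (f x).
  by apply: DeriveDef => //; rewrite -derive1E.
have := is_deriveD (is_derive_cst (F 0 : R) x 1) D1; rewrite add0r.
apply: near_eq_is_derive; apply: (@itv_oo_near _ 0 L); first by rewrite x0.
by move=> y /andP[y0 yL]; rewrite [RHS]H// !ltW.
Qed.

Lemma primitive_derive_ae L F f : primitive L F f ->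
  {ae mu, forall x, 0 < x < L -> is_derive x 1 F (f x)}.
Proof.
move=> [fL H]; pose g := f \_ `[0, L].
have ig : mu.-integrable setT (EFin \o g).
  by rewrite -restrict_EFin; apply/integrable_restrict => //=; rewrite setTI.
have lg : locally_integrable setT g by apply: integrable_locally.
have := @FTC1 R g (BLeft 0) (fun y => integrableS (mu := mu) measurableT (measurable_itv _) (@subsetT _ _) ig) lg.
apply: filterS; first exact: (ae_filter_ringOfSetsType mu).
move=> x /= Hx /andP[x0 xL].
have [|d1 d2] := Hx; first by rewrite lte_fin.
have gf : g x = f x by rewrite /g patchE mem_set//= in_itv/= !ltW.
rewrite -gf.
have D1 : is_derive x 1 (fun y => \int[mu]_(t in `[0, y]) g t) (g x).
  by apply: DeriveDef => //; rewrite -derive1E.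
have := is_deriveD (is_derive_cst (F 0 : R) x 1) D1; rewrite add0r.
apply: near_eq_is_derive; apply: (@itv_oo_near _ 0 L); first by rewrite x0.
move=> y /andP[y0 yL]; rewrite [RHS]H; last by rewrite !ltW.
congr (_ + _); apply: eq_Rintegral => t; rewrite inE/= in_itv/= => /andP[t0 ty].
by rewrite /g patchE mem_set//= in_itv/= t0 (le_trans ty)// ltW.
Qed.

End Primitive.

(** * Calculus of indefinite integrals *)

Section PrimitiveCalculus.
Variable R : realType.
Notation mu := (@lebesgue_measure R).
Implicit Types (F G f g : R -> R) (L a b x y : R).

Lemma abs_continuous_dominated a b K f g h : 0 < K ->
  (forall x y, a < x -> x <= y -> y < b ->
    `|h y - h x| <= K * (`|f y - f x| + `|g y - g x|)) ->
  abs_continuous a b f -> abs_continuous a b g -> abs_continuous a b h.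
Proof.
move=> K0 hfg acf acg e e0.
have e1 : 0 < e / (2 * K) by rewrite divr_gt0// mulr_gt0.
have [d1 d10 H1] := acf _ e1; have [d2 d20 H2] := acg _ e1.
exists (Num.min d1 d2); first by rewrite lt_min d10.
move=> n u v uv dis; rewrite lt_min => /andP[/(H1 _ _ _ uv dis) l1 /(H2 _ _ _ uv dis) l2].
apply: (@le_lt_trans _ _ (\sum_i K * (`|f (v i) - f (u i)| + `|g (v i) - g (u i)|))).
  by apply: ler_sum => i _; have [? [? ?]] := uv i; exact: hfg.
rewrite -mulr_sumr big_split/= -ltr_pdivlMl//.
have -> : K^-1 * e = e / (2 * K) + e / (2 * K) by field; lra.
exact: ltrD.
Qed.

Lemma continuous_oo_cst L F c : 0 < L -> {within `[0, L], continuous F} ->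
  (forall x, 0 < x < L -> F x = c) -> forall x, 0 <= x <= L -> F x = c.
Proof.
move=> L0 /within_itv_continuousP cF Fc x xL.
apply/eqP; rewrite -subr_eq0 -normr_le0; apply/ler_addgt0Pr => e e0; rewrite add0r.
have [d d0 Hd] := cF x xL e e0.
have [y yL yx] : exists2 y, 0 < y < L & `|y - x| < d.
  move: xL => /andP[x0 xL].
  pose m := Num.min d L; have m0 : 0 < m by rewrite lt_min d0.
  have md : m <= d by rewrite ge_min lexx.
  have mL : m <= L by rewrite ge_min lexx orbT.
  have [xh|xh] := ltP x (L / 2).
    exists (x + m / 4); first by apply/andP; split; lra.
    by rewrite addrC addKr gtr0_norm; lra.
  exists (x - m / 4); first by apply/andP; split; lra.
  by rewrite addrC addKr normrN gtr0_norm; lra.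
rewrite -(Fc y yL) distrC; apply/ltW/Hd => //.
by move/andP: yL => [? ?]; rewrite !ltW.
Qed.

Lemma primitive0 L f : mu.-integrable `[0, L] (EFin \o f) ->
  primitive L (fun x => \int[mu]_(t in `[0, x]) f t) f.
Proof.
by move=> fL; split => // x _; rewrite set_itv1 Rintegral_set1 add0r.
Qed.

Lemma within_continuousB a b F G : {within `[a, b], continuous F} ->
  {within `[a, b], continuous G} -> {within `[a, b], continuous (fun x => F x - G x)}.
Proof. by move=> cF cG x; apply: cvgB; [exact: cF|exact: cG]. Qed.

Lemma within_continuousD a b F G : {within `[a, b], continuous F} ->
  {within `[a, b], continuous G} -> {within `[a, b], continuous (fun x => F x + G x)}.
Proof. by move=> cF cG x; apply: cvgD; [exact: cF|exact: cG]. Qed.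

Lemma within_continuousM a b F G : {within `[a, b], continuous F} ->
  {within `[a, b], continuous G} -> {within `[a, b], continuous (fun x => F x * G x)}.
Proof. by move=> cF cG x; apply: cvgM; [exact: cF|exact: cG]. Qed.

Lemma within_continuousZ a b c F : {within `[a, b], continuous F} ->
  {within `[a, b], continuous (fun x => c * F x)}.
Proof. by move=> cF x; apply: cvgM; [exact: cvg_cst|exact: cF]. Qed.

Lemma within_continuous_cst a b c : {within `[a, b], continuous (fun _ : R => c : R)}.
Proof. by move=> x; exact: cvg_cst. Qed.

(** Continuity carries the constancy of the difference from the open interval to its
    ends. *)
Lemma primitive_of_cst_diff L F f : 0 < L -> mu.-integrable `[0, L] (EFin \o f) ->
  {within `[0, L], continuous F} ->
  (forall x y, 0 < x -> x <= y -> y < L ->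
     F x - \int[mu]_(t in `[0, x]) f t = F y - \int[mu]_(t in `[0, y]) f t) ->
  primitive L F f.
Proof.
move=> L0 fL cF H; split => // x xL.
have pF := primitive0 fL.
pose D := fun x => F x - \int[mu]_(t in `[0, x]) f t.
have cD : {within `[0, L], continuous D}.
  by apply: within_continuousB => //; exact: primitive_continuous pF.
have Dc : forall x, 0 <= x <= L -> D x = D (L / 2).
  apply: continuous_oo_cst => // y /andP[y0 yL].
  have [yh|/ltW hy] := leP y (L / 2); first by apply: H => //; lra.
  by apply/esym; apply: H => //; lra.
have D0 : D 0 = F 0 by rewrite /D set_itv1 Rintegral_set1 subr0.
have := Dc x xL; rewrite -(Dc 0) ?lexx ?ltW// D0 /D => <-; ring.
Qed.

(** The difference from the indefinite integral of [f] is absolutely continuous with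
    derivative zero almost everywhere. *)
Lemma ac_primitive L F f : 0 < L -> mu.-integrable `[0, L] (EFin \o f) ->
  {within `[0, L], continuous F} -> abs_continuous 0 L F ->
  {ae mu, forall x, 0 < x < L -> is_derive x 1 F (f x)} ->
  primitive L F f.
Proof.
move=> L0 fL cF acF aeF; apply: primitive_of_cst_diff => // a b a0 ab bL.
pose G := fun x => \int[mu]_(t in `[0, x]) f t.
have pG : primitive L G f by exact: primitive0.
apply: (@abs_continuous_derive0_cst R (F - G) 0 L) => //.
  apply: (@abs_continuous_dominated 0 L 1 F G) => //; last exact: primitive_ac pG.
  move=> x y _ _ _; rewrite mul1r.
  have -> : (F - G) y - (F - G) x = (F y - F x) - (G y - G x).
    by rewrite /GRing.sub_fun !fctE; ring.
  exact: ler_normB.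
have := primitive_derive_ae pG.
apply: filterS2 aeF; first exact: (ae_filter_ringOfSetsType mu).
move=> x /= H1 H2 xL.
rewrite -[0](subrr (f x)); apply: is_deriveB; [exact: H1|exact: H2].
Qed.

Lemma C1_primitive L F f : 0 < L -> {within `[0, L], continuous F} ->
  {within `[0, L], continuous f} ->
  (forall x, 0 < x < L -> is_derive x 1 F (f x)) -> primitive L F f.
Proof.
move=> L0 cF cf dF.
have fL := within_itv_integrable cf.
apply: primitive_of_cst_diff => // a b a0 ab bL.
pose G := fun x => \int[mu]_(t in `[0, x]) f t.
have pG : primitive L G f by exact: primitive0.
pose D := fun x => F x - G x.
have dD x : x \in `]a, b[%R -> is_derive x 1 D ((fun=> 0) x).
  rewrite in_itv/= => /andP[ax xb].
  have xL : 0 < x < L by apply/andP; split; lra.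
  have cfx : {for x, continuous f}.
    by have [H _ _] := (continuous_within_itvP f L0).1 cf; apply: H; rewrite in_itv.
  by have := is_deriveB (dF x xL) (primitive_derive_pt pG xL cfx); rewrite subrr.
have cD : {within `[a, b], continuous D}.
  apply: (@continuous_subspaceW _ _ _ `[0, L]).
    by apply: subset_itv; rewrite bnd_simp ltW.
  by apply: within_continuousB => //; exact: primitive_continuous pG.
have [c _] := MVT_segment ab dD cD.
by rewrite mul0r => /eqP; rewrite subr_eq0 => /eqP.
Qed.

Lemma primitive_ext L F G f g : 0 <= L -> (forall x, 0 <= x <= L -> F x = G x) ->
  (forall x, 0 <= x <= L -> f x = g x) -> primitive L F f -> primitive L G g.
Proof.
move=> L0 FG fg [fL H]; split.
  apply: eq_integrable fL => // x; rewrite inE/= in_itv/= => xL.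
  by rewrite /= fg.
move=> x /andP[x0 xL]; rewrite -!FG ?lexx ?x0// H ?x0//; congr (_ + _).
apply: eq_Rintegral => t; rewrite inE/= in_itv/= => /andP[t0 tx].
by rewrite fg// t0 (le_trans tx).
Qed.

Lemma integrableB_itv L f g : mu.-integrable `[0, L] (EFin \o f) ->
  mu.-integrable `[0, L] (EFin \o g) ->
  mu.-integrable `[0, L] (EFin \o (fun x => f x - g x)).
Proof. by move=> fL gL; have := integrableB (mu := mu) (measurable_itv _) fL gL; exact. Qed.

Lemma integrableD_itv L f g : mu.-integrable `[0, L] (EFin \o f) ->
  mu.-integrable `[0, L] (EFin \o g) ->
  mu.-integrable `[0, L] (EFin \o (fun x => f x + g x)).
Proof. by move=> fL gL; have := integrableD (mu := mu) (measurable_itv _) fL gL; exact. Qed.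

Lemma integrableZ_itv L c f : mu.-integrable `[0, L] (EFin \o f) ->
  mu.-integrable `[0, L] (EFin \o (fun x => c * f x)).
Proof. by move=> fL; have := integrableZl (mu := mu) (measurable_itv _) c fL; exact. Qed.

Lemma integrable_cst_itv L c : mu.-integrable `[0, L] (EFin \o (fun=> c : R)).
Proof. by apply: within_itv_integrable; exact: within_continuous_cst. Qed.

Lemma primitive_cst L c : primitive L (fun=> c) (fun=> 0).
Proof.
split; first exact: integrable_cst_itv.
by move=> x _; rewrite /Rintegral integral0/= addr0.
Qed.

Lemma primitiveD L F G f g : primitive L F f -> primitive L G g ->
  primitive L (fun x => F x + G x) (fun x => f x + g x).
Proof.
move=> [fL HF] [gL HG]; split; first exact: integrableD_itv.
move=> x xL; move/andP: (xL) => [x0 xL']; rewrite HF// HG// RintegralD//; first by ring.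
- exact: integrable_sub fL.
- exact: integrable_sub gL.
Qed.

Lemma primitiveZ L c F f : primitive L F f ->
  primitive L (fun x => c * F x) (fun x => c * f x).
Proof.
move=> [fL HF]; split; first exact: integrableZ_itv.
move=> x xL; move/andP: (xL) => [x0 xL']; rewrite HF// RintegralZl//; first by ring.
exact: integrable_sub fL.
Qed.

Lemma primitiveB L F G f g : primitive L F f -> primitive L G g ->
  primitive L (fun x => F x - G x) (fun x => f x - g x).
Proof.
move=> pF pG; have := primitiveD pF (primitiveZ (-1) pG).
congr (primitive _ _ _); apply/funext => x; ring.
Qed.

(** The increments of the product are dominated by those of the factors, because the
    factors are bounded; this is integration by parts for absolutely continuous
    functions. *)
Lemma primitiveM L F G f g : 0 < L -> primitive L F f -> primitive L G g ->
  primitive L (fun x => F x * G x) (fun x => f x * G x + F x * g x).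
Proof.
move=> L0 pF pG.
have cF := primitive_continuous pF; have cG := primitive_continuous pG.
have [M M0 FM] := within_itv_bounded cF; have [N N0 GN] := within_itv_bounded cG.
apply: ac_primitive => //.
- apply: integrableD_itv; last exact: integrableM_continuous pG.1.
  have := integrableM_continuous cG pF.1.
  by congr (_.-integrable _ _); apply/funext => x /=; rewrite mulrC.
- exact: within_continuousM.
- apply: (@abs_continuous_dominated 0 L (M + N) F G); first exact: addr_gt0.
  + move=> x y x0 xy yL.
    have -> : F y * G y - F x * G x = F y * (G y - G x) + G x * (F y - F x) by ring.
    apply: le_trans (ler_normD _ _) _; rewrite !normrM.
    have h1 : `|F y| <= M by apply: FM; apply/andP; split; lra.
    have h2 : `|G x| <= N by apply: GN; apply/andP; split; lra.
    have h3 := ler_wpM2r (normr_ge0 (G y - G x)) h1.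
    have h4 := ler_wpM2r (normr_ge0 (F y - F x)) h2.
    have h5 := mulr_ge0 (ltW N0) (normr_ge0 (G y - G x)).
    have h6 := mulr_ge0 (ltW M0) (normr_ge0 (F y - F x)).
    by rewrite mulrDl !mulrDr; lra.
  + exact: primitive_ac pF.
  + exact: primitive_ac pG.
- have := primitive_derive_ae pG; have := primitive_derive_ae pF.
  apply: filterS2; first exact: (ae_filter_ringOfSetsType mu).
  move=> x /= H1 H2 xL.
  have := is_deriveM (H1 xL) (H2 xL).
  by rewrite /GRing.scale/= addrC [G x * _]mulrC.
Qed.

(** The exponential is Lipschitz on the bounded range of [F]. *)
Lemma primitive_exp L F f : 0 < L -> primitive L F f ->
  primitive L (fun x => expR (F x)) (fun x => expR (F x) * f x).
Proof.
move=> L0 pF; have cF := primitive_continuous pF.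
have [M M0 FM] := within_itv_bounded cF.
have cE : {within `[0, L], continuous (fun x => expR (F x))}.
  by move=> x; apply: continuous_comp; [exact: cF|exact: continuous_expR].
have FMx x : 0 < x -> x < L -> F x <= M.
  by move=> x0 xL; apply: le_trans (ler_norm _) (FM x _); rewrite !ltW.
have lip s t : s <= t -> t <= M -> expR t - expR s <= expR M * (t - s).
  move=> st tM.
  have h1 := expR_ge1Dx (s - t).
  have h2 : expR s = expR t * expR (s - t) by rewrite -expRD; congr expR; ring.
  have h3 : expR t <= expR M by rewrite ler_expR.
  have h4 := ler_wpM2l (expR_ge0 t) h1.
  have h5 : expR t * (t - s) <= expR M * (t - s) by rewrite ler_wpM2r// subr_ge0.
  by rewrite h2; move: h4 h5; rewrite !mulrDr mulr1 !mulrN; lra.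
apply: ac_primitive => //.
- exact: integrableM_continuous pF.1.
- apply: (@abs_continuous_dominated 0 L (expR M) F F); first exact: expR_gt0.
  + move=> x y x0 xy yL.
    have h : `|expR (F y) - expR (F x)| <= expR M * `|F y - F x|.
      have FxM : F x <= M by apply: FMx => //; lra.
      have FyM : F y <= M by apply: FMx => //; lra.
      have [lxy|/ltW lyx] := leP (F x) (F y).
        by rewrite !ger0_norm ?subr_ge0 ?ler_expR//; exact: lip.
      rewrite distrC [X in _ * X]distrC.
      by rewrite !ger0_norm ?subr_ge0 ?ler_expR//; exact: lip.
    apply: le_trans h _; rewrite mulrDr lerDl mulr_ge0//; exact: expR_ge0.
  + exact: primitive_ac pF.
  + exact: primitive_ac pF.
- have := primitive_derive_ae pF.
  apply: filterS; first exact: (ae_filter_ringOfSetsType mu).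
  move=> x /= H1 xL.
  exact: is_derive1_comp (is_derive_expR (F x)) (H1 xL).
Qed.

End PrimitiveCalculus.

(** * Linear systems with integrable coefficients *)

Section LinearSystem.
Variable R : realType.
Notation mu := (@lebesgue_measure R).

Lemma half_expn_small (C e : R) : 0 <= C -> 0 < e -> exists k : nat, C * (2^-1) ^+ k < e.
Proof.
move=> C0 e0.
have := @cvg_geometric R C (2^-1).
rewrite gtr0_norm ?invr_gt0// invf_lt1// ltr1n => /(_ isT).
move=> /cvgrPdist_lt /(_ _ e0) [k _ /(_ k (leqnn k))].
rewrite /= sub0r normrN /geometric/= ger0_norm; first by exists k.
by rewrite mulr_ge0// exprn_ge0.
Qed.

Lemma le_half_expn (C r s : R) : 0 <= C ->
  (forall k : nat, r <= s + C * (2^-1) ^+ k) -> r <= s.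
Proof.
move=> C0 H; apply/ler_addgt0Pr => e /(half_expn_small C0)[k /ltW Ck].
by apply: le_trans (H k) _; rewrite lerD2l.
Qed.

(** The intervals of radius [2 C 2^-k] around [u k] are nested, and the supremum of
    their left ends lies in all of them. The explicit rate makes the limit uniform
    when [u] depends on a parameter. *)
Lemma geometric_steps_limit (u : nat -> R) (C : R) : 0 <= C ->
  (forall k, `|u k.+1 - u k| <= C * (2^-1) ^+ k) ->
  exists l, forall k, `|u k - l| <= 2 * C * (2^-1) ^+ k.
Proof.
move=> C0 H.
pose r k := 2 * C * (2^-1) ^+ k.
have r0 k : 0 <= r k by rewrite mulr_ge0// ?exprn_ge0// mulr_ge0.
have rS k : r k.+1 = r k - C * (2^-1) ^+ k by rewrite /r exprS; field.
have Hk k : u k.+1 - u k <= C * (2^-1) ^+ k /\ u k - u k.+1 <= C * (2^-1) ^+ k.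
  by have := H k; rewrite ler_norml => /andP[]; split; lra.
have aI i j : (i <= j)%N -> u i - r i <= u j - r j.
  move=> /subnK <-; elim: (j - i)%N => [|k IH]//; rewrite addSn.
  apply: le_trans IH _; rewrite rS; have := Hk (k + i)%N; lra.
have bI i j : (i <= j)%N -> u j + r j <= u i + r i.
  move=> /subnK <-; elim: (j - i)%N => [|k IH]//; rewrite addSn.
  apply: le_trans _ IH; rewrite rS; have := Hk (k + i)%N; lra.
have ab i j : u i - r i <= u j + r j.
  have := aI _ _ (leq_maxl i j); have := bI _ _ (leq_maxr i j).
  have := r0 (maxn i j); lra.
pose S := [set u k - r k | k in [set: nat]].
have hS : has_sup S.
  split; first by exists (u 0%N - r 0%N), 0%N.
  by exists (u 0%N + r 0%N) => _ [k _ <-].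
exists (sup S) => k; rewrite -/(r k) ler_distlC.
apply/andP; split; first by apply: sup_upper_bound => //; exists k.
by apply: ge_sup; [case: hS|move=> _ [j _ <-]].
Qed.

Variables (n : nat) (L : R) (A : 'I_n -> 'I_n -> R -> R).
Hypothesis L0 : 0 < L.
Hypothesis iA : forall i j, mu.-integrable `[0, L] (EFin \o A i j).

Let a t := \sum_i \sum_j `|A i j t|.
Let m x := \int[mu]_(t in `[0, x]) a t.
Let w x := expR (2 * m x).
Let cont (Y : 'I_n -> R -> R) := forall i, {within `[0, L], continuous (Y i)}.
Let V (Y : 'I_n -> R -> R) i x := \int[mu]_(t in `[0, x]) (\sum_j A i j t * Y j t).

Let integrable_sum_itv (I : Type) (s : seq I) (f : I -> R -> R) :
  (forall i, mu.-integrable `[0, L] (EFin \o f i)) ->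
  mu.-integrable `[0, L] (EFin \o (fun t => \sum_(i <- s) f i t)).
Proof.
move=> H; elim: s => [|i s IH].
  have := integrable_cst_itv L (0 : R); congr (_.-integrable _ _).
  by apply/funext => t /=; rewrite big_nil.
have := integrableD_itv (H i) IH; congr (_.-integrable _ _).
by apply/funext => t /=; rewrite big_cons.
Qed.

Let integrable_norm_itv (f : R -> R) : mu.-integrable `[0, L] (EFin \o f) ->
  mu.-integrable `[0, L] (EFin \o (fun t => `|f t|)).
Proof. by move=> fL; have := integrable_abse fL; exact. Qed.

Let ia : mu.-integrable `[0, L] (EFin \o a).
Proof.
by apply: integrable_sum_itv => i; apply: integrable_sum_itv => j; exact: integrable_norm_itv.
Qed.

Let a_ge0 t : 0 <= a t.
Proof. by apply: sumr_ge0 => i _; apply: sumr_ge0 => j _. Qed.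

Let pm : primitive L m a. Proof. exact: primitive0. Qed.

Let pw : primitive L w (fun t => w t * (2 * a t)).
Proof. by apply: primitive_exp => //; exact: primitiveZ. Qed.

Let m0 : m 0 = 0. Proof. by rewrite /m set_itv1 Rintegral_set1. Qed.

Let w0 : w 0 = 1. Proof. by rewrite /w m0 mulr0 expR0. Qed.

Let m_homo x y : 0 <= x -> x <= y -> y <= L -> m x <= m y.
Proof.
move=> x0 xy yL; rewrite -subr_ge0 (primitive_increment pm)//.
by apply: Rintegral_ge0 => t _.
Qed.

Let w_ge1 x : 0 <= x <= L -> 1 <= w x.
Proof.
move=> /andP[x0 xL]; rewrite -expR0 /w ler_expR mulr_ge0//.
by rewrite -m0; exact: m_homo.
Qed.

Let w_le x : 0 <= x <= L -> w x <= w L.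
Proof.
move=> /andP[x0 xL]; rewrite /w ler_expR ler_pM2l//; exact: m_homo.
Qed.

Let w_gt0 x : 0 < w x. Proof. exact: expR_gt0. Qed.

(** The weight is chosen so that the Volterra operator halves the weighted supremum
    norm, because [w' = 2 a w]. *)
Let integral_weight x : 0 <= x <= L -> \int[mu]_(t in `[0, x]) (a t * w t) <= w x / 2.
Proof.
move=> xL; have /andP[x0 xL'] := xL.
have : w x = 1 + 2 * \int[mu]_(t in `[0, x]) (a t * w t).
  have [iw /(_ x xL) {1}->] := pw.
  rewrite w0 -RintegralZl//; last first.
    apply: integrable_sub xL' _ => //.
    have := integrableM_continuous (primitive_continuous pw) ia.
    by congr (_.-integrable _ _); apply/funext => t /=; rewrite mulrC.
  congr (_ + _); apply: eq_Rintegral => t _; ring.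
lra.
Qed.

Let integrable_V Y i : cont Y ->
  mu.-integrable `[0, L] (EFin \o (fun t => \sum_j A i j t * Y j t)).
Proof.
move=> cY; apply: integrable_sum_itv => j.
have := integrableM_continuous (cY j) (iA i j).
by congr (_.-integrable _ _); apply/funext => t /=; rewrite mulrC.
Qed.

Let primitive_V Y i : cont Y -> primitive L (V Y i) (fun t => \sum_j A i j t * Y j t).
Proof. by move=> cY; apply: primitive0; exact: integrable_V. Qed.

Let V_half Y N : cont Y -> 0 <= N ->
  (forall i x, 0 <= x <= L -> `|Y i x| <= N * w x) ->
  forall i x, 0 <= x <= L -> `|V Y i x| <= N * w x / 2.
Proof.
move=> cY N0 YN i x xL; have /andP[x0 xL'] := xL.
have iV := integrable_sub (lexx 0) xL' (integrable_V i cY).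
apply: le_trans (le_normr_Rintegral _ iV) _ => //.
have iaw : mu.-integrable `[0, x] (EFin \o (fun t => a t * w t)).
  apply: integrable_sub xL' _ => //.
  have := integrableM_continuous (primitive_continuous pw) ia.
  by congr (_.-integrable _ _); apply/funext => t /=; rewrite mulrC.
have h1 : \int[mu]_(t in `[0, x]) `|\sum_j A i j t * Y j t| <=
          \int[mu]_(t in `[0, x]) (N * (a t * w t)).
  apply: le_Rintegral => //.
  - by have := integrable_abse iV; exact.
  - by have := integrableZl (mu := mu) (measurable_itv _) N iaw; exact.
  - move=> t /=; rewrite in_itv/= => /andP[t0 tx].
    apply: le_trans (ler_norm_sum _ _ _) _.
    apply: (@le_trans _ _ (\sum_j `|A i j t| * (N * w t))).
      apply: ler_sum => j _; rewrite normrM ler_wpM2l//; apply: YN.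
      by rewrite t0 (le_trans tx).
    have hA : \sum_j `|A i j t| <= a t.
      by rewrite /a [leRHS](bigD1 i)//= lerDl; apply: sumr_ge0 => k _; exact: sumr_ge0.
    rewrite -mulr_suml mulrCA ler_wpM2l//.
    by apply: ler_wpM2r => //; exact: ltW.
apply: le_trans h1 _; rewrite RintegralZl// -mulrA ler_wpM2l//.
exact: integral_weight.
Qed.

(** Each application of [V_half] halves the excess over [2 b w] of a bound that is
    crude at first. *)
Let gronwall Y b : cont Y -> 0 <= b ->
  (forall i x, 0 <= x <= L -> `|Y i x| <= b + `|V Y i x|) ->
  forall i x, 0 <= x <= L -> `|Y i x| <= 2 * b * w x.
Proof.
move=> cY b0 YV.
have [M M0 YM] : exists2 M, 0 < M & forall i x, 0 <= x <= L -> `|Y i x| <= M.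
  pose M i := sval (cid2 (within_itv_bounded (cY i))).
  have HM i : 0 < M i /\ forall x, 0 <= x <= L -> `|Y i x| <= M i.
    by rewrite /M; case: cid2 => /= ? ? ?.
  exists (1 + \sum_i M i) => [|i x xL].
    by rewrite ltr_pwDl// sumr_ge0// => i _; apply: ltW; case: (HM i).
  apply: le_trans ((HM i).2 x xL) _; rewrite (bigD1 i)//= addrCA lerDl addr_ge0//.
  by rewrite sumr_ge0// => j _; apply: ltW; case: (HM j).
have step k : forall i x, 0 <= x <= L -> `|Y i x| <= (2 * b + M * (2^-1) ^+ k) * w x.
  elim: k => [|k IH] i x xL.
    rewrite expr0 mulr1; apply: le_trans (YM i x xL) _.
    have h1 := w_ge1 xL; have h : 0 <= 2 * b + M by lra.
    by have := ler_wpM2l h h1; rewrite mulr1; lra.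
  have N0 : 0 <= 2 * b + M * (2^-1) ^+ k.
    by rewrite addr_ge0// mulr_ge0// ?exprn_ge0// ltW.
  apply: le_trans (YV i x xL) _.
  have h2 := V_half cY N0 IH i xL.
  have h1 := ler_wpM2l b0 (w_ge1 xL).
  have -> : (2 * b + M * 2^-1 ^+ k.+1) * w x =
     b * w x + (2 * b + M * 2^-1 ^+ k) * w x / 2 by rewrite exprS; field.
  by rewrite mulr1 in h1; lra.
move=> i x xL; apply: (@le_half_expn (M * w x)); first by rewrite mulr_ge0// ltW.
move=> k; have := step k i x xL; rewrite mulrDl => /le_trans; apply.
by rewrite lerD2l mulrAC.
Qed.

Lemma linear_system_bound : exists2 K, 0 < K &
  forall (Y b : 'I_n -> R -> R),
  (forall i, mu.-integrable `[0, L] (EFin \o b i)) ->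
  (forall i, primitive L (Y i) (fun t => \sum_j A i j t * Y j t + b i t)) ->
  forall i x, 0 <= x <= L -> `|Y i x| <=
    K * (\sum_j `|Y j 0| + \sum_j \int[mu]_(t in `[0, L]) `|b j t|).
Proof.
exists (2 * w L); first by rewrite mulr_gt0.
move=> Y b ib pY i x xL.
set s := _ + _.
have s0 : 0 <= s.
  by rewrite addr_ge0// sumr_ge0// => j _; apply: Rintegral_ge0 => t _.
have cY : cont Y by move=> j; exact: primitive_continuous (pY j).
have := gronwall cY s0 _ i xL => /(_ _) H.
apply: (@le_trans _ _ (2 * s * w x)); last first.
  by rewrite -!mulrA ler_pM2l// mulrC ler_wpM2r// w_le.
apply: H => j y yL; have /andP[y0 yL'] := yL.
have [_ /(_ y yL) ->] := pY j.
rewrite RintegralD//; last 2 first.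
- exact: integrable_sub (integrable_V j cY).
- exact: integrable_sub (ib j).
rewrite -/(V Y j y) addrA addrAC; apply: le_trans (ler_normD _ _) _.
rewrite lerD2r; apply: le_trans (ler_normD _ _) _; rewrite /s lerD//.
  by rewrite (bigD1 j)//= lerDl sumr_ge0.
apply: le_trans (le_normr_Rintegral _ _) _ => //.
  exact: integrable_sub (ib j).
apply: (@le_trans _ _ (\int[mu]_(t in `[0, L]) `|b j t|)).
  rewrite -subr_ge0 (@Rintegral_sub _ _ L)//; last exact: integrable_norm_itv.
  exact: Rintegral_ge0.
by rewrite (bigD1 j)//= lerDl sumr_ge0// => k _; apply: Rintegral_ge0.
Qed.

(** Picard iteration: by [V_half] the steps shrink by a factor two in the weighted
    norm. *)
Lemma linear_system_exists (b : 'I_n -> R -> R) (c : 'I_n -> R) :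
  (forall i, mu.-integrable `[0, L] (EFin \o b i)) ->
  exists Y : 'I_n -> R -> R, (forall i, Y i 0 = c i) /\
  forall i, primitive L (Y i) (fun t => \sum_j A i j t * Y j t + b i t).
Proof.
move=> ib; pose B i x := c i + \int[mu]_(t in `[0, x]) b i t.
have pB i : primitive L (B i) (fun t => 0 + b i t).
  by apply: primitiveD; [exact: primitive_cst|exact: primitive0].
have cB : cont B by move=> i; exact: primitive_continuous (pB i).
pose Y := fix Y k : 'I_n -> R -> R :=
  if k is k'.+1 then fun i x => B i x + V (Y k') i x else B.
have cY k : cont (Y k).
  elim: k => [//|k IH] i /=; apply: within_continuousD; first exact: cB.
  exact: primitive_continuous (primitive_V i IH).
have V_sub k k' i x : 0 <= x <= L ->
    V (Y k) i x - V (Y k') i x = V (fun j t => Y k j t - Y k' j t) i x.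
  move=> /andP[x0 xL]; rewrite /V -RintegralB//.
  - apply: eq_Rintegral => t _; rewrite -sumrB; apply: eq_bigr => j _; ring.
  - exact: integrable_sub (integrable_V i (cY k)).
  - exact: integrable_sub (integrable_V i (cY k')).
have [N N0 BN] : exists2 N, 0 < N & forall i x, 0 <= x <= L -> `|V B i x| <= N.
  pose M i := sval (cid2 (within_itv_bounded (primitive_continuous (primitive_V i cB)))).
  have HM i : 0 < M i /\ forall x, 0 <= x <= L -> `|V B i x| <= M i.
    by rewrite /M; case: cid2 => /= ? ? ?.
  exists (1 + \sum_i M i) => [|i x xL].
    by rewrite ltr_pwDl// sumr_ge0// => i _; apply: ltW; case: (HM i).
  apply: le_trans ((HM i).2 x xL) _; rewrite (bigD1 i)//= addrCA lerDl addr_ge0//.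
  by rewrite sumr_ge0// => j _; apply: ltW; case: (HM j).
have step k i x : 0 <= x <= L -> `|Y k.+1 i x - Y k i x| <= N * (2^-1) ^+ k * w x.
  elim: k i x => [|k IH] i x xL.
    rewrite /= addrAC subrr add0r expr0 mulr1; apply: le_trans (BN i x xL) _.
    by rewrite ler_peMr// ?w_ge1// ltW.
  have -> : Y k.+2 i x - Y k.+1 i x = V (Y k.+1) i x - V (Y k) i x by rewrite /=; ring.
  rewrite V_sub//.
  have -> : N * 2^-1 ^+ k.+1 * w x = N * 2^-1 ^+ k * w x / 2 by rewrite exprS; field.
  apply: V_half => //.
    by move=> j; apply: within_continuousB; exact: cY.
  by rewrite mulr_ge0// ?exprn_ge0// ltW.
have lim_ex (ix : 'I_n * R) : exists l, 0 <= ix.2 <= L ->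
    forall k, `|Y k ix.1 ix.2 - l| <= 2 * (N * w L) * (2^-1) ^+ k.
  case: ix => i x /=; have [xL|xL] := pselect (0 <= x <= L); last by exists 0.
  have NW : 0 <= N * w L by rewrite mulr_ge0// ltW.
  have [k|l Hl] := @geometric_steps_limit (fun k => Y k i x) (N * w L) NW; last by exists l.
  apply: le_trans (step k i x xL) _; rewrite [leRHS]mulrAC ler_wpM2l ?w_le//.
  by rewrite mulr_ge0// ?exprn_ge0// ltW.
have [Z HZ] := choice lim_ex.
pose y i x := Z (i, x).
have Hy k i x : 0 <= x <= L -> `|Y k i x - y i x| <= 2 * (N * w L) * (2^-1) ^+ k.
  by move=> xL; have := HZ (i, x) xL k.
set C := 2 * (N * w L) in Hy.
have C0 : 0 <= C by rewrite /C !mulr_ge0// ltW.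
have cy : cont y.
  move=> i; apply/within_itv_continuousP => x xL e e0.
  have e3 : 0 < e / 3 by rewrite divr_gt0.
  have [k Hk] := half_expn_small C0 e3.
  have [d d0 Hd] := (within_itv_continuousP _ _ _).1 (cY k i) x xL _ e3.
  exists d => // z zL zx.
  have h1 := le_lt_trans (Hy k i z zL) Hk; have h2 := le_lt_trans (Hy k i x xL) Hk.
  have h3 := Hd z zL zx.
  have -> : y i z - y i x =
    (Y k i z - Y k i x) - (Y k i z - y i z) + (Y k i x - y i x) by ring.
  apply: le_lt_trans (ler_normD _ _) _.
  have := ler_normB (Y k i z - Y k i x) (Y k i z - y i z); lra.
have fixy i x : 0 <= x <= L -> y i x = B i x + V y i x.
  move=> xL; apply/eqP; rewrite -subr_eq0 -normr_le0.
  apply: (@le_half_expn (C * (1 + w x))).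
    by rewrite mulr_ge0// addr_ge0// ltW.
  move=> k; rewrite add0r.
  have -> : y i x - (B i x + V y i x) =
    - (Y k.+1 i x - y i x) + (V (Y k) i x - V y i x) by rewrite /=; ring.
  apply: le_trans (ler_normD _ _) _; rewrite normrN.
  have C2 : 0 <= C * (2^-1) ^+ k by rewrite mulr_ge0// exprn_ge0.
  have h1 : `|Y k.+1 i x - y i x| <= C * (2^-1) ^+ k.
    apply: le_trans (Hy k.+1 i x xL) _; rewrite exprS; lra.
  have h2 : `|V (Y k) i x - V y i x| <= C * (2^-1) ^+ k * w x / 2.
    have -> : V (Y k) i x - V y i x = V (fun j t => Y k j t - y j t) i x.
      case/andP: xL => x0 xL'; rewrite /V -RintegralB//.
      - apply: eq_Rintegral => t _; rewrite -sumrB; apply: eq_bigr => j _; ring.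
      - exact: integrable_sub (integrable_V i (cY k)).
      - exact: integrable_sub (integrable_V i cy).
    apply: V_half => //.
      by move=> j; apply: within_continuousB; [exact: cY|exact: cy].
    move=> j z zL; apply: le_trans (Hy k j z zL) _.
    by rewrite ler_peMr// w_ge1.
  have h3 : 0 <= C * (2^-1) ^+ k * w x by rewrite mulr_ge0// ltW.
  have -> : C * (1 + w x) * 2^-1 ^+ k = C * 2^-1 ^+ k + C * 2^-1 ^+ k * w x by ring.
  lra.
exists y; split => i.
  rewrite fixy ?lexx ?ltW// /B /V set_itv1 !Rintegral_set1; ring.
have := primitiveD (pB i) (primitive_V i cy).
apply: primitive_ext; first exact: ltW.
- by move=> x xL; rewrite fixy.
- by move=> x xL; rewrite add0r addrC.
Qed.

End LinearSystem.

(** * Second-order equations in integral form *)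

Section Classical.
Variable R : realType.
Notation mu := (@lebesgue_measure R).
Implicit Types (u p k : R -> R) (L : R).

Lemma abs_continuous_ext a b (f g : R -> R) :
  (forall x, a < x < b -> f x = g x) -> abs_continuous a b f -> abs_continuous a b g.
Proof.
move=> fg acf; apply: (@abs_continuous_dominated R a b 1 f f) => // x y ax xy yb.
rewrite mul1r -!fg ?lerDl//; apply/andP; split; lra.
Qed.

Lemma within_cvg_at_right L (f : R -> R) : 0 < L ->
  {within `[0, L], continuous f} -> f x @[x --> 0^'+] --> f 0.
Proof. by move=> L0 /(continuous_within_itvP f L0)[]. Qed.

Lemma within_cvg_at_left L (f : R -> R) : 0 < L ->
  {within `[0, L], continuous f} -> f x @[x --> L^'-] --> f L.
Proof. by move=> L0 /(continuous_within_itvP f L0)[]. Qed.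

(** As [p] is continuous, [u] is continuously differentiable with derivative [p], and
    the one-sided limits of its derivative are the end values of [p]. *)
Lemma primitive_second_order L u p k : 0 < L -> primitive L u p -> primitive L p k ->
  [/\ abs_continuous 0 L u /\ {within `[0, L], continuous u},
      forall x, 0 < x < L -> derivable u x 1 /\ derive1 u x = p x,
      abs_continuous 0 L (derive1 u),
      {ae mu, forall x, 0 < x < L ->
        derivable (derive1 u) x 1 /\ derive1 (derive1 u) x = k x} &
      lim (derive1 u @ 0^'+) = p 0 /\ lim (derive1 u @ L^'-) = p L].
Proof.
move=> L0 pu pp; have cp := primitive_continuous pp.
have du x : 0 < x < L -> is_derive x 1 u (p x).
  move=> xL; have cpx : {for x, continuous p}.
    by have [H _ _] := (continuous_within_itvP p L0).1 cp; apply: H; rewrite in_itv.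
  exact: primitive_derive_pt pu xL cpx.
have d1 x : 0 < x < L -> derive1 u x = p x.
  by move=> /du [_ <-]; rewrite derive1E.
have near_d1 x : 0 < x < L -> \near x, p x = derive1 u x.
  by move=> xL; apply: (itv_oo_near xL) => y yL; rewrite d1.
split.
- by split; [exact: primitive_ac pu|exact: primitive_continuous pu].
- by move=> x xL; split; [case: (du x xL)|exact: d1].
- apply: abs_continuous_ext (primitive_ac pp) => x xL; by rewrite d1.
- have := primitive_derive_ae pp.
  apply: filterS; first exact: (ae_filter_ringOfSetsType mu).
  move=> x /= H xL; have := near_eq_is_derive (near_d1 x xL) (H xL).
  by move=> [? <-]; rewrite derive1E.
- split; apply/cvg_lim => //.
  + have h := within_cvg_at_right L0 cp.
    apply: cvg_trans h; apply: near_eq_cvg; near=> x; apply/esym/d1.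
    by apply/andP; split.
  + have h := within_cvg_at_left L0 cp.
    apply: cvg_trans h; apply: near_eq_cvg; near=> x; apply/esym/d1.
    by apply/andP; split.
Unshelve. all: by end_near. Qed.

(** Absolute continuity on the open interval gives the Cauchy criterion at the end. *)
Lemma abs_continuous_cvg_at_right L (f : R -> R) : 0 < L -> abs_continuous 0 L f ->
  cvg (f @ 0^'+).
Proof.
move=> L0 acf; apply/cauchy_cvgP/cauchy_exP => e e0.
have [d d0 Hd] := acf e e0.
have sub x y : 0 < x -> x <= y -> y < L -> y < d -> `|f y - f x| < e.
  move=> x0 xy yL yd.
  have := Hd 1%N (fun=> x) (fun=> y); rewrite !big_ord1; apply => //.
    by move=> i j; rewrite !ord1 eqxx.
  lra.
pose m := Num.min d L / 2.
have m0 : 0 < m by rewrite divr_gt0// lt_min d0.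
have md : m < d by rewrite ltr_pdivrMr// gt_min; apply/orP; left; lra.
have mL : m < L by rewrite ltr_pdivrMr// gt_min; apply/orP; right; lra.
exists (f m); suff : \forall x \near 0^'+, ball (f m) e (f x) by [].
near=> x; rewrite /ball/=.
have x0 : 0 < x by near: x; exact: nbhs_right_gt.
have xd : x < d by near: x; exact: nbhs_right_lt.
have xL : x < L by near: x; exact: nbhs_right_lt.
have [xy|/ltW yx] := leP x m; last by rewrite distrC; apply: sub.
by apply: sub.
Unshelve. all: by end_near. Qed.

Lemma abs_continuous_cvg_at_left L (f : R -> R) : 0 < L -> abs_continuous 0 L f ->
  cvg (f @ L^'-).
Proof.
move=> L0 acf; apply/cauchy_cvgP/cauchy_exP => e e0.
have [d d0 Hd] := acf e e0.
have sub x y : 0 < x -> x <= y -> y < L -> L - d < x -> `|f y - f x| < e.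
  move=> x0 xy yL yd.
  have := Hd 1%N (fun=> x) (fun=> y); rewrite !big_ord1; apply => //.
    by move=> i j; rewrite !ord1 eqxx.
  lra.
pose m := Num.max (L - d) 0 / 2 + L / 2.
have m0 : 0 < m by rewrite ltr_wpDl ?divr_gt0// divr_ge0// le_max lexx orbT.
have mL : m < L.
  have : Num.max (L - d) 0 < L by rewrite gt_max L0 andbT; lra.
  rewrite /m; lra.
have md : L - d < m.
  have : L - d <= Num.max (L - d) 0 by rewrite le_max lexx.
  rewrite /m; lra.
have Ld : L - d < L by lra.
exists (f m); suff : \forall x \near L^'-, ball (f m) e (f x) by [].
near=> x; rewrite /ball/=.
have x0 : 0 < x by near: x; exact: nbhs_left_gt.
have xd : L - d < x by near: x; exact: nbhs_left_gt.
have xL : x < L by near: x; exact: nbhs_left_lt.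
have [xy|/ltW yx] := leP x m; last by rewrite distrC; apply: sub.
by apply: sub.
Unshelve. all: by end_near. Qed.

(** The derivative of [u], absolutely continuous on the open interval, has limits at
    both ends; [p] is its continuous extension. *)
Lemma second_order_primitive L u k : 0 < L -> mu.-integrable `[0, L] (EFin \o k) ->
  {within `[0, L], continuous u} ->
  (forall x, 0 < x < L -> derivable u x 1) -> abs_continuous 0 L (derive1 u) ->
  {ae mu, forall x, 0 < x < L ->
    derivable (derive1 u) x 1 /\ derive1 (derive1 u) x = k x} ->
  exists2 p, primitive L u p & primitive L p k.
Proof.
move=> L0 ik cu du acu aeu.
pose l0 := lim (derive1 u @ 0^'+); pose lL := lim (derive1 u @ L^'-).
pose p x := if x <= 0 then l0 else if L <= x then lL else derive1 u x.
have pE x : 0 < x < L -> p x = derive1 u x.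
  by move=> /andP[x0 xL]; rewrite /p leNgt x0 leNgt xL.
have p0 : p 0 = l0 by rewrite /p lexx.
have pL : p L = lL by rewrite /p lexx leNgt L0.
have near_p x : 0 < x < L -> \near x, derive1 u x = p x.
  by move=> xL; apply: (itv_oo_near xL) => y yL; rewrite pE.
have acp : abs_continuous 0 L p by apply: abs_continuous_ext acu => x xL; rewrite pE.
have cp : {within `[0, L], continuous p}.
  apply/(continuous_within_itvP p L0); split.
  - move=> x; rewrite in_itv/= => xL.
    apply/cvgrPdist_lt => e e0; have [d d0 Hd] := acp e e0.
    have /andP[x0 xL'] := xL.
    near=> y.
    have y0 : 0 < y by near: y; exact: lt_nbhsr.
    have yL : y < L by near: y; exact: lt_nbhsl.
    have yd : `|x - y| < d.
      by near: y; apply/nbhs_ballP; exists d.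
    have sub s t : 0 < s -> s <= t -> t < L -> t - s < d -> `|p t - p s| < e.
      move=> s0 st tL std.
      have := Hd 1%N (fun=> s) (fun=> t); rewrite !big_ord1; apply => //.
      by move=> i j; rewrite !ord1 eqxx.
    have [xy|/ltW yx] := leP x y.
      rewrite distrC; apply: sub => //.
      by move: yd; rewrite distrC ger0_norm ?subr_ge0.
    by apply: sub => //; move: yd; rewrite ger0_norm ?subr_ge0.
  - rewrite p0; apply: cvg_trans (abs_continuous_cvg_at_right L0 acu).
    apply: near_eq_cvg; near=> x; apply/esym/pE; apply/andP; split => //.
  - rewrite pL; apply: cvg_trans (abs_continuous_cvg_at_left L0 acu).
    apply: near_eq_cvg; near=> x; apply/esym/pE; apply/andP; split => //.
exists p.
  apply: C1_primitive => // x xL; rewrite pE// derive1E; apply: DeriveDef => //; exact: du.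
apply: ac_primitive => //.
apply: filterS aeu; first exact: (ae_filter_ringOfSetsType mu).
move=> x /= H xL; have [h1 <-] := H xL.
apply: near_eq_is_derive (near_p x xL) _.
by rewrite [X in is_derive _ _ _ X]derive1E; apply: DeriveDef.
Unshelve. all: by end_near. Qed.

End Classical.

(** * Complex-valued functions *)

Section ComplexCalculus.
Variable R : realType.
Local Notation C := R[i].
Notation mu := (@lebesgue_measure R).
Implicit Types (F G f g : R -> C) (L : R) (z w c : C).

Lemma ReD z w : complex.Re (z + w) = complex.Re z + complex.Re w.
Proof. by case: z; case: w. Qed.
Lemma ImD z w : complex.Im (z + w) = complex.Im z + complex.Im w.
Proof. by case: z; case: w. Qed.
Lemma ReN z : complex.Re (- z) = - complex.Re z. Proof. by case: z. Qed.
Lemma ImN z : complex.Im (- z) = - complex.Im z. Proof. by case: z. Qed.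
Lemma ReM z w : complex.Re (z * w) =
  complex.Re z * complex.Re w - complex.Im z * complex.Im w.
Proof. by case: z; case: w. Qed.
Lemma ImM z w : complex.Im (z * w) =
  complex.Re z * complex.Im w + complex.Im z * complex.Re w.
Proof. by case: z; case: w. Qed.
Lemma ReC (x : R) : complex.Re (x%:C)%C = x. Proof. by []. Qed.
Lemma ImC (x : R) : complex.Im (x%:C)%C = 0. Proof. by []. Qed.
Lemma ReJ z : complex.Re (z^*)%C = complex.Re z. Proof. by case: z. Qed.
Lemma ImJ z : complex.Im (z^*)%C = - complex.Im z. Proof. by case: z. Qed.

Definition cE := (ReD, ImD, ReN, ImN, ReM, ImM, ReC, ImC, ReJ, ImJ).

Lemma complexP z w : complex.Re z = complex.Re w -> complex.Im z = complex.Im w -> z = w.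
Proof. by case: z => a b; case: w => c d /= -> ->. Qed.

(** A real-valued norm, whereas the norm of the complex numbers takes complex values;
    the estimates stay in the ordered field this way. *)
Definition cn z : R := `|complex.Re z| + `|complex.Im z|.

Lemma cn_ge0 z : 0 <= cn z. Proof. exact: addr_ge0. Qed.

Lemma cn0 : cn 0 = 0. Proof. by rewrite /cn /= !normr0 addr0. Qed.

Lemma cnN z : cn (- z) = cn z. Proof. by rewrite /cn !cE !normrN. Qed.

Lemma cnD z w : cn (z + w) <= cn z + cn w.
Proof.
rewrite /cn !cE; have := ler_normD (complex.Re z) (complex.Re w).
have := ler_normD (complex.Im z) (complex.Im w); lra.
Qed.

Lemma cnB z w : cn (z - w) <= cn z + cn w.
Proof. by apply: le_trans (cnD _ _) _; rewrite cnN. Qed.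

Lemma cnM z w : cn (z * w) <= cn z * cn w.
Proof.
rewrite /cn !cE.
have := ler_normB (complex.Re z * complex.Re w) (complex.Im z * complex.Im w).
have := ler_normD (complex.Re z * complex.Im w) (complex.Im z * complex.Re w).
rewrite !normrM !mulrDl !mulrDr; lra.
Qed.

Lemma cnJ z : cn (z^*)%C = cn z. Proof. by rewrite /cn !cE normrN. Qed.

Lemma cn_sum (I : Type) (s : seq I) (P : pred I) (f : I -> C) :
  cn (\sum_(i <- s | P i) f i) <= \sum_(i <- s | P i) cn (f i).
Proof.
elim/big_rec2: _ => [|i y x _ H]; first by rewrite cn0.
by apply: le_trans (cnD _ _) _; rewrite lerD2l.
Qed.

Lemma cn_eq0 z : cn z <= 0 -> z = 0.
Proof.
rewrite /cn => H; apply: complexP => /=; apply/eqP; rewrite -normr_le0.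
  by have := normr_ge0 (complex.Im z); lra.
by have := normr_ge0 (complex.Re z); lra.
Qed.

Definition cprimitive L F f : Prop :=
  primitive L (rpart F) (rpart f) /\ primitive L (ipart F) (ipart f).

Definition cintegrable L f : Prop :=
  mu.-integrable `[0, L] (EFin \o rpart f) /\ mu.-integrable `[0, L] (EFin \o ipart f).

Definition cint L f : C :=
  Complex (\int[mu]_(t in `[0, L]) rpart f t) (\int[mu]_(t in `[0, L]) ipart f t).

Lemma cprimitive_ext L F G f g : 0 <= L -> (forall x, 0 <= x <= L -> F x = G x) ->
  (forall x, 0 <= x <= L -> f x = g x) -> cprimitive L F f -> cprimitive L G g.
Proof.
move=> L0 FG fg [pr pi]; split.
  by apply: primitive_ext pr => // x xL; rewrite /rpart ?FG ?fg.
by apply: primitive_ext pi => // x xL; rewrite /ipart ?FG ?fg.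
Qed.

Lemma cprimitive_cst L c : cprimitive L (fun=> c) (fun=> 0).
Proof. by split; exact: primitive_cst. Qed.

Lemma cprimitiveD L F G f g : cprimitive L F f -> cprimitive L G g ->
  cprimitive L (fun x => F x + G x) (fun x => f x + g x).
Proof.
move=> [pr pi] [pr' pi']; split.
  have := primitiveD pr pr'.
  by congr (primitive _ _ _); apply/funext => x; rewrite /rpart cE.
have := primitiveD pi pi'.
by congr (primitive _ _ _); apply/funext => x; rewrite /ipart cE.
Qed.

Lemma cprimitiveM L F G f g : 0 < L -> cprimitive L F f -> cprimitive L G g ->
  cprimitive L (fun x => F x * G x) (fun x => f x * G x + F x * g x).
Proof.
move=> L0 [pr pi] [pr' pi']; split.
  have := primitiveB (primitiveM L0 pr pr') (primitiveM L0 pi pi').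
  by congr (primitive _ _ _); apply/funext => x; rewrite /rpart /ipart !cE; ring.
have := primitiveD (primitiveM L0 pr pi') (primitiveM L0 pi pr').
by congr (primitive _ _ _); apply/funext => x; rewrite /rpart /ipart !cE; ring.
Qed.

Lemma cprimitiveZ L c F f : 0 < L -> cprimitive L F f ->
  cprimitive L (fun x => c * F x) (fun x => c * f x).
Proof.
move=> L0 pF; have := cprimitiveM L0 (cprimitive_cst L c) pF.
by congr (cprimitive _ _ _); apply/funext => x; rewrite mul0r add0r.
Qed.

Lemma cprimitiveB L F G f g : 0 < L -> cprimitive L F f -> cprimitive L G g ->
  cprimitive L (fun x => F x - G x) (fun x => f x - g x).
Proof.
move=> L0 pF pG; have := cprimitiveD pF (cprimitiveZ (-1) L0 pG).
by congr (cprimitive _ _ _); apply/funext => x; rewrite mulN1r.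
Qed.

Lemma cprimitiveJ L F f : cprimitive L F f ->
  cprimitive L (fun x => (F x)^*%C) (fun x => (f x)^*%C).
Proof.
move=> [pr pi]; split.
  by have := pr; congr (primitive _ _ _); apply/funext => x; rewrite /rpart cE.
have := primitiveZ (-1) pi.
by congr (primitive _ _ _); apply/funext => x; rewrite /ipart cE mulN1r.
Qed.

Lemma cprimitive_cint L F f : 0 <= L -> cprimitive L F f -> F L - F 0 = cint L f.
Proof.
move=> L0 [[_ /(_ L)] + [_ /(_ L)]]; rewrite lexx L0 => /(_ isT) hr /(_ isT) hi.
rewrite /rpart /ipart in hr hi.
by apply: complexP; rewrite /cint /= !cE; [rewrite hr|rewrite hi]; ring.
Qed.

Lemma cprimitive_continuous L F f : cprimitive L F f -> c_continuous_on 0 L F.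
Proof.
by move=> [pr pi]; split; [exact: primitive_continuous pr|exact: primitive_continuous pi].
Qed.

Lemma c_continuous_integrable L f : c_continuous_on 0 L f -> cintegrable L f.
Proof. by move=> [cr ci]; split; exact: within_itv_integrable. Qed.

Lemma c_continuous_cst L c : c_continuous_on 0 L (fun=> c).
Proof. by split; exact: within_continuous_cst. Qed.

Lemma c_continuousD L f g : c_continuous_on 0 L f -> c_continuous_on 0 L g ->
  c_continuous_on 0 L (fun x => f x + g x).
Proof.
move=> [cr ci] [cr' ci']; split.
  rewrite (_ : rpart _ = (fun x => rpart f x + rpart g x)).
    exact: within_continuousD.
  by apply/funext => x; rewrite /rpart cE.
rewrite (_ : ipart _ = (fun x => ipart f x + ipart g x)).
  exact: within_continuousD.
by apply/funext => x; rewrite /ipart cE.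
Qed.

Lemma c_continuousM L f g : c_continuous_on 0 L f -> c_continuous_on 0 L g ->
  c_continuous_on 0 L (fun x => f x * g x).
Proof.
move=> [cr ci] [cr' ci']; split.
  rewrite (_ : rpart _ = (fun x => rpart f x * rpart g x - ipart f x * ipart g x)).
    by apply: within_continuousB; exact: within_continuousM.
  by apply/funext => x; rewrite /rpart cE.
rewrite (_ : ipart _ = (fun x => rpart f x * ipart g x + ipart f x * rpart g x)).
  by apply: within_continuousD; exact: within_continuousM.
by apply/funext => x; rewrite /ipart cE.
Qed.

Lemma c_continuousZ L c f : c_continuous_on 0 L f -> c_continuous_on 0 L (fun x => c * f x).
Proof. by move=> cf; apply: c_continuousM => //; exact: c_continuous_cst. Qed.

Lemma c_continuousJ L f : c_continuous_on 0 L f -> c_continuous_on 0 L (fun x => (f x)^*%C).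
Proof.
move=> [cr ci]; split.
  by rewrite (_ : rpart _ = rpart f)//; apply/funext => x; rewrite /rpart cE.
rewrite (_ : ipart _ = (fun x => -1 * ipart f x)); first exact: within_continuousZ.
by apply/funext => x; rewrite /ipart cE mulN1r.
Qed.

Lemma c_continuous_sum L (I : Type) (s : seq I) (P : pred I) (f : I -> R -> C) :
  (forall i, c_continuous_on 0 L (f i)) ->
  c_continuous_on 0 L (fun x => \sum_(i <- s | P i) f i x).
Proof.
move=> cf; elim: s => [|i s IH].
  rewrite (_ : (fun x => _) = (fun=> 0)); first exact: c_continuous_cst.
  by apply/funext => x; rewrite big_nil.
rewrite (_ : (fun x => _) =
  (fun x => (if P i then f i x else 0) + \sum_(i <- s | P i) f i x)).
  by apply: c_continuousD => //; case: (P i) => //; exact: c_continuous_cst.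
by apply/funext => x; rewrite big_cons; case: ifP => // _; rewrite add0r.
Qed.

Lemma c_continuous_bounded L f : c_continuous_on 0 L f ->
  exists2 M, 0 < M & forall x, 0 <= x <= L -> cn (f x) <= M.
Proof.
move=> [/within_itv_bounded[M M0 HM] /within_itv_bounded[N N0 HN]].
exists (M + N); first exact: addr_gt0.
by move=> x xL; apply: lerD; [exact: HM|exact: HN].
Qed.

Lemma cintegrableD L f g : cintegrable L f -> cintegrable L g ->
  cintegrable L (fun x => f x + g x).
Proof.
move=> [fr fi] [gr gi]; split.
  have := integrableD_itv fr gr.
  by congr (_.-integrable _ _); apply/funext => x; rewrite /rpart /= cE.
have := integrableD_itv fi gi.
by congr (_.-integrable _ _); apply/funext => x; rewrite /ipart /= cE.
Qed.

Lemma cintegrableM L f g : c_continuous_on 0 L f -> cintegrable L g ->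
  cintegrable L (fun x => f x * g x).
Proof.
move=> [fr fi] [gr gi]; split.
  have := integrableB_itv (integrableM_continuous fr gr) (integrableM_continuous fi gi).
  by congr (_.-integrable _ _); apply/funext => x; rewrite /rpart /= cE.
have := integrableD_itv (integrableM_continuous fr gi) (integrableM_continuous fi gr).
by congr (_.-integrable _ _); apply/funext => x; rewrite /ipart /= cE.
Qed.

Lemma cintegrableZ L c f : cintegrable L f -> cintegrable L (fun x => c * f x).
Proof. by move=> fL; apply: cintegrableM => //; exact: c_continuous_cst. Qed.

Lemma eq_cint L f g : (forall x, 0 <= x <= L -> f x = g x) -> cint L f = cint L g.
Proof.
move=> fg; rewrite /cint; congr Complex; apply: eq_Rintegral => x;
 by rewrite inE/= in_itv/= => xL; rewrite /rpart /ipart fg.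
Qed.

Lemma cintD L f g : cintegrable L f -> cintegrable L g ->
  cint L (fun x => f x + g x) = cint L f + cint L g.
Proof.
move=> [fr fi] [gr gi]; apply: complexP; rewrite /cint /= -RintegralD//.
  by apply: eq_Rintegral => x _; rewrite /rpart cE.
by apply: eq_Rintegral => x _; rewrite /ipart cE.
Qed.

Lemma cintZ L c f : cintegrable L f -> cint L (fun x => c * f x) = c * cint L f.
Proof.
move=> [fr fi]; apply: complexP.
  rewrite ReM [complex.Re (cint L f)]/= [complex.Im (cint L f)]/= -!RintegralZl//.
  rewrite -RintegralB//; [|exact: integrableZ_itv..].
  by apply: eq_Rintegral => x _; rewrite /rpart ReM.
rewrite ImM [complex.Re (cint L f)]/= [complex.Im (cint L f)]/= -!RintegralZl//.
rewrite -RintegralD//; [|exact: integrableZ_itv..].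
by apply: eq_Rintegral => x _; rewrite /ipart ImM.
Qed.

Lemma cint0 L : cint L (fun=> 0) = 0.
Proof. by rewrite /cint /Rintegral !integral0. Qed.

(** The indefinite integral of [|f|^2] is nondecreasing and vanishes at both ends, so
    it vanishes throughout, and so does its derivative. *)
Lemma cint_normsq_eq0 L f : 0 < L -> c_continuous_on 0 L f ->
  complex.Re (cint L (fun x => f x * (f x)^*%C)) = 0 ->
  forall x, 0 <= x <= L -> f x = 0.
Proof.
move=> L0 cf H.
pose g x := complex.Re (f x) ^+ 2 + complex.Im (f x) ^+ 2.
have [cr ci] := cf.
have cg : {within `[0, L], continuous g}.
  by apply: within_continuousD; exact: within_continuousM.
have g0 x : 0 <= g x by rewrite addr_ge0// sqr_ge0.
have ig := within_itv_integrable cg.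
pose G x := \int[mu]_(t in `[0, x]) g t.
have pG : primitive L G g by exact: primitive0.
have GL : G L = 0.
  by rewrite -H /G /cint /=; apply: eq_Rintegral => x _; rewrite /rpart /g !cE; ring.
have G0 x : 0 <= x <= L -> G x = 0.
  move=> /andP[x0 xL]; apply/eqP; rewrite eq_le; apply/andP; split.
    rewrite -GL -subr_ge0 (primitive_increment pG)//; exact: Rintegral_ge0.
  exact: Rintegral_ge0.
have gx0 : forall x, 0 < x < L -> g x = 0.
  move=> x xL; have cgx : {for x, continuous g}.
    by have [h _ _] := (continuous_within_itvP g L0).1 cg; apply: h; rewrite in_itv.
  have [_ <-] := primitive_derive_pt pG xL cgx.
  have /near_eq_derive -> : \near x, G x = cst 0 x.
    by apply: (itv_oo_near xL) => y /andP[y0 yL]; rewrite G0// !ltW.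
  exact: derive_cst.
have gx := continuous_oo_cst L0 cg gx0.
move=> x xL; have /eqP := gx x xL.
rewrite /g paddr_eq0 ?sqr_ge0// !sqrf_eq0 => /andP[/eqP hr /eqP hi].
exact: complexP.
Qed.

Lemma cint_normsq_ge0 L f : 0 <= complex.Re (cint L (fun x => f x * (f x)^*%C)).
Proof.
rewrite /cint /=; apply: Rintegral_ge0 => x _.
by rewrite /rpart !cE mulrN opprK addr_ge0// -expr2 sqr_ge0.
Qed.

Lemma cint_bound L f M : 0 <= L -> c_continuous_on 0 L f ->
  (forall x, 0 <= x <= L -> cn (f x) <= M) ->
  cn (cint L f) <= \int[mu]_(t in `[0, L]) cn (f t) /\
  \int[mu]_(t in `[0, L]) cn (f t) <= M * L.
Proof.
move=> L0 cf H; have [fr fi] := c_continuous_integrable cf.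
have afr : mu.-integrable `[0, L] (EFin \o (fun t => `|rpart f t|)).
  by have := integrable_abse fr; exact.
have afi : mu.-integrable `[0, L] (EFin \o (fun t => `|ipart f t|)).
  by have := integrable_abse fi; exact.
split.
  rewrite [leRHS](_ : _ = \int[mu]_(t in `[0, L]) `|rpart f t| +
                          \int[mu]_(t in `[0, L]) `|ipart f t|).
    by apply: lerD; apply: le_normr_Rintegral.
  by rewrite -RintegralD.
apply: (@le_trans _ _ (\int[mu]_(t in `[0, L]) (cst M t))).
  apply: le_Rintegral => //; first exact: integrableD_itv.
  exact: integrable_cst_itv.
have muL : mu `[0, L]%classic = L%:E.
  rewrite lebesgue_measure_itv/= lte_fin.
  by case: ltP => [_|h]; rewrite -?EFinB ?subr0//; have -> : L = 0 by apply: le_anti; rewrite h.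
rewrite Rintegral_cst//.
by apply: (eq_ind_r (fun t : \bar R => M * fine t <= M * L) _ muL).
Qed.

End ComplexCalculus.

(** * The equation on one edge *)

Section Edge.
Variable R : realType.
Local Notation C := R[i].
Notation mu := (@lebesgue_measure R).
Variables (L : R) (q : R -> R).
Hypothesis L0 : 0 < L.
Hypothesis iq : mu.-integrable `[0, L] (EFin \o q).
Implicit Types (f p g h : R -> C) (z c : C).

(** First-order form of [- f'' + q f = g] with [p] in the role of [f']. The end values
    of [p] replace the one-sided limits of the derivative. *)
Definition edge_eq f p g : Prop :=
  cprimitive L f p /\ cprimitive L p (fun t => (q t)%:C%C * f t - g t).

Lemma edge_eq_ext f f' p p' g g' : (forall x, 0 <= x <= L -> f x = f' x) ->
  (forall x, 0 <= x <= L -> p x = p' x) -> (forall x, 0 <= x <= L -> g x = g' x) ->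
  edge_eq f p g -> edge_eq f' p' g'.
Proof.
move=> ff pp gg [H1 H2]; split; first exact: cprimitive_ext (ltW L0) _ _ H1.
by apply: cprimitive_ext H2 => //; [exact: ltW|move=> x xL; rewrite ff ?gg].
Qed.

Lemma edge_eqD f p g f' p' g' : edge_eq f p g -> edge_eq f' p' g' ->
  edge_eq (fun x => f x + f' x) (fun x => p x + p' x) (fun x => g x + g' x).
Proof.
move=> [H1 H2] [H3 H4]; split; first exact: cprimitiveD.
have := cprimitiveD H2 H4; congr (cprimitive _ _ _); apply/funext => x; ring.
Qed.

Lemma edge_eqZ c f p g : edge_eq f p g ->
  edge_eq (fun x => c * f x) (fun x => c * p x) (fun x => c * g x).
Proof.
move=> [H1 H2]; split; first exact: cprimitiveZ.
have := cprimitiveZ c L0 H2; congr (cprimitive _ _ _); apply/funext => x; ring.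
Qed.

Lemma edge_eq0 : edge_eq (fun=> 0) (fun=> 0) (fun=> 0).
Proof.
split; first exact: cprimitive_cst.
have := cprimitive_cst L (0 : C); congr (cprimitive _ _ _).
by apply/funext => x; rewrite mulr0 subr0.
Qed.

Lemma edge_eq_sum (I : Type) (s : seq I) (f p g : I -> R -> C) :
  (forall i, edge_eq (f i) (p i) (g i)) ->
  edge_eq (fun x => \sum_(i <- s) f i x) (fun x => \sum_(i <- s) p i x)
    (fun x => \sum_(i <- s) g i x).
Proof.
move=> H; elim: s => [|i s IH].
  have := edge_eq0; congr (edge_eq _ _ _); apply/funext => x; by rewrite big_nil.
have := edge_eqD (H i) IH.
by congr (edge_eq _ _ _); apply/funext => x; rewrite big_cons.
Qed.

Lemma edge_eqJ f p g : edge_eq f p g ->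
  edge_eq (fun x => (f x)^*%C) (fun x => (p x)^*%C) (fun x => (g x)^*%C).
Proof.
move=> [H1 H2]; split; first exact: cprimitiveJ.
have := cprimitiveJ H2; congr (cprimitive _ _ _); apply/funext => x.
by apply: complexP; rewrite !cE; ring.
Qed.

(** The Wronskian of [f] and [f'] is a primitive of [g f' - f g']. *)
Lemma edge_green f p g f' p' g' : edge_eq f p g -> edge_eq f' p' g' ->
  (f L * p' L - p L * f' L) - (f 0 * p' 0 - p 0 * f' 0) =
  cint L (fun x => g x * f' x - f x * g' x).
Proof.
move=> [H1 H2] [H3 H4].
have := cprimitiveB L0 (cprimitiveM L0 H1 H4) (cprimitiveM L0 H2 H3).
move=> /cprimitive_cint /= -> //; last exact: ltW.
congr cint; apply/funext => x; ring.
Qed.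

(** The complex second-order equation as a real linear system for the real and
    imaginary parts of [f] and [f'], in this order. *)
Let sysA z (i j : 'I_4) (t : R) : R :=
  match (i : nat), (j : nat) with
  | 0%N, 2%N | 1%N, 3%N => 1
  | 2%N, 0%N | 3%N, 1%N => q t - complex.Re z
  | 2%N, 1%N => complex.Im z
  | 3%N, 0%N => - complex.Im z
  | _, _ => 0
  end.

Let sysb h (i : 'I_4) (t : R) : R :=
  match (i : nat) with
  | 2%N => - complex.Re (h t) | 3%N => - complex.Im (h t) | _ => 0
  end.

Let isysA z i j : mu.-integrable `[0, L] (EFin \o sysA z i j).
Proof.
have iqz : mu.-integrable `[0, L] (EFin \o (fun t => q t - complex.Re z)).
  by apply: integrableB_itv => //; exact: integrable_cst_itv.
case: i => [[|[|[|[|i]]]] Hi] //; case: j => [[|[|[|[|j]]]] Hj] //;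
  by rewrite /sysA /=; first [exact: iqz | exact: integrable_cst_itv].
Qed.

Let isysb h i : cintegrable L h -> mu.-integrable `[0, L] (EFin \o sysb h i).
Proof.
move=> [hr hi]; case: i => [[|[|[|[|i]]]] Hi] //; rewrite /sysb /=;
  try exact: integrable_cst_itv.
- have := integrableZ_itv (-1) hr.
  by congr (_.-integrable _ _); apply/funext => x /=; rewrite mulN1r.
- have := integrableZ_itv (-1) hi.
  by congr (_.-integrable _ _); apply/funext => x /=; rewrite mulN1r.
Qed.

Let sysE z h (Y : 'I_4 -> R -> R) t i :
  \sum_j sysA z i j t * Y j t + sysb h i t =
  match (i : nat) with
  | 0%N => Y (inord 2) t
  | 1%N => Y (inord 3) t
  | 2%N => (q t - complex.Re z) * Y (inord 0) t + complex.Im z * Y (inord 1) t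
             - complex.Re (h t)
  | _ => (q t - complex.Re z) * Y (inord 1) t - complex.Im z * Y (inord 0) t
             - complex.Im (h t)
  end.
Proof.
have E (k : 'I_4) m : (k : nat) = m -> k = inord m.
  by move=> km; apply: val_inj; rewrite /= inordK// -km.
rewrite !big_ord_recl big_ord0.
rewrite -(E ord0 0%N)// -(E (lift ord0 ord0) 1%N)//.
rewrite -(E (lift ord0 (lift ord0 ord0)) 2%N)//.
rewrite -(E (lift ord0 (lift ord0 (lift ord0 ord0))) 3%N)//.
case: i => [[|[|[|[|i]]]] Hi] //; rewrite /sysA /sysb /=; ring.
Qed.

Lemma edge_exists z h c0 c1 : cintegrable L h ->
  exists f p, [/\ edge_eq f p (fun t => h t + z * f t), f 0 = c0 & p 0 = c1].
Proof.
move=> ih.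
pose c (i : 'I_4) := match (i : nat) with
  | 0%N => complex.Re c0 | 1%N => complex.Im c0 | 2%N => complex.Re c1
  | _ => complex.Im c1 end.
have [Y [Y0 pY]] := linear_system_exists L0 (isysA z) c (fun i => isysb i ih).
have H0 := pY (inord 0); have H1 := pY (inord 1).
have H2 := pY (inord 2); have H3 := pY (inord 3).
pose f t : C := Complex (Y (inord 0) t) (Y (inord 1) t).
pose p t : C := Complex (Y (inord 2) t) (Y (inord 3) t).
exists f, p; split.
- split; split.
  + by apply: primitive_ext H0 => // [|x _]; [exact: ltW|rewrite sysE inordK].
  + by apply: primitive_ext H1 => // [|x _]; [exact: ltW|rewrite sysE inordK].
  + apply: primitive_ext H2 => // [|x _]; [exact: ltW|rewrite sysE inordK//].
    by rewrite /rpart !cE /f /=; ring.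
  + apply: primitive_ext H3 => // [|x _]; [exact: ltW|rewrite sysE inordK//].
    by rewrite /ipart !cE /f /=; ring.
- by apply: complexP; rewrite /= Y0 /c inordK.
- by apply: complexP; rewrite /= Y0 /c inordK.
Qed.

Lemma edge_bound z : exists2 K, 0 < K & forall f p h, cintegrable L h ->
  edge_eq f p (fun t => h t + z * f t) -> forall x, 0 <= x <= L ->
  cn (f x) + cn (p x) <= K * (cn (f 0) + cn (p 0) + \int[mu]_(t in `[0, L]) cn (h t)).
Proof.
have [K K0 HK] := linear_system_bound L0 (isysA z).
exists (4 * K); first by rewrite mulr_gt0.
move=> f p h ih [[H0 H1] [H2 H3]] x xL.
pose Y (i : 'I_4) := match (i : nat) with
  | 0%N => rpart f | 1%N => ipart f | 2%N => rpart p | _ => ipart p end.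
have pY i : primitive L (Y i) (fun t => \sum_j sysA z i j t * Y j t + sysb h i t).
  case: i => [[|[|[|[|i]]]] Hi] //.
  - by apply: primitive_ext H0 => // [|t _]; [exact: ltW|rewrite sysE /= /Y inordK].
  - by apply: primitive_ext H1 => // [|t _]; [exact: ltW|rewrite sysE /= /Y inordK].
  - apply: primitive_ext H2 => // [|t _]; [exact: ltW|rewrite sysE /= /Y !inordK//].
    by rewrite /rpart /ipart !cE; ring.
  - apply: primitive_ext H3 => // [|t _]; [exact: ltW|rewrite sysE /= /Y !inordK//].
    by rewrite /rpart /ipart !cE; ring.
have := HK Y (sysb h) (fun i => isysb i ih) pY.
set S := _ + _ => HY.
have SE : S = cn (f 0) + cn (p 0) + \int[mu]_(t in `[0, L]) cn (h t).
  have [hr hi] := ih.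
  have ahr : mu.-integrable `[0, L] (EFin \o (fun t => `|rpart h t|)).
    by have := integrable_abse hr; exact.
  have ahi : mu.-integrable `[0, L] (EFin \o (fun t => `|ipart h t|)).
    by have := integrable_abse hi; exact.
  rewrite /S !big_ord_recl !big_ord0 /Y /sysb /= /cn RintegralD//.
  rewrite !normr0 /Rintegral !integral0 /= !add0r !addr0 !addrA.
  by under eq_integral do rewrite normrN; under [X in _ + fine X = _]eq_integral do rewrite normrN.
rewrite -SE.
have := HY ord0 x xL; have := HY (lift ord0 ord0) x xL.
have := HY (lift ord0 (lift ord0 ord0)) x xL.
have := HY (lift ord0 (lift ord0 (lift ord0 ord0))) x xL.
rewrite /Y /= /rpart /ipart /cn; lra.
Qed.

Lemma edge_zero_org z f p : edge_eq f p (fun t => z * f t) -> f 0 = 0 -> p 0 = 0 ->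
  forall x, 0 <= x <= L -> f x = 0 /\ p x = 0.
Proof.
move=> H f0 p0 x xL; have [K K0 HK] := edge_bound z.
have H' : edge_eq f p (fun t => (fun=> 0) t + z * f t).
  by apply: edge_eq_ext H => // y _; rewrite add0r.
have := HK f p (fun=> 0) _ H' x xL.
have i0 : cintegrable L (fun=> 0 : C).
  by apply: c_continuous_integrable; exact: c_continuous_cst.
move=> /(_ i0); rewrite f0 p0 cn0 /Rintegral integral0 /= !addr0 mulr0 => h.
by split; apply: cn_eq0; have := cn_ge0 (f x); have := cn_ge0 (p x); lra.
Qed.

(** The Wronskian with any other solution takes the same value at both ends by Green's
    formula, and the other solution may have any Cauchy data at the near end. *)
Lemma edge_zero_ter z f p : edge_eq f p (fun t => z * f t) -> f L = 0 -> p L = 0 ->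
  forall x, 0 <= x <= L -> f x = 0 /\ p x = 0.
Proof.
move=> H fL pL.
have i0 : cintegrable L (fun=> 0 : C).
  by apply: c_continuous_integrable; exact: c_continuous_cst.
have W c0 c1 : f 0 * c1 - p 0 * c0 = 0.
  have [g [r [Hg g0 r0]]] := edge_exists z c0 c1 i0.
  have := edge_green H Hg; rewrite fL pL g0 r0 !mul0r subrr sub0r.
  rewrite (@eq_cint _ _ _ (fun=> 0)); last by move=> x _; ring.
  by rewrite cint0 => /eqP; rewrite oppr_eq0 => /eqP.
apply: (edge_zero_org H).
  by have := W 0 1; rewrite mulr1 mulr0 subr0.
by have := W 1 0; rewrite mulr0 mulr1 sub0r => /eqP; rewrite oppr_eq0 => /eqP.
Qed.

Lemma edge_eq_classical f p g : edge_eq f p g ->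
  [/\ [/\ c_abs_continuous 0 L f, forall x, 0 < x < L -> c_derivable f x &
          c_abs_continuous 0 L (c_der f)],
      c_continuous_on 0 L f,
      {ae mu, forall x, 0 < x < L -> c_derivable (c_der f) x /\
         - c_der (c_der f) x + (q x)%:C%C * f x = g x},
      c_lim (0^'+) (c_der f) = p 0 & c_lim (L^'-) (c_der f) = p L].
Proof.
move=> [[H0 H1] [H2 H3]].
have [[a1 a2] a3 a4 a5 [a6 a7]] := primitive_second_order L0 H0 H2.
have [[b1 b2] b3 b4 b5 [b6 b7]] := primitive_second_order L0 H1 H3.
split.
- split; [by split| |by split].
  by move=> x xL; split; [case: (a3 x xL)|case: (b3 x xL)].
- by split.
- apply: filterS2 a5 b5; first exact: (ae_filter_ringOfSetsType mu).
  move=> x /= Ha Hb xL; have [c1 c2] := Ha xL; have [d1 d2] := Hb xL.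
  split; first exact: conj c1 d1.
  have -> : c_der (c_der f) x = (q x)%:C%C * f x - g x.
    by apply: complexP; [exact: c2|exact: d2].
  by ring.
- by apply: complexP; [exact: a6|exact: b6].
- by apply: complexP; [exact: a7|exact: b7].
Qed.

Lemma classical_edge_eq f g : cintegrable L g -> c_continuous_on 0 L f ->
  (forall x, 0 < x < L -> c_derivable f x) -> c_abs_continuous 0 L (c_der f) ->
  {ae mu, forall x, 0 < x < L -> c_derivable (c_der f) x /\
     - c_der (c_der f) x + (q x)%:C%C * f x = g x} ->
  exists p, edge_eq f p g.
Proof.
move=> [gr gi] [cr ci] df [ar ai] ae.
have ik1 : mu.-integrable `[0, L] (EFin \o rpart (fun t => (q t)%:C%C * f t - g t)).
  have := integrableB_itv (integrableM_continuous cr iq) gr.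
  by congr (_.-integrable _ _); apply/funext => x /=; rewrite /rpart !cE; congr EFin; ring.
have ik2 : mu.-integrable `[0, L] (EFin \o ipart (fun t => (q t)%:C%C * f t - g t)).
  have := integrableB_itv (integrableM_continuous ci iq) gi.
  by congr (_.-integrable _ _); apply/funext => x /=; rewrite /ipart !cE; congr EFin; ring.
have [|p1 p1a p1b] := second_order_primitive L0 ik1 cr (fun x xL => (df x xL).1) ar.
  apply: filterS ae; first exact: (ae_filter_ringOfSetsType mu).
  move=> x /= H xL; have [[d1 d2] e] := H xL; split; first exact: d1.
  have e' : c_der (c_der f) x = (q x)%:C%C * f x - g x by rewrite -e; ring.
  have E := congr1 (@complex.Re R) e'. exact E.
have [|p2 p2a p2b] := second_order_primitive L0 ik2 ci (fun x xL => (df x xL).2) ai.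
  apply: filterS ae; first exact: (ae_filter_ringOfSetsType mu).
  move=> x /= H xL; have [[d1 d2] e] := H xL; split; first exact: d2.
  have e' : c_der (c_der f) x = (q x)%:C%C * f x - g x by rewrite -e; ring.
  have E := congr1 (@complex.Im R) e'. exact E.
by exists (fun x => Complex (p1 x) (p2 x)).
Qed.

End Edge.

(** * The boundary value problem on the graph *)

Section SquareSystem.
Variables (F : fieldType) (I : finType).

(** For index types without a distinguished order: the systems below are indexed by
    the endpoints of the edges. *)
Lemma square_system_inverse (m : I -> I -> F) :
  (forall x : I -> F, (forall i, \sum_j m i j * x j = 0) -> forall i, x i = 0) ->
  exists n : I -> I -> F, forall (y : I -> F) i,
    \sum_j m i j * (\sum_k n j k * y k) = y i.
Proof.
move=> inj.
pose M : 'M[F]_#|I| := \matrix_(i, j) m (enum_val i) (enum_val j).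
have re (g : I -> F) : \sum_j g j = \sum_(j < #|I|) g (enum_val j).
  by rewrite (reindex (@enum_val I I)) //=; apply: onW_bij; exact: enum_val_bij.
have Mu : M \in unitmx.
  rewrite -unitmx_tr -row_free_unit; apply/inj_row_free => v vM.
  apply/rowP => i; rewrite mxE -(enum_valK i).
  apply: (inj (fun u => v 0 (enum_rank u))) => u.
  have := congr1 (fun r : 'rV_#|I| => r 0 (enum_rank u)) vM.
  rewrite !mxE => {2}<-; rewrite re; apply: eq_bigr => j _.
  by rewrite !mxE enum_rankK enum_valK mulrC.
exists (fun j k => invmx M (enum_rank j) (enum_rank k)) => y i.
pose Y : 'cV[F]_#|I| := \col_k y (enum_val k).
have := congr1 (fun c : 'cV_#|I| => c (enum_rank i) 0) (mulKVmx Mu Y).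
rewrite [RHS]mxE enum_rankK => <-; rewrite mxE re; apply: eq_bigr => j _.
rewrite !mxE !enum_rankK enum_valK; congr (_ * _).
by rewrite re; apply: eq_bigr => k _; rewrite !mxE enum_valK.
Qed.

End SquareSystem.

Section GraphProblem.
Variables (R : realType) (G : metric_graph R).
Local Notation C := R[i].
Notation mu := (@lebesgue_measure R).
Variables (q : 'I_(nedges G) -> R -> R) (alpha : vertex G -> R).
Hypothesis hq : L1_potential q.
Implicit Types (f p g h : gfun G) (v : vertex G) (e : vertex G -> C).

Lemma vertex_ofE (x : endpoint G) (v : vertex G) : x \in val v -> vertex_of x = v.
Proof.
case: v => A HA /=; have := HA; move=> /imsetP[y _ Ay] xA; apply: val_inj => /=.
rewrite Ay; apply/setP => w; rewrite !inE.
have [_ H] := same_vertexP y x w.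
have xy : same_vertex y x by move: xA; rewrite Ay inE.
by rewrite (H xy).
Qed.

Lemma mem_vertex_of (x : endpoint G) : x \in val (vertex_of x).
Proof. by rewrite /= inE; have [] := same_vertexP x x x. Qed.

Lemma mem_vertex (x : endpoint G) v : (x \in val v) = (vertex_of x == v).
Proof.
apply/idP/eqP => [|<-]; [exact: vertex_ofE|exact: mem_vertex_of].
Qed.

Lemma vertex_reprK v : vertex_of (vertex_repr v) = v.
Proof. by apply: vertex_ofE; rewrite /vertex_repr; exact: xchooseP. Qed.

Definition sol f p g : Prop := forall j, edge_eq (len j) (q j) (f j) (p j) (g j).

(** [p] stands for [f']; the derivative points out of the edge, towards the vertex. *)
Definition end_der p (x : endpoint G) : C := if x.2 then p x.1 (len x.1) else - p x.1 0.

Definition vertex_der p v : C := \sum_(x : endpoint G | vertex_of x == v) end_der p x.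

(** The vertex problem in first-order form: the values of [p] replace the one-sided
    limits of derivatives, and continuity is comparison with the representative
    endpoint of the vertex. *)
Definition bvp f p g e : Prop :=
  [/\ sol f p g, forall x, end_val f x = vertex_val f (vertex_of x) &
      forall v, vertex_der p v - (alpha v)%:C%C * vertex_val f v = e v].

Lemma vertex_der_split p v : vertex_der p v =
  \sum_(j | ter j == v) p j (len j) - \sum_(j | org j == v) p j 0.
Proof.
rewrite /vertex_der -sumrN.
rewrite [LHS](eq_bigr (fun x : 'I_(nedges G) * bool => end_der p (x.1, x.2))); last by case.
rewrite [LHS](eq_bigl (fun x : 'I_(nedges G) * bool => vertex_of (x.1, x.2) == v)); last by case.
rewrite -(pair_big_dep xpredT (fun j b => vertex_of (j, b) == v)
            (fun j b => end_der p (j, b))) /=.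
rewrite (eq_bigr (fun j => (if ter j == v then p j (len j) else 0) +
                           (if org j == v then - p j 0 else 0))); last first.
  by move=> j _; rewrite big_mkcond big_bool.
by rewrite big_split/= -!big_mkcond.
Qed.

Lemma sol_continuous f p g j : sol f p g -> c_continuous_on 0 (len j) (f j).
Proof. by move=> /(_ j) [H _]; exact: cprimitive_continuous H. Qed.

Lemma c_continuous_square_integrable L (f : R -> C) : c_continuous_on 0 L f ->
  square_integrable 0 L f.
Proof.
move=> [cr ci]; split.
- exact: within_itv_measurable.
- exact: within_itv_measurable.
- have cg : {within `[0, L], continuous (fun x => rpart f x ^+ 2 + ipart f x ^+ 2)}.
    by apply: within_continuousD; exact: within_continuousM.
  have := @integrable_fin_num _ _ _ mu _ (measurable_itv _) _ (within_itv_integrable cg).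
  by rewrite /sqnorm_on ltey_eq => ->.
Qed.

Lemma square_integrable_sq L (f : R -> C) : square_integrable 0 L f ->
  mu.-integrable `[0, L] (EFin \o (fun x => rpart f x ^+ 2 + ipart f x ^+ 2)).
Proof.
move=> [mr mi foo]; apply/integrableP; split.
  apply/measurable_realfun.measurable_EFinP; apply: measurable_realfun.measurable_funD;
    exact: measurable_realfun.measurable_funX.
apply: le_lt_trans foo; rewrite le_eqVlt; apply/orP; left; apply/eqP.
by apply: eq_integral => x _; rewrite /= ger0_norm// addr_ge0// sqr_ge0.
Qed.

Lemma square_integrable_cintegrable L (f : R -> C) : square_integrable 0 L f ->
  cintegrable L f.
Proof.
move=> fL; have isq := square_integrable_sq fL; have [mr mi _] := fL.
have i1 := integrableD_itv (integrable_cst_itv L (1 : R)) isq.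
have sq (a b : R) : `|a| <= 1 + (a ^+ 2 + b ^+ 2).
  have : 0 <= (`|a| - 1) ^+ 2 by exact: sqr_ge0.
  rewrite sqrrB real_normK ?num_real// mulr1 expr1n.
  have := sqr_ge0 a; have := sqr_ge0 b; have := normr_ge0 a.
  rewrite mulr2n; lra.
split; apply: (le_integrable _ _ _ i1) => //; try exact/measurable_realfun.measurable_EFinP.
- move=> x _ /=; rewrite lee_fin [leRHS]ger0_norm ?addr_ge0 ?sqr_ge0//.
- move=> x _ /=; rewrite lee_fin [leRHS]ger0_norm ?addr_ge0 ?sqr_ge0//.
  by rewrite [X in 1 + X]addrC; exact: sq.
Qed.

Lemma bvp_classical f p g e : bvp f p g e ->
  [/\ L2 f /\ AC2 f, L_eq q f g, graph_continuous f &
      forall v, delta_val alpha f v = e v].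
Proof.
move=> [Hs Hc He].
have cl j := edge_eq_classical (len_gt0 j) (Hs j).
split.
- split=> j; first by apply: c_continuous_square_integrable; exact: sol_continuous Hs.
  by have [] := cl j.
- by move=> j; have [] := cl j.
- split=> [j|x y xy]; first by have [] := cl j.
  by rewrite Hc [RHS]Hc xy.
- move=> v; rewrite -He /delta_val; congr (_ - _).
  rewrite vertex_der_split /dnu; congr (_ - _); apply: eq_bigr => j _.
    by have [] := cl j.
  by have [] := cl j.
Qed.

Lemma classical_bvp f g e : (forall j, cintegrable (len j) (g j)) -> AC2 f ->
  L_eq q f g -> graph_continuous f -> (forall v, delta_val alpha f v = e v) ->
  exists p, bvp f p g e.
Proof.
move=> ig acf Lf [cf vf] ef.
have ex j : exists p : R -> C, edge_eq (len j) (q j) (f j) p (g j).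
  have [a1 a2 a3] := acf j.
  exact: (classical_edge_eq (len_gt0 j) (hq j) (ig j) (cf j) a2 a3 (Lf j)).
have [p Hp] := choice ex.
exists p; split=> //.
  by move=> x; rewrite /vertex_val; apply: vf; rewrite vertex_reprK.
move=> v; rewrite -ef /delta_val; congr (_ - _).
rewrite vertex_der_split /dnu; congr (_ - _); apply: eq_bigr => j _; apply/esym.
  by have [] := edge_eq_classical (len_gt0 j) (Hp j).
by have [] := edge_eq_classical (len_gt0 j) (Hp j).
Qed.

Lemma eq_on_graph_end_val f g (x : endpoint G) : eq_on_graph f g -> end_val f x = end_val g x.
Proof.
move=> H; rewrite /end_val; apply: H; have := len_gt0 x.1.
by case: x.2 => h; rewrite ?lexx ltW.
Qed.

Lemma sol_zero_der f p g : sol f p g -> eq_on_graph f (@gfun0 R G) -> eq_on_graph p (@gfun0 R G).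
Proof.
move=> Hs f0 j; have [[H1 H2] [H3 H4]] := Hs j; have L0 := len_gt0 j.
have main (u w k : R -> R) : primitive (len j) u w -> primitive (len j) w k ->
    (forall x, 0 <= x <= len j -> u x = 0) -> forall x, 0 <= x <= len j -> w x = 0.
  move=> pu pw u0; have cw := primitive_continuous pw.
  apply: (continuous_oo_cst L0 cw) => x xL.
  have cwx : {for x, continuous w}.
    by have [h _ _] := (continuous_within_itvP w L0).1 cw; apply: h; rewrite in_itv.
  have [_ <-] := primitive_derive_pt pu xL cwx.
  have /near_eq_derive -> : \near x, u x = cst 0 x.
    by apply: (itv_oo_near xL) => y /andP[y0 yL]; rewrite u0// !ltW.
  exact: derive_cst.
move=> x xL; apply: complexP.
  by apply: (main _ _ _ H1 H3) => // y yL; rewrite /rpart f0.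
by apply: (main _ _ _ H2 H4) => // y yL; rewrite /ipart f0.
Qed.

End GraphProblem.

(** * The bordered problem *)

Section Fredholm.
Variables (R : realType) (G : metric_graph R).
Local Notation C := R[i].
Notation mu := (@lebesgue_measure R).
Variables (q : 'I_(nedges G) -> R -> R) (alpha : vertex G -> R).
Hypothesis hq : L1_potential q.
Implicit Types (f p g h : gfun G) (v : vertex G) (e : vertex G -> C).

Definition gcont f : Prop := forall j, c_continuous_on 0 (len j) (f j).
Definition gintegrable f : Prop := forall j, cintegrable (len j) (f j).

Definition inner f g : C := \sum_j cint (len j) (fun t => f j t * (g j t)^*%C).

Definition gcomb (I : finType) (c : I -> C) (S : I -> gfun G) : gfun G :=
  fun j t => \sum_i c i * S i j t.

Definition gadd f g : gfun G := fun j t => f j t + g j t.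
Definition gscale (c : C) f : gfun G := fun j t => c * f j t.

Lemma gcont_comb (I : finType) (c : I -> C) (S : I -> gfun G) :
  (forall i, gcont (S i)) -> gcont (gcomb c S).
Proof. by move=> H j; apply: c_continuous_sum => i; apply: c_continuousZ; exact: H. Qed.

Lemma gcont_add f g : gcont f -> gcont g -> gcont (gadd f g).
Proof. by move=> cf cg j; exact: c_continuousD. Qed.

Lemma gcont_integrable f : gcont f -> gintegrable f.
Proof. by move=> cf j; exact: c_continuous_integrable. Qed.

Lemma innerD f f' g : gcont f -> gcont f' -> gcont g ->
  inner (gadd f f') g = inner f g + inner f' g.
Proof.
move=> cf cf' cg; rewrite /inner -big_split; apply: eq_bigr => j _ /=.
rewrite -cintD; last 2 first.
- by apply: c_continuous_integrable; apply: c_continuousM => //; exact: c_continuousJ.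
- by apply: c_continuous_integrable; apply: c_continuousM => //; exact: c_continuousJ.
by apply: eq_cint => t _; rewrite mulrDl.
Qed.

Lemma innerZ c f g : gcont f -> gcont g -> inner (gscale c f) g = c * inner f g.
Proof.
move=> cf cg; rewrite /inner mulr_sumr; apply: eq_bigr => j _ /=.
rewrite -cintZ.
  by apply: eq_cint => t _; rewrite mulrA.
by apply: c_continuous_integrable; apply: c_continuousM => //; exact: c_continuousJ.
Qed.

Lemma inner_comb (I : finType) (c : I -> C) (S : I -> gfun G) g :
  (forall i, gcont (S i)) -> gcont g ->
  inner (gcomb c S) g = \sum_i c i * inner (S i) g.
Proof.
move=> cS cg.
suff H (s : seq I) : inner (fun j t => \sum_(i <- s) c i * S i j t) g =
    \sum_(i <- s) c i * inner (S i) g by exact: H.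
elim: s => [|i s IH].
  rewrite big_nil /inner big1// => j _; rewrite -[RHS](cint0 (len j)).
  by apply: eq_cint => t _; rewrite /= big_nil mul0r.
rewrite big_cons -innerZ// -IH -innerD//.
- by congr inner; apply/funext => j; apply/funext => t; rewrite big_cons.
- by move=> j; apply: c_continuousZ; exact: cS.
- by move=> j; apply: c_continuous_sum => k; apply: c_continuousZ; exact: cS.
Qed.

Lemma inner_congr f f' g g' : eq_on_graph f f' -> eq_on_graph g g' -> inner f g = inner f' g'.
Proof.
move=> ff gg; apply: eq_bigr => j _; apply: eq_cint => t tL.
by rewrite ff ?gg.
Qed.

Lemma inner_combr (I : finType) (c : I -> C) (S : I -> gfun G) f :
  (forall i, gcont (S i)) -> gcont f ->
  inner f (gcomb c S) = \sum_i (c i)^*%C * inner f (S i).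
Proof.
move=> cS cf.
have int1 j (g : gfun G) : gcont g -> cintegrable (len j) (fun t => f j t * (g j t)^*%C).
  by move=> cg; apply: c_continuous_integrable; apply: c_continuousM => //; exact: c_continuousJ.
suff H (s : seq I) : inner f (fun j t => \sum_(i <- s) c i * S i j t) =
    \sum_(i <- s) (c i)^*%C * inner f (S i) by exact: H.
elim: s => [|i s IH].
  rewrite big_nil /inner big1// => j _; rewrite -[RHS](cint0 (len j)).
  by apply: eq_cint => t _; rewrite /= big_nil conjc0 mulr0.
rewrite big_cons -IH /inner mulr_sumr -big_split; apply: eq_bigr => j _ /=.
rewrite -cintZ; last exact: int1.
rewrite -cintD; last 2 first.
- by apply: cintegrableZ; exact: int1.
- by apply: (int1 j (fun j t => \sum_(i <- s) c i * S i j t)) => l;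
    apply: c_continuous_sum => k; apply: c_continuousZ; exact: cS.
apply: eq_cint => t _; rewrite big_cons; apply: complexP; rewrite !cE; ring.
Qed.

Lemma inner_eq0 f : gcont f -> inner f f = 0 -> eq_on_graph f (@gfun0 R G).
Proof.
move=> cf H.
have Hr : \sum_j complex.Re (cint (len j) (fun t => f j t * (f j t)^*%C)) = 0.
  rewrite -[RHS](congr1 (@complex.Re R) H) /inner.
  by rewrite (big_morph (@complex.Re R) (id1 := 0) (op1 := +%R))//; exact: ReD.
move=> j t tL; apply: (cint_normsq_eq0 (len_gt0 j)) => //.
move/eqP: Hr; rewrite psumr_eq0; last by move=> k _; exact: cint_normsq_ge0.
by move=> /allP /(_ j (mem_index_enum _)) /= /eqP.
Qed.

(** One functional per endpoint: the delta condition at the representative of a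
    vertex, continuity elsewhere. There are thus as many vertex conditions as Cauchy
    data on the edges. *)
Definition vcond f p (x : endpoint G) : C :=
  if x == vertex_repr (vertex_of x)
  then vertex_der p (vertex_of x) - (alpha (vertex_of x))%:C%C * vertex_val f (vertex_of x)
  else end_val f x - vertex_val f (vertex_of x).

Definition vdata e (x : endpoint G) : C :=
  if x == vertex_repr (vertex_of x) then e (vertex_of x) else 0.

Lemma bvpP f p g e : bvp q alpha f p g e <->
  sol q f p g /\ forall x, vcond f p x = vdata e x.
Proof.
split=> [[H1 H2 H3]|[H1 H2]].
  split=> // x; rewrite /vcond /vdata; case: eqP => _; first exact: H3.
  by rewrite H2 subrr.
split=> // [x|v].
  have := H2 x; rewrite /vcond /vdata; case: eqP => [xr _|_ /eqP].
    by rewrite /vertex_val -xr.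
  by rewrite subr_eq0 => /eqP.
by have := H2 (vertex_repr v); rewrite /vcond /vdata vertex_reprK eqxx.
Qed.

Lemma end_der_comb (I : finType) (c : I -> C) (P : I -> gfun G) x :
  end_der (gcomb c P) x = \sum_i c i * end_der (P i) x.
Proof.
rewrite /end_der /gcomb; case: x.2 => //.
by rewrite -sumrN; apply: eq_bigr => i _; rewrite mulrN.
Qed.

Lemma vertex_der_comb (I : finType) (c : I -> C) (P : I -> gfun G) v :
  vertex_der (gcomb c P) v = \sum_i c i * vertex_der (P i) v.
Proof.
rewrite /vertex_der (eq_bigr _ (fun x _ => end_der_comb c P x)) exchange_big /=.
by apply: eq_bigr => i _; rewrite mulr_sumr.
Qed.

Lemma vertex_val_comb (I : finType) (c : I -> C) (S : I -> gfun G) v :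
  vertex_val (gcomb c S) v = \sum_i c i * vertex_val (S i) v.
Proof. by []. Qed.

Lemma vcond_comb (I : finType) (c : I -> C) (S P : I -> gfun G) x :
  vcond (gcomb c S) (gcomb c P) x = \sum_i c i * vcond (S i) (P i) x.
Proof.
rewrite /vcond; case: ifP => _.
  rewrite vertex_der_comb vertex_val_comb mulr_sumr -sumrB.
  by apply: eq_bigr => i _; ring.
rewrite vertex_val_comb {1}/end_val /gcomb -sumrB.
by apply: eq_bigr => i _; rewrite -mulrBr.
Qed.

Lemma vcondD f f' p p' x : vcond (gadd f f') (gadd p p') x = vcond f p x + vcond f' p' x.
Proof.
have dD y : end_der (gadd p p') y = end_der p y + end_der p' y.
  by rewrite /end_der /gadd; case: y.2 => //; ring.
rewrite /vcond /vertex_der; case: ifP => _.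
  rewrite (eq_bigr _ (fun y _ => dD y)) big_split /=.
  rewrite {1}/vertex_val {1}/end_val /gadd /=; rewrite -!/(end_val _ _) -!/(vertex_val _ _).
  by rewrite /vertex_val /end_val; ring.
by rewrite /vertex_val /end_val /gadd; ring.
Qed.

Lemma solD f p g f' p' g' : sol q f p g -> sol q f' p' g' ->
  sol q (gadd f f') (gadd p p') (gadd g g').
Proof. by move=> H H' j; exact: edge_eqD. Qed.

Lemma sol_comb (I : finType) (c : I -> C) (S P Gs : I -> gfun G) :
  (forall i, sol q (S i) (P i) (Gs i)) ->
  sol q (gcomb c S) (gcomb c P) (gcomb c Gs).
Proof.
by move=> H j; apply: edge_eq_sum => i; apply: edge_eqZ; [exact: len_gt0|exact: H].
Qed.

Lemma sol_ext f f' p p' g g' : eq_on_graph f f' -> eq_on_graph p p' -> eq_on_graph g g' ->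
  sol q f p g -> sol q f' p' g'.
Proof.
by move=> ff pp gg H j; apply: edge_eq_ext (H j); [exact: len_gt0|exact: ff|exact: pp|exact: gg].
Qed.

Definition L1norm h : R := \sum_j \int[mu]_(t in `[0, len j]) cn (h j t).

Variables (d : nat) (phi : 'I_d -> gfun G).
Hypothesis cphi : forall k, gcont (phi k).

(** At an eigenvalue the boundary value problem is neither solvable nor uniquely
    solvable. For a basis [phi] of the kernel, multiples of the [phi k] added to the
    right-hand side make it solvable, and prescribed inner products with the [phi k]
    single out one solution. *)
Definition bordered z f p (a : 'I_d -> C) h e (b : 'I_d -> C) : Prop :=
  bvp q alpha f p (fun j t => (h j t - gcomb a phi j t) + z * f j t) e /\
  forall k, inner f (phi k) = b k.

Definition bordered_injective z : Prop := forall f p a,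
  bordered z f p a (@gfun0 R G) (fun=> 0) (fun=> 0) ->
  eq_on_graph f (@gfun0 R G) /\ forall k, a k = 0.

Let U : finType := (endpoint G + 'I_d)%type.

(** The conditions of the bordered problem, two for each edge and one for each [phi k],
    as many as there are Cauchy data and border unknowns. *)
Let out f p (u : U) : C :=
  match u with inl x => vcond f p x | inr k => inner f (phi k) end.

Let out_comb (I : finType) (c : I -> C) (S P : I -> gfun G) u :
  (forall i, gcont (S i)) -> out (gcomb c S) (gcomb c P) u = \sum_i c i * out (S i) (P i) u.
Proof. by move=> cS; case: u => [x|k] /=; [exact: vcond_comb|exact: inner_comb]. Qed.

Let outD f f' p p' u : gcont f -> gcont f' ->
  out (gadd f f') (gadd p p') u = out f p u + out f' p' u.
Proof. by move=> cf cf'; case: u => [x|k] /=; [exact: vcondD|exact: innerD]. Qed.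

Let out_bound : exists2 D, 0 < D & forall f p m, 0 <= m -> gcont f ->
  (forall j t, 0 <= t <= len j -> cn (f j t) <= m /\ cn (p j t) <= m) ->
  forall u, cn (out f p u) <= D * m.
Proof.
have HM0 (kj : 'I_d * 'I_(nedges G)) : exists m : R, 0 < m /\
    forall t, 0 <= t <= len kj.2 -> cn (phi kj.1 kj.2 t) <= m.
  by have [m m0 Hm] := c_continuous_bounded (cphi kj.1 kj.2); exists m.
have [M HM] := choice HM0.
pose D1 : R := #|endpoint G|%:R + \sum_v cn (alpha v)%:C%C + 2.
pose D2 : R := \sum_k \sum_j M (k, j) * len j.
have D20 : 0 <= D2.
  by apply: sumr_ge0 => k _; apply: sumr_ge0 => j _; rewrite mulr_ge0// ltW// ?len_gt0//; case: (HM (k, j)).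
have Sv0 : 0 <= \sum_v cn (alpha v)%:C%C by apply: sumr_ge0 => v _; exact: cn_ge0.
have n0 : 0 <= #|endpoint G|%:R :> R by exact: ler0n.
exists (D1 + D2); first by rewrite /D1; lra.
move=> f p m m0 cf fp u.
have eval x : cn (end_val f x) <= m.
  rewrite /end_val; have [] := fp x.1 (if x.2 then len x.1 else 0) => //.
  by have := len_gt0 x.1; case: x.2 => l0; rewrite ?lexx ltW.
have eder x : cn (end_der p x) <= m.
  rewrite /end_der; have l0 := len_gt0 x.1; case: x.2.
    by have [|_] := fp x.1 (len x.1); rewrite ?lexx ?(ltW l0).
  by rewrite cnN; have [|_] := fp x.1 0; rewrite ?lexx ?(ltW l0).
case: u => [x|k] /=; last first.
  rewrite /inner; apply: le_trans (cn_sum _ _ _) _.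
  apply: (@le_trans _ _ (\sum_j M (k, j) * len j * m)).
    apply: ler_sum => j _.
    have cfj : c_continuous_on 0 (len j) (fun t => f j t * (phi k j t)^*%C).
      by apply: c_continuousM => //; apply: c_continuousJ; exact: cphi.
    have b t : 0 <= t <= len j -> cn (f j t * (phi k j t)^*%C) <= M (k, j) * m.
      move=> tL; apply: le_trans (cnM _ _) _; rewrite cnJ mulrC.
      by apply: ler_pM; rewrite ?cn_ge0//; [exact: (HM (k, j)).2|case: (fp j t tL)].
    have [h1 h2] := cint_bound (ltW (len_gt0 j)) cfj b.
    by apply: le_trans h1 _; apply: le_trans h2 _; rewrite mulrAC.
  rewrite -mulr_suml ler_wpM2r//.
  apply: (@le_trans _ _ D2); last by rewrite /D1; lra.
  rewrite /D2 [leRHS](bigD1 k)//= lerDl; apply: sumr_ge0 => i _; apply: sumr_ge0 => j _.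
  by rewrite mulr_ge0// ltW// ?len_gt0//; case: (HM (i, j)).
apply: (@le_trans _ _ (D1 * m)); last by rewrite ler_wpM2r// lerDl.
rewrite /vcond; case: ifP => _.
  apply: le_trans (cnB _ _) _.
  have h1 : cn (vertex_der p (vertex_of x)) <= #|endpoint G|%:R * m.
    apply: le_trans (cn_sum _ _ _) _.
    apply: (@le_trans _ _ (\sum_(y : endpoint G) m)); last first.
      by rewrite sumr_const mulr_natl lexx.
    rewrite big_mkcond; apply: ler_sum => y _; case: ifP => _ //; exact: eder.
  have h2 : cn ((alpha (vertex_of x))%:C%C * vertex_val f (vertex_of x)) <=
            (\sum_v cn (alpha v)%:C%C) * m.
    apply: le_trans (cnM _ _) _; apply: ler_pM; rewrite ?cn_ge0//; last exact: eval.
    by rewrite [leRHS](bigD1 (vertex_of x))//= lerDl; apply: sumr_ge0 => v _; exact: cn_ge0.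
  by rewrite /D1 !mulrDl; lra.
apply: le_trans (cnB _ _) _.
have := eval x; have := eval (vertex_repr (vertex_of x)); rewrite -/(vertex_val _ _).
have h3 : 0 <= #|endpoint G|%:R * m by rewrite mulr_ge0.
have h4 : 0 <= (\sum_v cn (alpha v)%:C%C) * m by rewrite mulr_ge0.
by rewrite /D1 !mulrDl; lra.
Qed.

Lemma gfun_bound (f p : gfun G) : gcont f -> gcont p -> exists2 m, 0 < m &
  forall j t, 0 <= t <= len j -> cn (f j t) <= m /\ cn (p j t) <= m.
Proof.
move=> cf cp.
have H0 j : exists m : R, 0 < m /\
    forall t, 0 <= t <= len j -> cn (f j t) <= m /\ cn (p j t) <= m.
  have [m m0 Hm] := c_continuous_bounded (cf j).
  have [n n0 Hn] := c_continuous_bounded (cp j).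
  exists (m + n); split; first exact: addr_gt0.
  by move=> t tL; have := Hm t tL; have := Hn t tL; split; lra.
have [M HM] := choice H0.
have M0 : 0 <= \sum_j M j by apply: sumr_ge0 => j _; apply: ltW; case: (HM j).
exists (1 + \sum_j M j); first by lra.
move=> j t tL; have [_ /(_ t tL)[h1 h2]] := HM j.
have h3 : M j <= \sum_j M j.
  rewrite [leRHS](bigD1 j)//= lerDl; apply: sumr_ge0 => k _; apply: ltW.
  by case: (HM k).
by split; lra.
Qed.

Lemma sol_gcont f p g : sol q f p g -> gcont f /\ gcont p.
Proof.
move=> H; split=> j; have [H1 H2] := H j; first exact: cprimitive_continuous H1.
exact: cprimitive_continuous H2.
Qed.

Lemma L1norm_ge0 h : 0 <= L1norm h.
Proof. by apply: sumr_ge0 => j _; apply: Rintegral_ge0 => t _; exact: cn_ge0. Qed.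

Lemma sol_exists z h (c0 c1 : 'I_(nedges G) -> C) : gintegrable h ->
  exists f p, [/\ sol q f p (fun j t => h j t + z * f j t),
    forall j, f j 0 = c0 j & forall j, p j 0 = c1 j].
Proof.
move=> ih.
have H0 j : exists fp : (R -> C) * (R -> C),
    [/\ edge_eq (len j) (q j) fp.1 fp.2 (fun t => h j t + z * fp.1 t),
        fp.1 0 = c0 j & fp.2 0 = c1 j].
  have [f [p [H f0 p0]]] := edge_exists (len_gt0 j) (hq j) z (c0 j) (c1 j) (ih j).
  by exists (f, p).
have [S HS] := choice H0.
by exists (fun j => (S j).1), (fun j => (S j).2); split=> j; case: (HS j).
Qed.

Lemma sol_bound z : exists2 K, 0 < K & forall f p h, gintegrable h ->
  sol q f p (fun j t => h j t + z * f j t) ->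
  (forall j, f j 0 = 0) -> (forall j, p j 0 = 0) ->
  forall j t, 0 <= t <= len j -> cn (f j t) <= K * L1norm h /\ cn (p j t) <= K * L1norm h.
Proof.
have H0 j : exists K : R, 0 < K /\ forall f p h : R -> C, cintegrable (len j) h ->
  edge_eq (len j) (q j) f p (fun t => h t + z * f t) -> forall x, 0 <= x <= len j ->
  cn (f x) + cn (p x) <= K * (cn (f 0) + cn (p 0) + \int[mu]_(t in `[0, len j]) cn (h t)).
  by have [K K0 HK] := edge_bound (len_gt0 j) (hq j) z; exists K.
have [K HK] := choice H0.
have K0 : 0 <= \sum_j K j by apply: sumr_ge0 => j _; apply: ltW; case: (HK j).
exists (1 + \sum_j K j); first by lra.
move=> f p h ih Hs f0 p0 j t tL.
have [Kj0 /(_ _ _ _ (ih j) (Hs j) t tL)] := HK j; rewrite f0 p0 cn0 !add0r => H.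
have Hj0 i : 0 <= \int[mu]_(t in `[0, len i]) cn (h i t).
  by apply: Rintegral_ge0 => s _; exact: cn_ge0.
have h1 : \int[mu]_(t in `[0, len j]) cn (h j t) <= L1norm h.
  by rewrite /L1norm [leRHS](bigD1 j)//= lerDl; apply: sumr_ge0 => i _.
have h2 : K j <= 1 + \sum_j K j.
  have : K j <= \sum_j K j.
    rewrite [leRHS](bigD1 j)//= lerDl; apply: sumr_ge0 => k _; apply: ltW.
    by case: (HK k).
  lra.
have h3 : K j * \int[mu]_(t in `[0, len j]) cn (h j t) <= (1 + \sum_j K j) * L1norm h.
  by apply: ler_pM => //; exact: ltW.
by have := cn_ge0 (f j t); have := cn_ge0 (p j t); split; lra.
Qed.

(** Superposition of one inhomogeneous solution and of the solutions with unit data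
    turns the problem into a square linear system; the Fredholm alternative is then
    the invertibility of an injective square matrix. *)
Lemma bordered_solvable z : bordered_injective z -> exists2 K, 0 < K &
  forall h e b, gintegrable h -> exists f p a, bordered z f p a h e b /\
    forall j t, 0 <= t <= len j ->
      cn (f j t) <= K * (L1norm h + \sum_v cn (e v) + \sum_k cn (b k)).
Proof.
move=> inj.
(* solutions with one unit Cauchy datum, or with [- phi k] as right-hand side *)
pose src (u : U) : gfun G := if u is inr k then gscale (-1) (phi k) else @gfun0 R G.
have isrc u : gintegrable (src u).
  move=> j; case: u => [x|k] /=.
    by apply: c_continuous_integrable; exact: c_continuous_cst.
  by apply: cintegrableZ; apply: c_continuous_integrable; exact: cphi.
have S0 (u : U) : exists fp : gfun G * gfun G,
    [/\ sol q fp.1 fp.2 (fun j t => src u j t + z * fp.1 j t),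
        forall j, fp.1 j 0 = (u == inl (j, false))%:R &
        forall j, fp.2 j 0 = (u == inl (j, true))%:R].
  have [f [p H]] := sol_exists z (fun j => (u == inl (j, false))%:R)
                     (fun j => (u == inl (j, true))%:R) (isrc u).
  by exists (f, p).
have [SP HS] := choice S0.
pose S u := (SP u).1; pose P u := (SP u).2.
have sS u : sol q (S u) (P u) (fun j t => src u j t + z * S u j t) by case: (HS u).
have cS u : gcont (S u) by case: (sol_gcont (sS u)).
have cP u : gcont (P u) by case: (sol_gcont (sS u)).
have comb_src (x : U -> C) j t :
    gcomb x src j t = - gcomb (fun k => x (inr k)) phi j t.
  rewrite /gcomb big_sumType /= big1 => [|y _]; last by rewrite mulr0.
  by rewrite add0r -sumrN; apply: eq_bigr => k _; rewrite /gscale; ring.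
have comb_rhs (x : U -> C) j t :
    gcomb x (fun u j t => src u j t + z * S u j t) j t =
    gcomb x src j t + z * gcomb x S j t.
  by rewrite /gcomb mulr_sumr -big_split /=; apply: eq_bigr => u _; ring.
have comb_S0 (x : U -> C) j : gcomb x S j 0 = x (inl (j, false)).
  rewrite /gcomb (bigD1 (inl (j, false)))//= big1 => [|u uj].
    by have [_ h _] := HS (inl (j, false)); rewrite /S h eqxx mulr1 addr0.
  by have [_ h _] := HS u; rewrite /S h (negbTE uj) mulr0.
have comb_P0 (x : U -> C) j : gcomb x P j 0 = x (inl (j, true)).
  rewrite /gcomb (bigD1 (inl (j, true)))//= big1 => [|u uj].
    by have [_ _ h] := HS (inl (j, true)); rewrite /P h eqxx mulr1 addr0.
  by have [_ _ h] := HS u; rewrite /P h (negbTE uj) mulr0.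
pose m (i u : U) := out (S u) (P u) i.
have [|n Hn] := @square_system_inverse _ U m.
  move=> x Hx.
  have Ho u : out (gcomb x S) (gcomb x P) u = 0.
    by rewrite out_comb// -[RHS](Hx u); apply: eq_bigr => i _; rewrite mulrC.
  have sx := sol_comb x sS.
  have [|fx0 ax0] := inj (gcomb x S) (gcomb x P) (fun k => x (inr k)).
    split; last by move=> k; exact: (Ho (inr k)).
    apply/bvpP; split; last first.
      by move=> y; have /= -> := Ho (inl y); rewrite /vdata; case: ifP.
    apply: sol_ext sx => // j t _; rewrite comb_rhs comb_src /gfun0; ring.
  have px0 := sol_zero_der sx fx0.
  move=> [[j b]|k]; last exact: ax0.
  case: b; first by rewrite -comb_P0 px0// lexx ltW// len_gt0.
  by rewrite -comb_S0 fx0// lexx ltW// len_gt0.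
have [K0 K00 HK0] := sol_bound z.
have [D D0 HD] := out_bound.
have [MS MS0 HMS] : exists2 m, 0 < m & forall u j t, 0 <= t <= len j -> cn (S u j t) <= m.
  have H0 (u : U) : exists m : R, 0 < m /\ forall j t, 0 <= t <= len j -> cn (S u j t) <= m.
    have [m0 m00 Hm] := gfun_bound (cS u) (cP u).
    by exists m0; split=> // j t tL; case: (Hm j t tL).
  have [M HM] := choice H0.
  have M0 : 0 <= \sum_j M j by apply: sumr_ge0 => j _; apply: ltW; case: (HM j).
  exists (1 + \sum_j M j); first by lra.
  move=> u j t tL; have [_ /(_ j t tL) h1] := HM u.
  have : M u <= \sum_j M j.
    rewrite [leRHS](bigD1 u)//= lerDl; apply: sumr_ge0 => k _; apply: ltW.
    by case: (HM k).
  lra.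
pose N := \sum_u \sum_k cn (n u k).
have N0 : 0 <= N by apply: sumr_ge0 => u _; apply: sumr_ge0 => k _; exact: cn_ge0.
have NP : 0 <= N * (1 + D * K0) * #|U|%:R * MS.
  apply: mulr_ge0; last exact: ltW.
  apply: mulr_ge0; last exact: ler0n.
  by apply: mulr_ge0 => //; rewrite addr_ge0// mulr_ge0// ltW.
exists (K0 + N * (1 + D * K0) * #|U|%:R * MS); first by rewrite ltr_pwDl.
move=> h e b ih.
(* the given right-hand side with zero Cauchy data *)
have [fh [ph [sh fh0 ph0]]] := sol_exists z (fun=> 0) (fun=> 0) ih.
have [cfh cph] := sol_gcont sh.
have bh := HK0 fh ph h ih sh fh0 ph0.
set H := L1norm h; have H0 : 0 <= H by exact: L1norm_ge0.
have KH : 0 <= K0 * H by rewrite mulr_ge0// ltW.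
have boh := HD fh ph (K0 * H) KH cfh bh.
pose y (u : U) := match u with inl x => vdata e x | inr k => b k end.
set E := \sum_v cn (e v) + \sum_k cn (b k).
have Se0 : 0 <= \sum_v cn (e v) by apply: sumr_ge0 => v _; exact: cn_ge0.
have Sb0 : 0 <= \sum_k cn (b k) by apply: sumr_ge0 => v _; exact: cn_ge0.
have yE u : cn (y u) <= E.
  case: u => [x|k] /=.
    rewrite /vdata; case: ifP => _; last by rewrite cn0 addr_ge0.
    have : cn (e (vertex_of x)) <= \sum_v cn (e v).
      rewrite [leRHS](bigD1 (vertex_of x))//= lerDl; apply: sumr_ge0 => v _; exact: cn_ge0.
    rewrite /E; lra.
  have : cn (b k) <= \sum_k cn (b k).
    rewrite [leRHS](bigD1 k)//= lerDl; apply: sumr_ge0 => v _; exact: cn_ge0.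
  rewrite /E; lra.
pose r u := y u - out fh ph u.
pose x u := \sum_k n u k * r k.
have xE u : cn (x u) <= N * (E + D * K0 * H).
  apply: le_trans (cn_sum _ _ _) _.
  apply: (@le_trans _ _ (\sum_k cn (n u k) * (E + D * K0 * H))).
    apply: ler_sum => k _; apply: le_trans (cnM _ _) _.
    apply: ler_wpM2l; first exact: cn_ge0.
    apply: le_trans (cnB _ _) _; rewrite -[D * K0 * H]mulrA; apply: lerD => //.
  rewrite -mulr_suml ler_wpM2r//; last first.
    rewrite [leRHS](bigD1 u)//= lerDl; apply: sumr_ge0 => v _; apply: sumr_ge0 => k _.
    exact: cn_ge0.
  by rewrite -mulrA addr_ge0 ?addr_ge0// mulr_ge0// ltW.
pose f := gadd fh (gcomb x S); pose p := gadd ph (gcomb x P).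
exists f, p, (fun k => x (inr k)); split.
  have ofp u : out f p u = y u.
    rewrite outD//; last exact: gcont_comb.
    rewrite out_comb// (eq_bigr (fun i => m u i * x i)); last by move=> i _; rewrite mulrC.
    by rewrite Hn /r; ring.
  split; last by move=> k; exact: (ofp (inr k)).
  apply/bvpP; split; last by move=> w; exact: (ofp (inl w)).
  apply: sol_ext (solD sh (sol_comb x sS)) => // j t _.
  by rewrite /gadd comb_rhs comb_src /f /gadd; ring.
move=> j t tL; rewrite /f /gadd; apply: le_trans (cnD _ _) _.
have [h1 _] := bh j t tL.
have h2 : cn (gcomb x S j t) <= N * (E + D * K0 * H) * #|U|%:R * MS.
  apply: le_trans (cn_sum _ _ _) _.
  apply: (@le_trans _ _ (\sum_(u : U) N * (E + D * K0 * H) * MS)).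
    apply: ler_sum => u _; apply: le_trans (cnM _ _) _.
    by apply: ler_pM; rewrite ?cn_ge0//; exact: HMS.
  by rewrite sumr_const -[X in X <= _]mulr_natl mulrA [#|_|%:R * _]mulrC lexx.
have h3 : N * (E + D * K0 * H) * #|U|%:R * MS <=
          N * (1 + D * K0) * #|U|%:R * MS * (H + E).
  have -> : N * (1 + D * K0) * #|U|%:R * MS * (H + E) =
            N * ((1 + D * K0) * (H + E)) * #|U|%:R * MS by ring.
  apply: ler_wpM2r; first exact: ltW.
  apply: ler_wpM2r; first exact: ler0n.
  apply: ler_wpM2l => //.
  have : 0 <= D * K0 * E by rewrite mulr_ge0 ?addr_ge0// mulr_ge0// ltW.
  have -> : (1 + D * K0) * (H + E) = H + E + D * K0 * H + D * K0 * E by ring.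
  lra.
have h4 : 0 <= K0 * E by rewrite mulr_ge0 ?addr_ge0// ltW.
have -> : (K0 + N * (1 + D * K0) * #|U|%:R * MS) *
    (H + \sum_v cn (e v) + \sum_k cn (b k)) =
    K0 * H + K0 * E + N * (1 + D * K0) * #|U|%:R * MS * (H + E) by rewrite /E; ring.
apply: lerD; last exact: (le_trans h2 h3).
by apply: le_trans h1 _; rewrite lerDl.
Qed.

End Fredholm.

(** * Green's formula and the kernel *)

Section Kernel.
Variables (R : realType) (G : metric_graph R).
Local Notation C := R[i].
Notation mu := (@lebesgue_measure R).
Variables (q : 'I_(nedges G) -> R -> R) (alpha : vertex G -> R).
Hypothesis hq : L1_potential q.
Implicit Types (f p g h : gfun G) (v : vertex G) (e : vertex G -> C).

Local Notation bvp := (bvp q alpha).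
Local Notation sol := (sol q).
Local Notation G0 := (@gfun0 R G).

Lemma gcont_L2 f : gcont f -> L2 f.
Proof. by move=> cf j; exact: c_continuous_square_integrable. Qed.

Lemma L2_integrable f : L2 f -> gintegrable f.
Proof. by move=> Hf j; exact: square_integrable_cintegrable. Qed.

Lemma L2D f g : L2 f -> L2 g -> L2 (gadd f g).
Proof.
move=> Hf Hg j; have [fr fi foo] := Hf j; have [gr gi goo] := Hg j.
have E1 : rpart (gadd f g j) = (fun x => rpart (f j) x + rpart (g j) x).
  by apply/funext => x; rewrite /rpart /gadd cE.
have E2 : ipart (gadd f g j) = (fun x => ipart (f j) x + ipart (g j) x).
  by apply/funext => x; rewrite /ipart /gadd cE.
have m1 : measurable_fun `[0, len j] (rpart (gadd f g j)).
  by rewrite E1; exact: measurable_realfun.measurable_funD.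
have m2 : measurable_fun `[0, len j] (ipart (gadd f g j)).
  by rewrite E2; exact: measurable_realfun.measurable_funD.
split=> //.
have i1 := integrableD_itv (integrableZ_itv 2 (square_integrable_sq (Hf j)))
                           (integrableZ_itv 2 (square_integrable_sq (Hg j))).
have i2 : mu.-integrable `[0, len j] (EFin \o (fun x =>
    rpart (gadd f g j) x ^+ 2 + ipart (gadd f g j) x ^+ 2)).
  apply: (le_integrable _ _ _ i1) => //.
    apply/measurable_realfun.measurable_EFinP; apply: measurable_realfun.measurable_funD;
      exact: measurable_realfun.measurable_funX.
  move=> x _ /=; rewrite lee_fin !ger0_norm; last 2 first.
  - by rewrite !addr_ge0// mulr_ge0// addr_ge0// sqr_ge0.
  - by rewrite addr_ge0// sqr_ge0.
  have sq (a b c d : R) :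
      (a + b) ^+ 2 + (c + d) ^+ 2 <= 2 * (a ^+ 2 + c ^+ 2) + 2 * (b ^+ 2 + d ^+ 2).
    by have := sqr_ge0 (a - b); have := sqr_ge0 (c - d); nra.
  by rewrite E1 E2; exact: sq.
have := @integrable_fin_num _ _ _ mu _ (measurable_itv _) _ i2.
by rewrite /sqnorm_on ltey_eq => ->.
Qed.

Lemma bvp_gcont f p g e : bvp f p g e -> gcont f.
Proof. by move=> [Hs _ _]; case: (sol_gcont Hs). Qed.

Lemma A_shift_bvp z f h : L2 h ->
  A_shift q alpha z f h <->
  exists p, bvp f p (fun j x => h j x + z * f j x) (fun=> 0).
Proof.
move=> Hh; split.
  move=> [[_ acf] [L2g Lf] cf df].
  by apply: classical_bvp => //; exact: L2_integrable.
move=> [p Hp]; have [[h1 h2] h3 h4 h5] := bvp_classical Hp.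
split => //; split => //.
apply: (L2D Hh); apply: gcont_L2 => j; apply: c_continuousZ; exact: (bvp_gcont Hp).
Qed.

Lemma bvp_ext f f' p p' g g' e : eq_on_graph f f' -> eq_on_graph p p' ->
  eq_on_graph g g' -> bvp f p g e -> bvp f' p' g' e.
Proof.
move=> ff pp gg [H1 H2 H3].
have dE x : end_der p' x = end_der p x.
  have l0 := len_gt0 x.1.
  rewrite /end_der; case: x.2; first by rewrite pp// lexx ltW.
  by congr (- _); rewrite pp// lexx ltW.
split.
- exact: sol_ext H1.
- by move=> x; rewrite /vertex_val -!(eq_on_graph_end_val _ ff); exact: H2.
- move=> v; rewrite -H3 /vertex_val -(eq_on_graph_end_val _ ff); congr (_ - _).
  by apply: eq_bigr => x _; rewrite dE.
Qed.

Lemma L2_0 : L2 G0.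
Proof. by apply: gcont_L2 => j; exact: c_continuous_cst. Qed.

Lemma A_ker_bvp z f : A_ker q alpha z f <->
  exists p, bvp f p (fun j x => z * f j x) (fun=> 0).
Proof.
split.
  move=> /(A_shift_bvp _ _ L2_0)[p Hp]; exists p; apply: bvp_ext Hp => // j x _.
  by rewrite /gfun0 add0r.
move=> [p Hp]; apply/(A_shift_bvp _ _ L2_0); exists p; apply: bvp_ext Hp => // j x _.
by rewrite /gfun0 add0r.
Qed.

Lemma bvpJ f p g e : bvp f p g e ->
  bvp (fun j t => (f j t)^*%C) (fun j t => (p j t)^*%C) (fun j t => (g j t)^*%C)
      (fun v => (e v)^*%C).
Proof.
move=> [H1 H2 H3]; split.
- by move=> j; apply: edge_eqJ; exact: H1.
- by move=> x; have := H2 x; rewrite /vertex_val /end_val => ->.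
- move=> v; rewrite -H3.
  have -> : vertex_der (fun j t => (p j t)^*%C) v = (vertex_der p v)^*%C.
    rewrite /vertex_der (big_morph (@conjc R) (id1 := 0) (op1 := +%R)).
    + apply: eq_bigr => x _; rewrite /end_der; case: x.2 => //.
      by apply: complexP; rewrite !cE.
    + by move=> x y; apply: complexP; rewrite !cE; ring.
    + by rewrite conjc0.
  by rewrite /vertex_val /end_val; apply: complexP; rewrite !cE; ring.
Qed.

(** Summing the Wronskians at the endpoints vertex by vertex, the terms with the
    strengths [alpha] cancel. *)
Lemma bvp_green f p g e f' p' g' e' : bvp f p g e -> bvp f' p' g' e' ->
  \sum_j cint (len j) (fun t => g j t * f' j t - f j t * g' j t) =
  \sum_v (vertex_val f v * e' v - vertex_val f' v * e v).
Proof.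
move=> [H1 H2 H3] [H1' H2' H3'].
transitivity (\sum_(x : endpoint G) (end_val f x * end_der p' x - end_der p x * end_val f' x)).
  rewrite [RHS](eq_bigr (fun x : 'I_(nedges G) * bool =>
    end_val f (x.1, x.2) * end_der p' (x.1, x.2) - end_der p (x.1, x.2) * end_val f' (x.1, x.2)));
    last by case.
  rewrite -(pair_bigA _ (fun j b => end_val f (j, b) * end_der p' (j, b) -
              end_der p (j, b) * end_val f' (j, b))) /=.
  apply: eq_bigr => j _; rewrite big_bool -(edge_green (len_gt0 j) (H1 j) (H1' j)).
  by rewrite /end_val /end_der /=; ring.
rewrite (partition_big (@vertex_of R G) xpredT) //=; apply: eq_bigr => v _.
transitivity (\sum_(x | vertex_of x == v)
    (vertex_val f v * end_der p' x - vertex_val f' v * end_der p x)).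
  by apply: eq_bigr => x /eqP xv; rewrite H2 H2' xv; ring.
rewrite sumrB -!mulr_sumr -!/(vertex_der _ _) -H3 -H3'; ring.
Qed.

(** Green's formula against the conjugate of [phi], which solves the same equation
    because [lambda], [q] and [alpha] are real. *)
Lemma bvp_green_ker (lambda : R) f p h e phi psi :
  gintegrable h -> bvp f p (fun j t => h j t + (lambda%:C)%C * f j t) e ->
  bvp phi psi (fun j t => (lambda%:C)%C * phi j t) (fun=> 0) ->
  inner h phi = - \sum_v (vertex_val phi v)^*%C * e v.
Proof.
move=> ih Hf Hphi; have := bvp_green Hf (bvpJ Hphi).
rewrite -sumrN => E.
transitivity (\sum_j cint (len j) (fun t => (h j t + (lambda%:C)%C * f j t) * (phi j t)^*%C -
       f j t * ((lambda%:C)%C * phi j t)^*%C)).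
  apply: eq_bigr => j _; apply: eq_cint => t _; apply: complexP; rewrite !cE; ring.
rewrite E; apply: eq_bigr => v _.
have -> : vertex_val (fun j t => (phi j t)^*%C) v = (vertex_val phi v)^*%C by [].
by rewrite conjc0; ring.
Qed.

Lemma bvpD f p g e f' p' g' e' : bvp f p g e -> bvp f' p' g' e' ->
  bvp (gadd f f') (gadd p p') (gadd g g') (fun v => e v + e' v).
Proof.
move=> /bvpP[H1 H2] /bvpP[H1' H2']; apply/bvpP; split; first exact: solD.
by move=> x; rewrite vcondD H2 H2' /vdata; case: ifP => _; rewrite ?addr0.
Qed.

Lemma bvp_comb (I : finType) (c : I -> C) (S P Gs : I -> gfun G) (es : I -> vertex G -> C) :
  (forall i, bvp (S i) (P i) (Gs i) (es i)) ->
  bvp (gcomb c S) (gcomb c P) (gcomb c Gs) (fun v => \sum_i c i * es i v).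
Proof.
move=> H; apply/bvpP; split.
  by apply: sol_comb => i; case/bvpP: (H i).
move=> x; rewrite vcond_comb /vdata; case: ifP => xr.
  by apply: eq_bigr => i _; case/bvpP: (H i) => _ ->; rewrite /vdata xr.
by rewrite big1// => i _; case/bvpP: (H i) => _ ->; rewrite /vdata xr mulr0.
Qed.

Lemma bvpZ c f p g e : bvp f p g e ->
  bvp (gscale c f) (gscale c p) (gscale c g) (fun v => c * e v).
Proof.
move=> H.
have E (k : gfun G) : gcomb (fun _ : unit => c) (fun=> k) = gscale c k.
  apply/funext => j; apply/funext => t; rewrite /gcomb /gscale.
  by rewrite (big_pred1 tt)// => -[].
have := @bvp_comb unit (fun=> c) (fun=> f) (fun=> p) (fun=> g) (fun=> e) (fun=> H).
have -> : (fun v => \sum_(i : unit) c * e v) = (fun v => c * e v).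
  by apply/funext => v; rewrite (big_pred1 tt)// => -[].
by rewrite !E.
Qed.

Lemma sol_unique z f p : sol f p (fun j t => z * f j t) ->
  (forall j, f j 0 = 0) -> (forall j, p j 0 = 0) ->
  eq_on_graph f G0 /\ eq_on_graph p G0.
Proof.
move=> H f0 p0.
have E j := edge_zero_org (len_gt0 j) (hq j) (H j) (f0 j) (p0 j).
by split=> j t tL; case: (E j t tL).
Qed.

(** The vertex conditions cut the kernel out of the finite-dimensional space of Cauchy
    data. *)
Lemma ker_has_dim z : exists d, has_dim (A_ker q alpha z) d.
Proof.
have i0 : gintegrable G0 by move=> j; apply: c_continuous_integrable; exact: c_continuous_cst.
have S0 (u : endpoint G) : exists fp : gfun G * gfun G,
    [/\ sol fp.1 fp.2 (fun j t => z * fp.1 j t),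
        forall j, fp.1 j 0 = (u == (j, false))%:R &
        forall j, fp.2 j 0 = (u == (j, true))%:R].
  have [f [p [H f0 p0]]] := sol_exists hq z (fun j => (u == (j, false))%:R)
                     (fun j => (u == (j, true))%:R) i0.
  exists (f, p); split => //.
  by apply: sol_ext H => // j t _; rewrite /gfun0 add0r.
have [SP HS] := choice S0.
pose S u := (SP u).1; pose P u := (SP u).2.
have sS u : sol (S u) (P u) (fun j t => z * S u j t) by case: (HS u).
have comb_rhs (x : endpoint G -> C) j t :
    gcomb x (fun u j t => z * S u j t) j t = z * gcomb x S j t.
  by rewrite /gcomb mulr_sumr; apply: eq_bigr => u _; ring.
have comb_S0 (x : endpoint G -> C) j : gcomb x S j 0 = x (j, false).
  rewrite /gcomb (bigD1 (j, false))//= big1 => [|u uj].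
    by have [_ h _] := HS (j, false); rewrite /S h eqxx mulr1 addr0.
  by have [_ h _] := HS u; rewrite /S h (negbTE uj) mulr0.
have comb_P0 (x : endpoint G -> C) j : gcomb x P j 0 = x (j, true).
  rewrite /gcomb (bigD1 (j, true))//= big1 => [|u uj].
    by have [_ _ h] := HS (j, true); rewrite /P h eqxx mulr1 addr0.
  by have [_ _ h] := HS u; rewrite /P h (negbTE uj) mulr0.
have sx x : sol (gcomb x S) (gcomb x P) (fun j t => z * gcomb x S j t).
  by apply: sol_ext (sol_comb x sS) => // j t _; rewrite comb_rhs.
pose N := #|endpoint G|.
have re (g : endpoint G -> C) : \sum_u g u = \sum_(i < N) g (enum_val i).
  by rewrite (reindex (@enum_val _ (endpoint G))) //=; apply: onW_bij; exact: enum_val_bij.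
pose Mt : 'M[C]_N := \matrix_(u, i) vcond alpha (S (enum_val u)) (P (enum_val u)) (enum_val i).
pose B := row_base (kermx Mt).
pose row_fun (r : 'rV[C]_N) (u : endpoint G) := r 0 (enum_rank u).
have MtE (r : 'rV[C]_N) i :
    (r *m Mt) 0 (enum_rank i) = vcond alpha (gcomb (row_fun r) S) (gcomb (row_fun r) P) i.
  rewrite vcond_comb re mxE; apply: eq_bigr => u _.
  by rewrite mxE enum_rankK /row_fun enum_valK.
have kerE (r : 'rV[C]_N) : r *m Mt = 0 <->
    bvp (gcomb (row_fun r) S) (gcomb (row_fun r) P)
        (fun j t => z * gcomb (row_fun r) S j t) (fun=> 0).
  split=> [r0|/bvpP[_ H]].
    apply/bvpP; split=> // i; rewrite -MtE r0 mxE /vdata; by case: ifP.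
  by apply/rowP => i; rewrite -(enum_valK i) MtE H mxE /vdata; case: ifP.
pose phi (k : 'I_(\rank (kermx Mt))) := gcomb (row_fun (row k B)) S.
have combphi (c : 'I_(\rank (kermx Mt)) -> C) j t :
    \sum_k c k * phi k j t = gcomb (row_fun ((\row_k c k) *m B)) S j t.
  rewrite /phi /gcomb.
  transitivity (\sum_k \sum_u c k * (row_fun (row k B) u * S u j t)).
    by apply: eq_bigr => k _; rewrite mulr_sumr.
  rewrite exchange_big /=; apply: eq_bigr => u _; rewrite /row_fun mxE mulr_suml.
  by apply: eq_bigr => k _; rewrite !mxE mulrA.
exists (\rank (kermx Mt)), phi; split.
- move=> k; apply/A_ker_bvp; exists (gcomb (row_fun (row k B)) P); apply/kerE.
  apply/sub_kermxP; apply: submx_trans (row_sub _ _) _.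
  by rewrite /B eq_row_base.
- move=> c Hc k.
  have r0 : (\row_k c k) *m B = 0.
    set r := _ *m _.
    have f0 : eq_on_graph (gcomb (row_fun r) S) G0.
      by move=> j t tL; rewrite -combphi; exact: Hc.
    have p0 := sol_zero_der (sx (row_fun r)) f0.
    have H0 u : row_fun r u = 0.
      case: u => j [].
        by rewrite -(comb_P0 (row_fun r)) p0// lexx ltW// len_gt0.
      by rewrite -(comb_S0 (row_fun r)) f0// lexx ltW// len_gt0.
    by apply/rowP => i; rewrite [RHS]mxE -(enum_valK i); exact: H0.
  have /eqP : (\row_k c k) *m B = 0 := r0.
  rewrite mulmx_free_eq0; last exact: row_base_free.
  by move=> /eqP /rowP /(_ k); rewrite !mxE.
- move=> f /A_ker_bvp[p Hp].
  have [Hs _ _] := Hp.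
  pose r : 'rV[C]_N := \row_i (if (enum_val i).2 then p (enum_val i).1 0 else f (enum_val i).1 0).
  have rE u : row_fun r u = if u.2 then p u.1 0 else f u.1 0.
    by rewrite /row_fun mxE enum_rankK.
  have [] := @sol_unique z (gadd f (gscale (-1) (gcomb (row_fun r) S)))
                         (gadd p (gscale (-1) (gcomb (row_fun r) P))).
  + move=> j; apply: edge_eq_ext (edge_eqD (Hs j) (edge_eqZ (len_gt0 j) (-1) (sx (row_fun r) j))) => //.
      exact: len_gt0.
    by move=> t _; rewrite /gadd /gscale; ring.
  + by move=> j; rewrite /gadd /gscale comb_S0 rE /=; ring.
  + by move=> j; rewrite /gadd /gscale comb_P0 rE /=; ring.
  move=> Hf Hpp.
  have fE : eq_on_graph f (gcomb (row_fun r) S).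
    move=> j t tL; have := Hf j t tL; rewrite /gadd /gscale /gfun0 mulN1r => /eqP.
    by rewrite subr_eq0 => /eqP.
  have pE : eq_on_graph p (gcomb (row_fun r) P).
    move=> j t tL; have := Hpp j t tL; rewrite /gadd /gscale /gfun0 mulN1r => /eqP.
    by rewrite subr_eq0 => /eqP.
  have /kerE/sub_kermxP rker : bvp (gcomb (row_fun r) S) (gcomb (row_fun r) P)
      (fun j t => z * gcomb (row_fun r) S j t) (fun=> 0).
    by apply: bvp_ext Hp => // j t tL; rewrite fE.
  have rB : (r <= B)%MS by rewrite /B eq_row_base.
  have /submxP[c rc] := rB.
  exists (fun k => c 0 k) => j t tL; rewrite fE// combphi rc; congr (gcomb (row_fun (_ *m _)) S j t).
  by apply/rowP => k; rewrite mxE.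
Qed.

Lemma has_dim_le (K : gfun G -> Prop) d d' : has_dim K d -> has_dim K d' -> (d <= d')%N.
Proof.
move=> [b [Kb free _]] [b' [_ _ span]].
have [c Hc] := choice (fun k => span (b k) (Kb k)).
pose M : 'M[C]_(d, d') := \matrix_(k, l) c k l.
suff : row_free M by rewrite /row_free => /eqP <-; exact: rank_leq_col.
apply/inj_row_free => v vM; apply/rowP => k; rewrite [RHS]mxE.
apply: (free (fun k => v 0 k)) => j x xL.
transitivity (\sum_k \sum_l v 0 k * (c k l * b' l j x)).
  by apply: eq_bigr => i _; rewrite -mulr_sumr (Hc i j x xL).
rewrite exchange_big big1// => l _.
have := congr1 (fun r : 'rV_d' => r 0 l) vM; rewrite !mxE => E.
transitivity ((\sum_j v 0 j * M j l) * b' l j x); last by rewrite E mul0r.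
by rewrite mulr_suml; apply: eq_bigr => i _; rewrite mxE mulrA.
Qed.

Lemma dim_kerE z d : has_dim (A_ker q alpha z) d -> dim_ker q alpha z = d.
Proof.
move=> H; rewrite /dim_ker; case: xgetP => [n _ Hn|/(_ d)//].
by apply/eqP; rewrite eqn_leq (has_dim_le Hn H) (has_dim_le H Hn).
Qed.

End Kernel.

(** * Bounds and the resolvent *)

Section Resolvent.
Variables (R : realType) (G : metric_graph R).
Local Notation C := R[i].
Notation mu := (@lebesgue_measure R).
Variables (q : 'I_(nedges G) -> R -> R) (alpha : vertex G -> R).
Hypothesis hq : L1_potential q.
Implicit Types (f p g h : gfun G) (v : vertex G) (e : vertex G -> C) (z w c : C).

Local Notation bvp := (bvp q alpha).
Local Notation G0 := (@gfun0 R G).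

Let Lt : R := \sum_(j : 'I_(nedges G)) len j.

Let Lt_ge0 : 0 <= Lt. Proof. by apply: sumr_ge0 => j _; rewrite ltW// len_gt0. Qed.

Lemma L1norm_bound h m : gintegrable h ->
  (forall j t, 0 <= t <= len j -> cn (h j t) <= m) -> L1norm h <= m * Lt.
Proof.
move=> ih Hm; rewrite /L1norm /Lt mulr_sumr; apply: ler_sum => j _.
have [hr hi] := ih j.
have ahr : mu.-integrable `[0, len j] (EFin \o (fun t => `|rpart (h j) t|)).
  by have := integrable_abse hr; exact.
have ahi : mu.-integrable `[0, len j] (EFin \o (fun t => `|ipart (h j) t|)).
  by have := integrable_abse hi; exact.
have c0 := c_continuous_cst (len j) (m%:C)%C.
have m0 : 0 <= m.
  by apply: le_trans (cn_ge0 (h j 0)) (Hm j 0 _); rewrite lexx ltW// len_gt0.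
apply: (@le_trans _ _ (\int[mu]_(t in `[0, len j]) cn ((m%:C)%C : C))).
  apply: le_Rintegral => //.
  - exact: integrableD_itv.
  - exact: integrable_cst_itv.
  - by move=> t /=; rewrite in_itv/= => tL; rewrite /cn /= normr0 addr0 (ger0_norm m0); exact: Hm.
have [|_ h2] := cint_bound (M := m) (ltW (len_gt0 j)) c0; last exact: h2.
by move=> t _; rewrite /cn /= normr0 addr0 ger0_norm.
Qed.

Lemma L1normD g h : gintegrable g -> gintegrable h -> L1norm (gadd g h) <= L1norm g + L1norm h.
Proof.
move=> ig ih; rewrite /L1norm -big_split /=; apply: ler_sum => j _.
have an k : gintegrable k -> mu.-integrable `[0, len j] (EFin \o (fun t => cn (k j t))).
  move=> /(_ j)[hr hi]; apply: integrableD_itv.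
    by have := integrable_abse hr; exact.
  by have := integrable_abse hi; exact.
have igh : gintegrable (gadd g h) by move=> i; exact: cintegrableD.
rewrite -RintegralD//; last 2 first.
- exact: an.
- exact: an.
apply: le_Rintegral => //.
- exact: an.
- by apply: integrableD_itv; exact: an.
- by move=> t _; exact: cnD.
Qed.

Lemma L1norm0 : L1norm G0 = 0.
Proof.
by rewrite /L1norm big1// => j _; rewrite /gfun0 cn0 /Rintegral integral0.
Qed.

Section Bordered.
Variables (d : nat) (phi : 'I_d -> gfun G).
Hypothesis cphi : forall k, gcont (phi k).
Local Notation bordered := (bordered q alpha phi).

Lemma bordered_ext z z' f f' p p' a h h' e e' b b' : eq_on_graph f f' -> eq_on_graph p p' ->
  (forall j t, 0 <= t <= len j -> h j t + z * f j t = h' j t + z' * f' j t) ->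
  (forall v, e v = e' v) -> (forall k, b k = b' k) ->
  bordered z f p a h e b -> bordered z' f' p' a h' e' b'.
Proof.
move=> ff pp hh ee bb [H1 H2]; split.
  have [K1 K2 K3] : bvp f' p' (fun j t => (h' j t - gcomb a phi j t) + z' * f' j t) e.
    apply: bvp_ext H1 => // j t tL.
    by rewrite addrAC hh//; ring.
  by split=> // v; rewrite K3 ee.
by move=> k; rewrite -bb -H2; apply: inner_congr => // j t tL; rewrite ff.
Qed.

Lemma borderedB z f p a h e b f' p' a' h' e' b' :
  bordered z f p a h e b -> bordered z f' p' a' h' e' b' ->
  bordered z (gadd f (gscale (-1) f')) (gadd p (gscale (-1) p'))
    (fun k => a k - a' k) (gadd h (gscale (-1) h')) (fun v => e v - e' v) (fun k => b k - b' k).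
Proof.
move=> [H1 H2] [H1' H2']; split.
  have [K1 K2 K3] := bvpD H1 (bvpZ (-1) H1').
  have [J1 J2 J3] : bvp (gadd f (gscale (-1) f')) (gadd p (gscale (-1) p'))
     (fun j t => (gadd h (gscale (-1) h') j t - gcomb (fun k => a k - a' k) phi j t) +
                 z * gadd f (gscale (-1) f') j t) (fun v => e v + -1 * e' v).
    apply: bvp_ext (And3 K1 K2 K3) => // j t tL; rewrite /gadd /gscale /gcomb.
    have -> : \sum_i (a i - a' i) * phi i j t = \sum_i a i * phi i j t - \sum_i a' i * phi i j t.
      by rewrite -sumrB; apply: eq_bigr => i _; ring.
    ring.
  by split=> // v; rewrite J3; ring.
move=> k; rewrite innerD//.
- by rewrite innerZ ?H2 ?H2' ?mulN1r//; exact: bvp_gcont H1'.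
- exact: bvp_gcont H1.
- by move=> j; apply: c_continuousZ; apply: (bvp_gcont H1').
Qed.

Lemma bordered_bound z : bordered_injective q alpha phi z -> exists2 K, 0 < K &
  forall f p a h e b, gintegrable h -> bordered z f p a h e b ->
    forall j t, 0 <= t <= len j ->
      cn (f j t) <= K * (L1norm h + \sum_v cn (e v) + \sum_k cn (b k)).
Proof.
move=> inj; have [K K0 HK] := bordered_solvable hq cphi inj.
exists K => // f p a h e b ih H j t tL.
have [f' [p' [a' [H' bf']]]] := HK h e b ih.
have [] := inj (gadd f (gscale (-1) f')) (gadd p (gscale (-1) p')) (fun k => a k - a' k).
  apply: bordered_ext (borderedB H H') => //.
  - by move=> i s sL; rewrite /gfun0 /gadd /gscale; ring.
  - by move=> v; rewrite subrr.
  - by move=> k; rewrite subrr.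
move=> f0 _; have := f0 j t tL; rewrite /gadd /gscale /gfun0 mulN1r => /eqP.
by rewrite subr_eq0 => /eqP ->; exact: bf'.
Qed.

(** A change of the spectral parameter acts as a right-hand side proportional to the
    solution, and is absorbed when it is small. *)
Lemma bordered_bound_near z : bordered_injective q alpha phi z -> exists2 r, 0 < r &
  exists2 K, 0 < K & forall w f p a h e b, cn (w - z) < r -> gintegrable h ->
    bordered w f p a h e b -> forall j t, 0 <= t <= len j ->
      cn (f j t) <= K * (L1norm h + \sum_v cn (e v) + \sum_k cn (b k)).
Proof.
move=> inj; have [K K0 HK] := bordered_bound inj.
have d0 : 0 < 2 * K * (Lt + 1).
  by apply: mulr_gt0; [rewrite mulr_gt0|rewrite ltr_wpDl].
exists ((2 * K * (Lt + 1))^-1); first by rewrite invr_gt0.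
exists (2 * K); first by rewrite mulr_gt0.
move=> w f p a h e b wz ih H.
have cf := bvp_gcont H.1; have cp : gcont p by case: (H.1) => Hs _ _; case: (sol_gcont Hs).
have [m m0 Hm] := gfun_bound cf cp.
set D := _ + \sum_k _.
have D0 : 0 <= D.
  rewrite addr_ge0 ?addr_ge0 ?L1norm_ge0//; apply: sumr_ge0 => k _; exact: cn_ge0.
have iwf : gintegrable (gscale (w - z) f).
  by apply: gcont_integrable => j; exact: c_continuousZ.
have ihwf : gintegrable (gadd h (gscale (w - z) f)) by move=> j; exact: cintegrableD.
have H' : bordered z f p a (gadd h (gscale (w - z) f)) e b.
  by apply: bordered_ext H => // j t _; rewrite /gadd /gscale; ring.
have step n : forall j t, 0 <= t <= len j -> cn (f j t) <= 2 * K * D + m * (2^-1) ^+ n.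
  elim: n => [|n IH] j t tL.
    rewrite expr0 mulr1; have [h1 _] := Hm j t tL.
    have : 0 <= 2 * K * D by rewrite !mulr_ge0// ltW.
    lra.
  have := HK f p a _ e b ihwf H' j t tL; rewrite -!addrA.
  set X := 2 * K * D + m * 2^-1 ^+ n in IH.
  have X0 : 0 <= X by rewrite /X addr_ge0 ?mulr_ge0 ?exprn_ge0// ltW.
  have h1 : L1norm (gadd h (gscale (w - z) f)) <= L1norm h + cn (w - z) * X * Lt.
    apply: le_trans (L1normD ih iwf) _; rewrite lerD2l; apply: L1norm_bound => //.
    move=> i s sL; rewrite /gscale; apply: le_trans (cnM _ _) _.
    by apply: ler_wpM2l; [exact: cn_ge0|exact: IH].
  have h2 : K * (cn (w - z) * X * Lt) <= X / 2.
    have h3 : cn (w - z) * (2 * K * (Lt + 1)) <= 1.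
      by rewrite -ler_pdivlMr// mul1r ltW.
    have h4 : cn (w - z) * (2 * K * Lt) <= 1.
      apply: le_trans h3; apply: ler_wpM2l; first exact: cn_ge0.
      by apply: ler_wpM2l; [rewrite mulr_ge0// ltW|lra].
    have h5 := ler_wpM2r X0 h4.
    have -> : K * (cn (w - z) * X * Lt) = cn (w - z) * (2 * K * Lt) * X / 2 by field.
    lra.
  move=> h6; apply: le_trans h6 _.
  apply: (@le_trans _ _ (K * (D + cn (w - z) * X * Lt))).
    apply: ler_wpM2l; first exact: ltW.
    by rewrite /D; lra.
  rewrite mulrDr; have -> : 2 * K * D + m * 2^-1 ^+ n.+1 = K * D + X / 2.
    by rewrite /X exprS; field.
  lra.
move=> j t tL; apply: (@le_half_expn _ m); first exact: ltW.
by move=> n; exact: step.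
Qed.

End Bordered.

(** The bordered problem with an empty border is the resolvent equation. It bounds the
    supremum of the solution by the [L1] norm of the right-hand side, which on a
    compact graph is stronger than a bound in [L2]. *)
Lemma no_kernel_resolvent z : (forall f, A_ker q alpha z f -> eq_on_graph f G0) ->
  resolvent_set q alpha z.
Proof.
move=> inj.
pose phi0 (k : 'I_0) : gfun G := G0.
have c0 k : gcont (phi0 k) by move=> j; exact: c_continuous_cst.
have comb0 a j t : gcomb a phi0 j t = 0 by rewrite /gcomb big_ord0.
have inj0 : bordered_injective q alpha phi0 z.
  move=> f p a [H1 H2]; split; last by case.
  apply: inj; apply/A_ker_bvp => //; exists p; apply: bvp_ext H1 => // j t _.
  by rewrite comb0 /gfun0; ring.
have [K K0 HK] := bordered_solvable hq c0 inj0.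
have [K' K'0 HK'] := bordered_bound c0 inj0.
split=> //.
  move=> h Hh; have ih := L2_integrable Hh.
  have [f [p [a [[H1 _] _]]]] := HK h (fun=> 0) (fun=> 0) ih.
  exists f; apply/(A_shift_bvp _ hq z f Hh); exists p.
  by apply: bvp_ext H1 => // j t _; rewrite comb0; ring.
pose c := K' ^+ 2 * (Lt / 2 + 1) ^+ 2 * 2 * Lt.
exists c => f h Hh /(A_shift_bvp _ hq z f Hh)[p Hp].
have ih := L2_integrable Hh.
pose Q := \sum_j \int[mu]_(t in `[0, len j]) (rpart (h j) t ^+ 2 + ipart (h j) t ^+ 2).
have Q0 : 0 <= Q.
  by apply: sumr_ge0 => j _; apply: Rintegral_ge0 => t _; rewrite addr_ge0// sqr_ge0.
have QE : sqnorm h = Q%:E.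
  rewrite /sqnorm /Q -sumEFin; apply: eq_bigr => j _; rewrite /Rintegral fineK//.
  exact: (integrable_fin_num (mu := mu) (measurable_itv _) (square_integrable_sq (Hh j))).
(* the [L1] norm against the squared [L2] norm, by the arithmetic-geometric mean *)
have hs s : 0 < s -> L1norm h <= s * (Lt / 2) + Q / s.
  move=> s0; rewrite /L1norm /Lt /Q mulr_suml mulr_suml mulr_sumr -big_split /=.
  apply: ler_sum => j _.
  have isq := square_integrable_sq (Hh j).
  have i2 : mu.-integrable `[0, len j] (EFin \o (fun t => s^-1 *
      (rpart (h j) t ^+ 2 + ipart (h j) t ^+ 2))) by exact: integrableZ_itv.
  have ich : mu.-integrable `[0, len j] (EFin \o (fun t => cn (h j t))).
    have [hr hi] := ih j; apply: integrableD_itv.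
      by have := integrable_abse hr; exact.
    by have := integrable_abse hi; exact.
  apply: (@le_trans _ _ (\int[mu]_(t in `[0, len j])
      (s / 2 + s^-1 * (rpart (h j) t ^+ 2 + ipart (h j) t ^+ 2)))).
    apply: le_Rintegral => //.
      by apply: integrableD_itv => //; exact: integrable_cst_itv.
    move=> t _; rewrite /cn -!/(rpart _ _) -!/(ipart _ _).
    rewrite -/(rpart (h j) t) -/(ipart (h j) t).
    set a := rpart _ _; set b := ipart _ _.
    have -> : a ^+ 2 + b ^+ 2 = `|a| ^+ 2 + `|b| ^+ 2 by rewrite !real_normK ?num_real.
    have : 0 <= s^-1 * ((`|a| + `|b| - s) ^+ 2 + (`|a| - `|b|) ^+ 2) / 2.
      rewrite mulr_ge0 ?invr_ge0// mulr_ge0 ?invr_ge0 ?addr_ge0 ?sqr_ge0//; exact: ltW.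
    have -> : s^-1 * ((`|a| + `|b| - s) ^+ 2 + (`|a| - `|b|) ^+ 2) / 2 =
      s / 2 + s^-1 * (`|a| ^+ 2 + `|b| ^+ 2) - (`|a| + `|b|) by field; lra.
    lra.
  rewrite RintegralD//; last exact: integrable_cst_itv.
  rewrite [X in _ + X <= _]RintegralZl//.
  have cc := c_continuous_cst (len j) ((s / 2)%:C)%C.
  have s2 : 0 <= s / 2 by rewrite divr_ge0// ltW.
  have [|_ h2] := cint_bound (M := s / 2) (ltW (len_gt0 j)) cc.
    by move=> t _; rewrite /cn /= normr0 addr0 ger0_norm.
  apply: lerD; last by rewrite [leLHS]mulrC lexx.
  have -> : s * (len j / 2) = s / 2 * len j by field.
  apply: le_trans h2; rewrite le_eqVlt; apply/orP; left; apply/eqP.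
  by apply: eq_Rintegral => t _; rewrite /cn /= normr0 addr0 ger0_norm.
have hsq : L1norm h ^+ 2 <= (Lt / 2 + 1) ^+ 2 * Q.
  have [Qp|Qn] := ltP 0 Q; last first.
    have Qz : Q = 0 by apply: le_anti; rewrite Qn Q0.
    have hz : L1norm h <= 0.
      apply/ler_addgt0Pr => s s0; rewrite add0r.
      have L1 : 0 < Lt / 2 + 1 by rewrite ltr_wpDl// divr_ge0.
      have := hs (s / (Lt / 2 + 1)); rewrite divr_gt0// Qz mul0r addr0 => /(_ isT) h1.
      apply: le_trans h1 _; rewrite -mulrA ler_piMr//; first exact: ltW.
      by rewrite mulrC ler_pdivrMr// mul1r; lra.
    have := L1norm_ge0 h => h0; have -> : L1norm h = 0 by apply: le_anti; rewrite hz h0.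
    by rewrite expr2 mul0r Qz mulr0.
  have sq0 : 0 < Num.sqrt Q by rewrite sqrtr_gt0.
  have h1 : L1norm h <= (Lt / 2 + 1) * Num.sqrt Q.
    apply: le_trans (hs _ sq0) _.
    have -> : Q / Num.sqrt Q = Num.sqrt Q.
      by rewrite -{1}(sqr_sqrtr Q0) expr2 mulfK// gt_eqF.
    lra.
  rewrite -[X in _ * X](sqr_sqrtr Q0) -exprMn; apply: lerXn2r; last exact: h1.
    by rewrite nnegrE; exact: L1norm_ge0.
  by rewrite nnegrE; apply: mulr_ge0; [rewrite addr_ge0// divr_ge0|exact: ltW].
have Hb : bordered q alpha phi0 z f p (fun=> 0) h (fun=> 0) (fun=> 0).
  split; last by case.
  by apply: bvp_ext Hp => // j t _; rewrite comb0; ring.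
have fb j t : 0 <= t <= len j -> cn (f j t) <= K' * L1norm h.
  move=> tL; have := HK' f p (fun=> 0) h (fun=> 0) (fun=> 0) ih Hb j t tL.
  have -> : \sum_(v : vertex G) cn (0 : C) = 0 by apply: big1 => v _; exact: cn0.
  by rewrite big_ord0 !addr0; apply.
have cf := bvp_gcont Hp.
have Hf := gcont_L2 cf.
have QfE : sqnorm f = (\sum_j \int[mu]_(t in `[0, len j])
    (rpart (f j) t ^+ 2 + ipart (f j) t ^+ 2))%:E.
  rewrite /sqnorm -sumEFin; apply: eq_bigr => j _; rewrite /Rintegral fineK//.
  exact: (integrable_fin_num (mu := mu) (measurable_itv _) (square_integrable_sq (Hf j))).
rewrite QfE QE -EFinM lee_fin.
have KH : 0 <= K' * L1norm h by rewrite mulr_ge0 ?L1norm_ge0// ltW.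
apply: (@le_trans _ _ (\sum_(j : 'I_(nedges G)) (K' * L1norm h) ^+ 2 * 2 * len j)).
  apply: ler_sum => j _.
  pose m := (K' * L1norm h) ^+ 2 * 2.
  have m0 : 0 <= m by rewrite mulr_ge0// sqr_ge0.
  have cc := c_continuous_cst (len j) (m%:C)%C.
  have [|_ h2] := cint_bound (M := m) (ltW (len_gt0 j)) cc.
    by move=> t _; rewrite /cn /= normr0 addr0 ger0_norm.
  apply: le_trans h2; apply: le_Rintegral => //.
  - exact: square_integrable_sq.
  - exact: integrable_cst_itv.
  move=> t /=; rewrite in_itv /= => tL; rewrite /cn /= normr0 addr0 (ger0_norm m0).
  have := fb j t tL; rewrite /cn -/(rpart (f j) t) -/(ipart (f j) t).
  set a := rpart _ _; set b := ipart _ _ => ab.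
  have ha : `|a| <= K' * L1norm h by have := normr_ge0 b; lra.
  have hb : `|b| <= K' * L1norm h by have := normr_ge0 a; lra.
  have ha2 : `|a| ^+ 2 <= (K' * L1norm h) ^+ 2 by apply: lerXn2r.
  have hb2 : `|b| ^+ 2 <= (K' * L1norm h) ^+ 2 by apply: lerXn2r.
  by move: ha2 hb2; rewrite !real_normK ?num_real// /m; lra.
rewrite -mulr_sumr -/Lt /c exprMn.
have -> : K' ^+ 2 * (Lt / 2 + 1) ^+ 2 * 2 * Lt * Q =
  K' ^+ 2 * ((Lt / 2 + 1) ^+ 2 * Q) * 2 * Lt by ring.
apply: ler_wpM2r => //; apply: ler_wpM2r => //; apply: ler_wpM2l => //; exact: sqr_ge0.
Qed.

End Resolvent.

(** * Expansion at an eigenvalue *)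

Section Expansion.
Variables (R : realType) (G : metric_graph R).
Local Notation C := R[i].
Variables (q : 'I_(nedges G) -> R -> R) (alpha : vertex G -> R).
Hypothesis hq : L1_potential q.
Implicit Types (f p g h : gfun G) (v : vertex G) (e : vertex G -> C) (z w c : C).

Local Notation bvp := (bvp q alpha).
Local Notation G0 := (@gfun0 R G).

Variable lambda : R.
Local Notation z0 := (lambda%:C)%C.
Variables (d : nat) (phi psi : 'I_d -> gfun G).
Hypothesis Hphi : forall k, bvp (phi k) (psi k) (fun j t => z0 * phi k j t) (fun=> 0).
Hypothesis Hfree : forall c : 'I_d -> C, eq_on_graph (gcomb c phi) G0 -> forall k, c k = 0.
Hypothesis Hspan : forall f, A_ker q alpha z0 f -> exists c : 'I_d -> C, eq_on_graph f (gcomb c phi).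

Local Notation bordered := (bordered q alpha phi).

Lemma basis_gcont k : gcont (phi k). Proof. exact: bvp_gcont (Hphi k). Qed.
Let cphi := basis_gcont.

Let sum_mul0 (y : vertex G -> C) : \sum_v y v * 0 = 0.
Proof. by apply: big1 => v _; rewrite mulr0. Qed.

(** A combination orthogonal to the basis is orthogonal to itself. *)
Lemma gram_injective (a : 'I_d -> C) :
  (forall k, inner (gcomb a phi) (phi k) = 0) -> forall k, a k = 0.
Proof.
move=> H; apply: Hfree; apply: inner_eq0; first exact: gcont_comb.
rewrite inner_combr//; last exact: gcont_comb.
by rewrite big1// => k _; rewrite H mulr0.
Qed.

(** By Green's formula against [phi k] the border coefficients depend on the vertex data
    alone, not on the spectral parameter; this makes the pole simple and its residue
    explicit. *)
Lemma bordered_coef z f p a h e b : gcont h -> (forall k, inner h (phi k) = 0) ->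
  (forall k, b k = 0) -> bordered z f p a h e b ->
  forall k, inner (gcomb a phi) (phi k) = \sum_v (vertex_val (phi k) v)^*%C * e v.
Proof.
move=> ch h0 b0 [H1 H2] k; have cf := bvp_gcont H1.
pose h' := gadd (gadd h (gscale (-1) (gcomb a phi))) (gscale (z - z0) f).
have cc : gcont (gcomb a phi) by exact: gcont_comb.
have c1 : gcont (gscale (-1) (gcomb a phi)) by move=> j; exact: c_continuousZ.
have c2 : gcont (gscale (z - z0) f) by move=> j; exact: c_continuousZ.
have ch' : gcont h' by apply: gcont_add => //; exact: gcont_add.
have H : bvp f p (fun j t => h' j t + z0 * f j t) e.
  by apply: bvp_ext H1 => // j t _; rewrite /h' /gadd /gscale; ring.
have := bvp_green_ker (gcont_integrable ch') H (Hphi k).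
rewrite /h' !innerD// ?innerZ// ?h0 ?H2 ?b0; last exact: gcont_add.
move=> /eqP; rewrite mulr0 addr0 add0r mulN1r eqr_opp => /eqP //.
Qed.

(** The border coefficients vanish by [bordered_coef]; what remains lies in the kernel
    and is orthogonal to it. *)
Lemma basis_bordered_injective : bordered_injective q alpha phi z0.
Proof.
move=> f p a H; have [H1 H2] := H.
have c00 : gcont G0 by move=> j; exact: c_continuous_cst.
have p00 k : inner G0 (phi k) = 0.
  rewrite /inner big1// => j _; rewrite -[RHS](cint0 (len j)); apply: eq_cint => t _.
  by rewrite /gfun0 mul0r.
have a0 := gram_injective (fun k => etrans (bordered_coef c00 p00 (fun=> erefl) H k)
   (sum_mul0 _)).
split=> //.
have fker : A_ker q alpha z0 f.
  apply/A_ker_bvp => //; exists p; apply: bvp_ext H1 => // j t _.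
  by rewrite /gcomb big1 => [|k _]; [rewrite /gfun0; ring|rewrite a0 mul0r].
have [c fc] := Hspan fker.
have cf := bvp_gcont H1.
apply: inner_eq0 => //.
rewrite (inner_congr (fun j t tL => erefl) fc) inner_combr//.
by rewrite big1// => k _; rewrite H2 mulr0.
Qed.

(** Let [g v w] solve the bordered problem at [w] with unit datum at [v]; it exists also
    at [w = lambda]. Since the [phi k] are eigenfunctions, subtracting
    [(w - lambda)^-1] times its border term, whose coefficients [A v] do not depend
    on [w], gives the solution without border. The derivative of [g v] at [z] solves
    the bordered problem with right-hand side [g v z], with a quadratic remainder. *)
Lemma basis_expansion : exists (A : vertex G -> 'I_d -> C) (r : R) (g : vertex G -> C -> gfun G),
  [/\ 0 < r,
      forall v k, inner (gcomb (A v) phi) (phi k) = (vertex_val (phi k) v)^*%C,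
      forall w, cn (w - z0) < r -> w != z0 ->
        [/\ resolvent_set q alpha w, forall v, exists f, TW_solution q alpha w v f &
        forall v f, TW_solution q alpha w v f ->
          forall u, vertex_val f u =
            vertex_val (g v w) u - (w - z0)^-1 * \sum_k A v k * vertex_val (phi k) u] &
      forall z v u, cn (z - z0) < r -> exists c : C, exists2 K : R, 0 <= K &
        forall w, cn (w - z0) < r ->
          cn (vertex_val (g v w) u - vertex_val (g v z) u - (w - z) * c)
            <= K * cn (w - z) ^+ 2].
Proof.
have inj0 := basis_bordered_injective.
have [r r0 [K K0 HK]] := bordered_bound_near hq cphi inj0.
have c00 : gcont G0 by move=> j; exact: c_continuous_cst.
have i00 := gcont_integrable c00.
have p00 k : inner G0 (phi k) = 0.
  rewrite /inner big1// => j _; rewrite -[RHS](cint0 (len j)); apply: eq_cint => t _.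
  by rewrite /gfun0 mul0r.
have sum0v : \sum_(v : vertex G) cn (0 : C) = 0 by apply: big1 => v _; exact: cn0.
have sum0d : \sum_(k : 'I_d) cn (0 : C) = 0 by apply: big1 => v _; exact: cn0.
have inj w : cn (w - z0) < r -> bordered_injective q alpha phi w.
  move=> wr f p a H; split.
    move=> j t tL; apply: cn_eq0.
    have := HK w f p a G0 _ _ wr i00 H j t tL.
    by rewrite L1norm0 sum0v sum0d !addr0 mulr0; apply.
  exact: gram_injective (fun k => etrans (bordered_coef c00 p00 (fun=> erefl) H k)
   (sum_mul0 _)).
have exg (vw : vertex G * C) : exists gpa : gfun G * gfun G * ('I_d -> C),
    cn (vw.2 - z0) < r -> bordered vw.2 gpa.1.1 gpa.1.2 gpa.2 G0 (fun u => (u == vw.1)%:R) (fun=> 0).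
  have [wr|wr] := pselect (cn (vw.2 - z0) < r); last by exists (G0, G0, fun=> 0).
  have [K' _ HK'] := bordered_solvable hq cphi (inj _ wr).
  have [g [p [a [H _]]]] := HK' G0 (fun u => (u == vw.1)%:R) (fun=> 0) i00.
  by exists (g, p, a).
have [F HF] := choice exg.
pose g v w := (F (v, w)).1.1; pose p v w := (F (v, w)).1.2; pose a v w := (F (v, w)).2.
have Hg v w : cn (w - z0) < r -> bordered w (g v w) (p v w) (a v w) G0 (fun u => (u == v)%:R) (fun=> 0).
  by move=> wr; exact: HF (v, w) wr.
have sum1 (y : vertex G -> C) v : \sum_u y u * (u == v)%:R = y v.
  rewrite (bigD1 v)//= eqxx mulr1 big1 ?addr0// => u /negbTE ->.
  by rewrite mulr0.
have acoef v w : cn (w - z0) < r ->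
    forall k, inner (gcomb (a v w) phi) (phi k) = (vertex_val (phi k) v)^*%C.
  move=> wr k; rewrite (bordered_coef c00 p00 (fun=> erefl) (Hg v w wr)).
  exact: (sum1 (fun u => (vertex_val (phi k) u)^*%C)).
have z0r : cn (z0 - z0) < r by rewrite subrr cn0.
pose A v := a v z0.
have aA v w : cn (w - z0) < r -> forall k, a v w k = A v k.
  move=> wr k; apply/eqP; rewrite -subr_eq0; apply/eqP.
  apply: (gram_injective (a := fun k => a v w k - A v k)) => l.
  have -> : gcomb (fun k => a v w k - A v k) phi =
            gadd (gcomb (a v w) phi) (gscale (-1) (gcomb (A v) phi)).
    apply/funext => j; apply/funext => t; rewrite /gcomb /gadd /gscale mulN1r -sumrB.
    by apply: eq_bigr => i _; ring.
  rewrite innerD//; last 2 first.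
  - exact: gcont_comb.
  - by move=> j; apply: c_continuousZ; exact: gcont_comb.
  - rewrite innerZ//; last exact: gcont_comb.
    by have := acoef v z0 z0r l; rewrite -/(A v) (acoef v w wr) => ->; ring.
exists A, r, g; split=> //.
- by move=> v k; exact: acoef.
- move=> w wr wz0.
  have nk : forall f, A_ker q alpha w f -> eq_on_graph f G0.
    move=> f /(A_ker_bvp _ hq)[pf Hf].
    have cf := bvp_gcont Hf.
    have cwf : gcont (gscale (w - z0) f) by move=> j; exact: c_continuousZ.
    have Hf' : bvp f pf (fun j t => gscale (w - z0) f j t + z0 * f j t) (fun=> 0).
      by apply: bvp_ext Hf => // j t _; rewrite /gscale; ring.
    have pf0 k : inner f (phi k) = 0.
      have := bvp_green_ker (gcont_integrable cwf) Hf' (Hphi k).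
      rewrite innerZ// big1 => [|v _]; last by rewrite mulr0.
      move=> /eqP; rewrite oppr0 mulf_eq0 subr_eq0 (negbTE wz0) /= => /eqP //.
    have [] := inj w wr f pf (fun=> 0); last by [].
    split=> //; apply: bvp_ext Hf => // j t _.
    by rewrite /gcomb big1 => [|k _]; [rewrite /gfun0; ring|rewrite mul0r].
  pose cs v k := - (w - z0)^-1 * A v k.
  pose Fs v := gadd (g v w) (gcomb (cs v) phi); pose Ps v := gadd (p v w) (gcomb (cs v) psi).
  have HFs v : bvp (Fs v) (Ps v) (fun j t => w * Fs v j t) (fun u => (u == v)%:R).
    have [Hg1 _] := Hg v w wr.
    have [K1 K2 K3] : bvp (Fs v) (Ps v) (fun j t => w * Fs v j t)
       (fun u => (u == v)%:R + \sum_k cs v k * 0).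
      apply: bvp_ext (bvpD Hg1 (bvp_comb (cs v) Hphi)) => // j t _; rewrite /Fs /gadd.
      have -> : gcomb (a v w) phi j t = - (w - z0) * gcomb (cs v) phi j t.
        rewrite /gcomb mulr_sumr; apply: eq_bigr => k _; rewrite aA// /cs.
        have wz : w - z0 != 0 by rewrite subr_eq0.
        by field.
      have -> : gcomb (cs v) (fun k j t => z0 * phi k j t) j t = z0 * gcomb (cs v) phi j t.
        by rewrite /gcomb mulr_sumr; apply: eq_bigr => k _; ring.
      by rewrite /gfun0; ring.
    split=> // u; rewrite K3 big1 ?addr0// => k _; exact: mulr0.
  split; first exact: no_kernel_resolvent.
    by move=> v; exists (Fs v); have [] := bvp_classical (HFs v).
  move=> v f [[_ acf] cf Lf df] u.
  have igf : gintegrable (fun j t => w * f j t).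
    by move=> j; apply: cintegrableZ; apply: c_continuous_integrable; case: cf.
  have [pf Hf] := classical_bvp hq igf acf Lf cf df.
  have f0 : eq_on_graph (gadd f (gscale (-1) (Fs v))) G0.
    apply: nk; apply/A_ker_bvp => //; exists (gadd pf (gscale (-1) (Ps v))).
    have [K1 K2 K3] : bvp (gadd f (gscale (-1) (Fs v))) (gadd pf (gscale (-1) (Ps v)))
       (fun j t => w * gadd f (gscale (-1) (Fs v)) j t) (fun u => (u == v)%:R + -1 * (u == v)%:R).
      apply: bvp_ext (bvpD Hf (bvpZ (-1) (HFs v))) => // j t _; rewrite /gadd /gscale; ring.
    by split=> // u'; rewrite K3; ring.
  have fE : eq_on_graph f (gadd (g v w) (gcomb (cs v) phi)).
    move=> j t tL; have := f0 j t tL; rewrite /gadd /gscale /gfun0 mulN1r => /eqP.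
    by rewrite subr_eq0 => /eqP.
  rewrite /vertex_val (eq_on_graph_end_val _ fE) -!/(vertex_val _ _).
  rewrite {1}/end_val /gadd -!/(end_val _ _); congr (_ + _).
  rewrite /gcomb mulr_sumr -sumrN; apply: eq_bigr => k _.
  by rewrite /cs /end_val; ring.
- move=> z v u zr.
  have [K' _ HK'] := bordered_solvable hq cphi (inj _ zr).
  have cg : gcont (g v z) by exact: bvp_gcont (Hg v z zr).1.
  have [k [pk [ak [Hk _]]]] := HK' (g v z) (fun=> 0) (fun=> 0) (gcont_integrable cg).
  have pg i : inner (g v z) (phi i) = 0 by exact: (Hg v z zr).2.
  have ak0 := gram_injective (fun k => etrans (bordered_coef cg pg (fun=> erefl) Hk k)
   (sum_mul0 _)).
  have ck : gcont k by exact: bvp_gcont Hk.1.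
  have [m m0 Hm] := gfun_bound ck ck.
  exists (vertex_val k u), (K * L1norm k); first by rewrite mulr_ge0 ?L1norm_ge0// ltW.
  move=> w wr.
  pose U := gadd (gadd (g v w) (gscale (-1) (g v z))) (gscale (- (w - z)) k).
  pose P := gadd (gadd (p v w) (gscale (-1) (p v z))) (gscale (- (w - z)) pk).
  have cwk : gcont (gscale ((w - z) ^+ 2) k) by move=> j; exact: c_continuousZ.
  have HU : bordered w U P (fun=> 0) (gscale ((w - z) ^+ 2) k) (fun=> 0) (fun=> 0).
    have [Gw1 Gw2] := Hg v w wr; have [Gz1 Gz2] := Hg v z zr; have [Hk1 Hk2] := Hk.
    have H1 := bvpD (bvpD Gw1 (bvpZ (-1) Gz1)) (bvpZ (- (w - z)) Hk1).
    split.
      have [K1 K2 K3] : bvp U P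
         (fun j t => (gscale ((w - z) ^+ 2) k j t - gcomb (fun=> 0) phi j t) + w * U j t)
         (fun u => ((u == v)%:R + -1 * (u == v)%:R) + - (w - z) * 0).
        apply: bvp_ext H1 => // j t _; rewrite /U /gadd /gscale.
        have -> : gcomb (fun=> 0) phi j t = 0 by rewrite /gcomb big1// => i _; rewrite mul0r.
        have -> : gcomb ak phi j t = 0 by rewrite /gcomb big1// => i _; rewrite ak0 mul0r.
        have -> : gcomb (a v w) phi j t = gcomb (a v z) phi j t.
          by apply: eq_bigr => i _; rewrite !aA.
        by rewrite /gfun0; ring.
      by split=> // u'; rewrite K3; ring.
    move=> i; rewrite /U innerD//; last 2 first.
    - by apply: gcont_add => [|j]; [exact: bvp_gcont Gw1|exact: c_continuousZ].
    - by move=> j; exact: c_continuousZ.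
    rewrite innerD//; last 2 first.
    - exact: bvp_gcont Gw1.
    - by move=> j; exact: c_continuousZ.
    by rewrite !innerZ// Gw2 Gz2 Hk2; ring.
  have hb : L1norm (gscale ((w - z) ^+ 2) k) <= cn (w - z) ^+ 2 * L1norm k.
    rewrite /L1norm mulr_sumr; apply: ler_sum => j _.
    have ick : (lebesgue_measure).-integrable `[0, len j] (EFin \o (fun t => cn (k j t))).
      have [hr hi] := gcont_integrable ck j; apply: integrableD_itv.
        by have := integrable_abse hr; exact.
      by have := integrable_abse hi; exact.
    rewrite -RintegralZl//; apply: le_Rintegral => //.
    + have [hr hi] := gcont_integrable cwk j; apply: integrableD_itv.
        by have := integrable_abse hr; exact.
      by have := integrable_abse hi; exact.
    + exact: integrableZ_itv.
    + move=> t _; apply: le_trans (cnM _ _) _; apply: ler_wpM2r; first exact: cn_ge0.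
      by rewrite !expr2; exact: cnM.
  have yL : 0 <= (if (vertex_repr u).2 then len (vertex_repr u).1 else 0) <= len (vertex_repr u).1.
    by have := len_gt0 (vertex_repr u).1; case: (_.2) => l0; rewrite ?lexx ltW.
  have := HK w U P _ _ _ _ wr (gcont_integrable cwk) HU _ _ yL.
  rewrite sum0v sum0d !addr0 => h1.
  have -> : vertex_val (g v w) u - vertex_val (g v z) u - (w - z) * vertex_val k u =
            U (vertex_repr u).1 (if (vertex_repr u).2 then len (vertex_repr u).1 else 0).
    by rewrite /U /gadd /gscale /vertex_val /end_val; ring.
  apply: le_trans h1 _; rewrite -mulrA; apply: ler_wpM2l; first exact: ltW.
  by rewrite mulrC.
Qed.

End Expansion.

(** * Laurent expansions *)

Section ComplexLocal.
Variable R : realType.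
Local Notation C := R[i].
Implicit Types (z w c u : C) (F : C -> C).

Lemma normc_le_cn w : `|w| <= (cn w)%:C%C.
Proof.
case: w => a b; rewrite normc_def /= lecR /cn /=.
rewrite -[leRHS]ger0_norm ?addr_ge0// -sqrtr_sqr ler_wsqrtr//.
rewrite sqrrD !real_normK ?num_real// -addrA lerD2l lerDr.
by rewrite mulrn_wge0// mulr_ge0.
Qed.

Lemma cn_le_normc w : (cn w)%:C%C <= 2 * `|w|.
Proof.
case: w => a b; rewrite normc_def /=.
have -> : 2 * (Num.sqrt (a ^+ 2 + b ^+ 2))%:C%C = (2 * Num.sqrt (a ^+ 2 + b ^+ 2))%:C%C :> C.
  by rewrite rmorphM /= rmorph_nat.
rewrite lecR /cn /=.
have ha : `|a| <= Num.sqrt (a ^+ 2 + b ^+ 2).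
  by rewrite -sqrtr_sqr ler_wsqrtr// lerDl sqr_ge0.
have hb : `|b| <= Num.sqrt (a ^+ 2 + b ^+ 2).
  by rewrite -[in leLHS]sqrtr_sqr ler_wsqrtr// lerDr sqr_ge0.
lra.
Qed.

Lemma cnM_ge u w : cn u * cn w <= 4 * cn (u * w).
Proof.
have h : ((cn u * cn w)%:C)%C <= ((4 * cn (u * w))%:C)%C :> C.
  apply: (@le_trans _ _ ((2 * `|u|) * (2 * `|w|))).
    rewrite rmorphM /=; apply: ler_pM; rewrite ?lec0R//; last exact: cn_le_normc.
    - by rewrite lecR cn_ge0.
    - by rewrite lecR cn_ge0.
    - exact: cn_le_normc.
  have -> : 2 * `|u| * (2 * `|w|) = 4 * `|u * w| by rewrite normrM; ring.
  rewrite rmorphM /= rmorph_nat; apply: ler_wpM2l => //; exact: normc_le_cn.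
by move: h; rewrite lecR.
Qed.

Lemma near_cnP z (P : C -> Prop) : (\forall w \near (z : C^o), P w) <->
  exists2 r : R, 0 < r & forall w, cn (w - z) < r -> P w.
Proof.
split.
  move=> /nbhs_ballP[e /= e0 He].
  have eE : e = ((complex.Re e)%:C)%C.
    by case: e e0 {He} => a b; rewrite ltcE /= => /andP[/eqP -> _].
  have e0' : 0 < complex.Re e by move: e0; rewrite {1}eE ltcR.
  exists (complex.Re e) => // w wr; apply: He.
  rewrite /ball/= distrC eE; apply: le_lt_trans (normc_le_cn _) _.
  by rewrite ltcR.
move=> [r r0 H]; apply/nbhs_ballP; exists ((r / 2)%:C)%C => /=.
  by rewrite ltcR divr_gt0.
move=> w; rewrite /ball/= distrC => wr; apply: H.
have : ((cn (w - z))%:C)%C < (r%:C)%C :> C.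
  apply: le_lt_trans (cn_le_normc _) _.
  have -> : (r%:C)%C = 2 * ((r / 2)%:C)%C :> C.
    by rewrite -[2](rmorph_nat (real_complex R)) -rmorphM /=; congr (_%:C)%C; field.
  by rewrite ltr_pM2l.
by rewrite ltcR.
Qed.

Lemma dnear_cnP z (P : C -> Prop) : (\forall w \near (z : C^o)^'%classic, P w) <->
  exists2 r : R, 0 < r & forall w, cn (w - z) < r -> w != z -> P w.
Proof. by rewrite /dnbhs /within /=; split => /near_cnP. Qed.

Lemma quadratic_derivable F z c (K r : R) : 0 < r -> 0 <= K ->
  (forall w, cn (w - z) < r -> cn (F w - F z - (w - z) * c) <= K * cn (w - z) ^+ 2) ->
  derivable (F : C^o -> C^o) z 1.
Proof.
move=> r0 K0 H; apply: (@cvgP _ _ (c : C^o)).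
apply/cvgrPdist_le => e e0.
have eE : e = ((complex.Re e)%:C)%C.
  by case: e e0 => a b; rewrite ltcE /= => /andP[/eqP -> _].
have e0' : 0 < complex.Re e by move: e0; rewrite {1}eE ltcR.
have K1 : 0 < 4 * K + 1 by lra.
apply/dnear_cnP; exists (Num.min r (complex.Re e / (4 * K + 1))).
  by rewrite lt_min r0 divr_gt0.
move=> h; rewrite subr0 lt_min => /andP[hr he] h0 /=.
have E : c - h^-1 *: (F (h *: 1 + z) - F z) = - (h^-1 * (F (h + z) - F z - h * c)).
  rewrite /GRing.scale /= mulr1; field.
  by rewrite h0.
rewrite E normrN normrM normfV.
have hn0 : 0 < `|h| by rewrite normr_gt0.
rewrite mulrC ler_pdivrMr//.
have := H (h + z); rewrite addrK => /(_ hr) h1.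
apply: le_trans (normc_le_cn _) _.
apply: (@le_trans _ _ ((K * cn h ^+ 2)%:C)%C); first by rewrite lecR.
apply: (@le_trans _ _ ((4 * K * cn h)%:C%C * `|h|)).
  have -> : ((K * cn h ^+ 2)%:C)%C = ((K * cn h)%:C)%C * ((cn h)%:C)%C :> C.
    by rewrite -rmorphM /= expr2 mulrA.
  have -> : ((4 * K * cn h)%:C)%C * `|h| = ((K * cn h)%:C)%C * (4 * `|h|) :> C.
    rewrite -mulrA rmorphM /= rmorph_nat; ring.
  apply: ler_wpM2l; first by rewrite lecR mulr_ge0// cn_ge0.
  apply: le_trans (cn_le_normc _) _; apply: ler_wpM2r => //.
  by rewrite ler_nat.
apply: ler_wpM2r => //; rewrite eE lecR.
move: he; rewrite ltr_pdivlMr// => he.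
have := cn_ge0 h; lra.
Qed.

Lemma simple_pole_derivable (z u s : C) (H : C -> C) : u != z ->
  derivable (H : C^o -> C^o) u 1 ->
  derivable ((fun x => (x - z)^-1 * s + H x) : C^o -> C^o) u 1.
Proof.
move=> uz dH.
pose D x : C := x - z.
have dD : derivable (D : C^o -> C^o) u 1.
  by apply: derivableB; [exact: derivable_id|exact: derivable_cst].
have dV : derivable ((fun x => (D x)^-1) : C^o -> C^o) u 1.
  by apply: (@derivableV C C^o D u 1 _ dD); rewrite /D subr_eq0.
have dM : derivable ((fun x => (D x)^-1 * s) : C^o -> C^o) u 1.
  by apply: (@derivableM C C^o (fun x => (D x)^-1) (fun=> s) u 1 dV); exact: derivable_cst.
exact: (@derivableD C C^o C^o (fun x => (D x)^-1 * s) H u 1 dM dH).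
Qed.

Lemma derivable_near_bounded F z : derivable (F : C^o -> C^o) z 1 ->
  exists2 r : R, 0 < r & exists M : R, forall w, cn (w - z) < r -> cn (F w) <= M.
Proof.
move=> dF; have cF : {for (z : C^o), continuous (F : C^o -> C^o)}.
  by apply: differentiable_continuous; apply/derivable1_diffP.
have /cvgrPdist_lt /(_ 1 ltr01) /near_cnP[r r0 Hr] := cF.
exists r => //; exists (cn (F z) + 2) => w wr.
have := Hr w wr; rewrite distrC => h.
have : cn (F w - F z) <= 2.
  rewrite -lecR; apply: le_trans (cn_le_normc _) _.
  by rewrite rmorph_nat -[leRHS]mulr1 ler_wpM2l// ltW.
move=> h2; have := cnD (F z) (F w - F z); rewrite addrC subrK; lra.
Qed.

(** Letting [u] tend to 0 shows that the constant term vanishes; then a factor [u] is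
    divided out. *)
Lemma flat_polynomial N : forall (a : nat -> C) (K r : R), 0 < r ->
  (forall u, u != 0 -> cn u < r -> cn (\sum_(i < N) a i * u ^+ i) <= K * cn u ^+ N) ->
  forall i, (i < N)%N -> a i = 0.
Proof.
elim: N => // N IH a K r r0 H.
have a0 : a 0%N = 0.
  apply: cn_eq0; apply/ler_addgt0Pr => e e0; rewrite add0r.
  pose B := `|K| + \sum_(i < N) cn (a i.+1).
  have B0 : 0 <= B by rewrite addr_ge0// sumr_ge0// => i _; exact: cn_ge0.
  pose t := Num.min (Num.min (r / 2) 1) (e / (B + 1)).
  have t0 : 0 < t.
    by rewrite !lt_min divr_gt0//= ltr01/= divr_gt0//; lra.
  have [tr [t1 te]] : t <= r / 2 /\ t <= 1 /\ t <= e / (B + 1).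
    by rewrite !ge_min !lexx !orbT.
  have cnt : cn (t%:C)%C = t by rewrite /cn /= normr0 addr0 gtr0_norm.
  have tn0 : (t%:C)%C != 0 :> C by rewrite eq_complex /= eqxx andbT gt_eqF.
  have cnX i : cn ((t%:C)%C ^+ i) = t ^+ i.
    by rewrite -rmorphXn /= /cn /= normr0 addr0 ger0_norm// exprn_ge0// ltW.
  have := H (t%:C)%C tn0; rewrite cnt => /(_ _) h1.
  have {}h1 : cn (\sum_(i < N.+1) a i * (t%:C)%C ^+ i) <= K * t ^+ N.+1 by apply: h1; lra.
  rewrite big_ord_recl /= expr0 mulr1 in h1.
  have h2 : cn (\sum_(i < N) a (lift ord0 i) * (t%:C)%C ^+ lift ord0 i) <=
            (\sum_(i < N) cn (a i.+1)) * t.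
    apply: le_trans (cn_sum _ _ _) _; rewrite mulr_suml; apply: ler_sum => i _.
    apply: le_trans (cnM _ _) _; apply: ler_wpM2l; first exact: cn_ge0.
    by rewrite cnX exprS ler_piMr// ?exprn_ile1// ltW.
  have tN : 0 <= t ^+ N by rewrite exprn_ge0// ltW.
  have h3 : K * t ^+ N.+1 <= `|K| * t.
    apply: (@le_trans _ _ (`|K| * t ^+ N.+1)).
      by apply: ler_wpM2r; [rewrite exprn_ge0// ltW|exact: ler_norm].
    by apply: ler_wpM2l => //; rewrite exprS ler_piMr// ?exprn_ile1// ltW.
  have h4 : B * t <= e.
    have : (B + 1) * t <= e by rewrite mulrC -ler_pdivlMr//; lra.
    lra.
  set X := \sum_(i < N) _ in h1 h2.
  have := cnB (a 0%N + X) X; rewrite addrK.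
  by rewrite /B mulrDl in h4; lra.
case=> [//|i] iN.
apply: (IH (fun i => a i.+1) (4 * K) r r0) => // u u0 ur.
have := H u u0 ur; rewrite big_ord_recl /= a0 mul0r add0r.
set X := \sum_(i < N) a i.+1 * u ^+ i.
have -> : \sum_(i < N) a (bump 0 i) * u ^+ bump 0 i = u * X.
  by rewrite /X mulr_sumr; apply: eq_bigr => k _; rewrite /bump /= add1n exprS; ring.
move=> h; have cu : 0 < cn u.
  rewrite lt_neqAle cn_ge0 andbT eq_sym; apply: contra u0 => /eqP cu.
  by apply/eqP/cn_eq0; rewrite cu.
have h1 := cnM_ge u X.
rewrite -(ler_pM2l cu); apply: le_trans h1 _.
by rewrite exprS in h; rewrite [leRHS](_ : _ = 4 * (K * (cn u * cn u ^+ N))); [lra|ring].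
Qed.

End ComplexLocal.

Section Residue.
Variables (R : realType) (m : nat).
Local Notation C := R[i].
Implicit Types (F H : C -> 'M[C]_m) (z w : C) (S : 'M[C]_m).

Lemma mx_analytic_bounded H z (k l : 'I_m) : mx_analytic_at H z ->
  exists2 r : R, 0 < r & exists M : R, forall w, cn (w - z) < r -> cn (H w k l) <= M.
Proof.
move=> /(_ k l) /nbhs_singleton; exact: (@derivable_near_bounded R (fun u => H u k l)).
Qed.

(** Multiplying the difference of two expansions by a high enough power of [w - z] gives
    a polynomial to which [flat_polynomial] applies. *)
Lemma residue_unique F z S S' : is_residue F z S -> is_residue F z S' -> S = S'.
Proof.
move=> [n [c [H [c0 aH FH]]]] [n' [c' [H' [c0' aH' FH']]]].
rewrite -c0 -c0'; apply/matrixP => k l.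
have [r1 r10 [M1 HM1]] := mx_analytic_bounded k l aH.
have [r2 r20 [M2 HM2]] := mx_analytic_bounded k l aH'.
have /dnear_cnP[r3 r30 H3] := FH; have /dnear_cnP[r4 r40 H4] := FH'.
pose N := (maxn n n').+1.
pose b i := (if (i < n.+1)%N then c i k l else 0) - (if (i < n'.+1)%N then c' i k l else 0).
have sumE (e : nat -> 'M[C]_m) p (w : C) : (p < N)%N ->
    (\sum_(i < p.+1) (w - z) ^- i.+1 *: e i) k l =
    \sum_(i < N) (if (i < p.+1)%N then e i k l else 0) * (w - z) ^- i.+1.
  move=> pN; rewrite summxE.
  rewrite (big_ord_widen_cond N xpredT (fun i => ((w - z) ^- i.+1 *: e i) k l))//.
  rewrite big_mkcond /=; apply: eq_bigr => i _; case: ifP => _; last by rewrite mul0r.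
  by rewrite mxE mulrC.
have nN : (n < N)%N by rewrite ltnS leq_maxl.
have n'N : (n' < N)%N by rewrite ltnS leq_maxr.
pose r := Num.min (Num.min r1 r2) (Num.min r3 r4).
have r0 : 0 < r by rewrite !lt_min r10 r20 r30.
have flat u : u != 0 -> cn u < r ->
    cn (\sum_(i < N) b (N.-1 - i)%N * u ^+ i) <= (M1 + M2) * cn u ^+ N.
  rewrite !lt_min => u0 /andP[/andP[ur1 ur2] /andP[ur3 ur4]].
  have uz : u + z - z = u by rewrite addrK.
  have uz0 : u + z != z by rewrite -subr_eq0 uz.
  have := H3 (u + z); rewrite uz => /(_ ur3 uz0) E1.
  have := H4 (u + z); rewrite uz => /(_ ur4 uz0) E2.
  have E : \sum_(i < N) b i * u ^- i.+1 = H' (u + z) k l - H (u + z) k l.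
    have := congr1 (fun A : 'M[C]_m => A k l) (etrans (esym E1) E2).
    rewrite !mxE -{1 3}uz !sumE// uz => E3.
    rewrite (eq_bigr (fun i : 'I_N => (if (i < n.+1)%N then c i k l else 0) * u ^- i.+1 -
       (if (i < n'.+1)%N then c' i k l else 0) * u ^- i.+1)); last first.
      by move=> i _; rewrite mulrBl.
    rewrite sumrB -[X in X - _ = _](addrK (H (u + z) k l)) E3; ring.
  (* multiplication by [u ^+ N] reverses the order of the coefficients *)
  have -> : \sum_(i < N) b (N.-1 - i)%N * u ^+ i = u ^+ N * (H' (u + z) k l - H (u + z) k l).
    rewrite -E mulr_sumr (reindex_inj rev_ord_inj) /=; apply: eq_bigr => i _.
    have iN : (i <= N.-1)%N by rewrite -ltnS prednK.
    rewrite subSS subKn//.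
    rewrite mulrCA; congr (_ * _).
    have -> : u ^+ N = u ^+ (N.-1 - i) * u ^+ i.+1.
      by rewrite -exprD addnS subnK.
    by rewrite mulfK// expf_neq0.
  apply: le_trans (cnM _ _) _; rewrite mulrC.
  have cX p : cn (u ^+ p) <= cn u ^+ p.
    elim: p => [|p IH]; first by rewrite !expr0 /cn /= normr1 normr0 addr0.
    rewrite !exprS; apply: le_trans (cnM _ _) _.
    by apply: ler_wpM2l => //; exact: cn_ge0.
  apply: ler_pM; rewrite ?cn_ge0//.
  apply: le_trans (cnB _ _) _; rewrite addrC; apply: lerD.
    by apply: HM1; rewrite uz.
  by apply: HM2; rewrite uz.
have := @flat_polynomial R N (fun i => b (N.-1 - i)%N) (M1 + M2) r r0 flat N.-1 (leqnn N).
rewrite subnn /b /= => /eqP; rewrite subr_eq0 => /eqP //.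
Qed.

Lemma residueE F z S : is_residue F z S -> residue F z = S.
Proof.
move=> H; rewrite /residue; case: xgetP => [S' _ H'|/(_ S)//].
exact: residue_unique H' H.
Qed.

Lemma removable_residue F z : removable F z -> is_residue F z 0.
Proof.
move=> [H aH FH]; exists 0%N, (fun=> 0), H; split=> //.
by move: FH; apply: filterS => w ->; rewrite big_ord1 scaler0 add0r.
Qed.

Lemma simple_pole_residue F H z S : mx_analytic_at H z ->
  (\forall w \near (z : C^o)^'%classic, F w = (w - z)^-1 *: S + H w) -> is_residue F z S.
Proof.
move=> aH FH; exists 0%N, (fun=> S), H; split=> //.
by move: FH; apply: filterS => w ->; rewrite big_ord1 expr1.
Qed.

End Residue.

(** * Propagation of zeros along a spanning tree *)

Section RootedTree.
Variables (R : realType) (G : metric_graph R).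
Hypothesis hG : graph_connected G.
Local Notation V := (vertex G).
Local Notation E := (endpoint G).
Implicit Types (v w u : V) (x y : E) (j : 'I_(nedges G)).

Definition opp x : E := (x.1, ~~ x.2).

Lemma oppK x : opp (opp x) = x.
Proof. by case: x => j b; rewrite /opp /= negbK. Qed.

Lemma same_edge x y : x.1 = y.1 -> x = y \/ x = opp y.
Proof.
case: x => j [] ; case: y => k [] /= ->; rewrite /opp /=; by [left|right].
Qed.

Lemma other_endpoint v x : vertex_of x = v -> v \notin boundary G ->
  exists2 y, y != x & vertex_of y = v.
Proof.
move=> xv; rewrite inE /degree => dv.
have xin : x \in val v by rewrite mem_vertex xv.
have : (0 < #|val v :\ x|)%N.
  by move: dv; rewrite (cardsD1 x (val v)) xin add1n eqSS -lt0n.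
case/card_gt0P => y; rewrite !inE => /andP[yx yv].
by exists y => //; apply/eqP; rewrite -mem_vertex.
Qed.

Lemma boundary_endpoint v x y : v \in boundary G -> vertex_of x = v -> vertex_of y = v -> x = y.
Proof.
rewrite inE => /cards1P[w vw] xv yv.
have : x \in val v by rewrite mem_vertex xv.
have : y \in val v by rewrite mem_vertex yv.
by rewrite vw !inE => /eqP -> /eqP ->.
Qed.

Lemma adjacent_endpoint u v : Defs.adjacent u v -> exists x, vertex_of x = v /\ vertex_of (opp x) = u.
Proof.
move=> /existsP[j /orP[/andP[/eqP ju /eqP jv]|/andP[/eqP jv /eqP ju]]].
  by exists (j, true).
by exists (j, false).
Qed.

(** Breadth-first search: [h] is the distance to the root, and [pi v] is the end at [v] of
    the last edge of a shortest path from the root. The edges of the [pi v] form a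
    spanning tree. *)
Lemma rooted_tree v0 : exists (h : V -> nat) (pi : V -> E), forall v, v != v0 ->
  vertex_of (pi v) = v /\ (h (vertex_of (opp (pi v))) < h v)%N.
Proof.
pose reach v n := [exists p : n.-tuple V, path (@Defs.adjacent R G) v0 p && (last v0 p == v)].
have ex v : exists n, reach v n.
  have /connectP[p pp ->] := hG v0 v.
  by exists (size p); apply/existsP; exists (in_tuple p); rewrite /= pp eqxx.
pose h v := ex_minn (ex v).
have hP v : reach v (h v) by rewrite /h; case: ex_minnP.
have hmin v n : reach v n -> (h v <= n)%N by rewrite /h; case: ex_minnP => m _ H /H.
have par v : exists x, v != v0 -> vertex_of x = v /\ (h (vertex_of (opp x)) < h v)%N.
  have [->|vv0] := eqVneq v v0; first by exists (vertex_repr v0).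
  have /existsP[p /andP[pp /eqP lp]] := hP v.
  case/lastP E : (tval p) pp lp => [|s u] /=; first by move=> _ v0v; rewrite v0v eqxx in vv0.
  rewrite rcons_path last_rcons => /andP[ps su] uv.
  have [x [xv xu]] := adjacent_endpoint su.
  exists x => _; rewrite xv uv; split=> //.
  rewrite xu; have hs : (h v = (size s).+1)%N by rewrite -(size_tuple p) E size_rcons.
  rewrite hs ltnS; apply: hmin; apply/existsP; exists (in_tuple s) => /=.
  by rewrite ps eqxx.
have [pi Hpi] := choice par.
by exists h, pi.
Qed.

Section Tree.
Variables (v0 : V) (h : V -> nat) (pi : V -> E).
Hypothesis Hpi : forall v, v != v0 ->
  vertex_of (pi v) = v /\ (h (vertex_of (opp (pi v))) < h v)%N.

Let par v := if v == v0 then v0 else vertex_of (opp (pi v)).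

Lemma tree_edge_inj v w : v != v0 -> w != v0 -> (pi v).1 = (pi w).1 -> v = w.
Proof.
move=> vv0 wv0 /same_edge[e|e].
  by have [<- _] := Hpi vv0; have [<- _] := Hpi wv0; rewrite e.
have [h1 h2] := Hpi vv0; have [h3 h4] := Hpi wv0.
have e' : opp (pi v) = pi w by rewrite e oppK.
move: h2 h4; rewrite e' h3 -e h1 => h5 h6.
by have := ltn_trans h5 h6; rewrite ltnn.
Qed.

Definition nontree : {set 'I_(nedges G)} :=
  (~: [set (pi v).1 | v in [set~ v0]])%SET.

Lemma card_nontree : (#|nontree|)%:Z = cyc G.
Proof.
have c1 : #|[set (pi v).1 | v in [set~ v0]]%SET| = #|V|.-1.
  rewrite card_in_imset; first by rewrite cardsC1.
  by move=> v w; rewrite !inE; exact: tree_edge_inj.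
have V0 : (0 < #|V|)%N by apply/card_gt0P; exists v0.
have := cardsC [set (pi v).1 | v in [set~ v0]]%SET.
rewrite c1 card_ord -/nontree => /(congr1 Posz); rewrite PoszD => e.
have [n nE] : exists n, #|V| = n.+1 by exists #|V|.-1; rewrite prednK.
by rewrite /cyc -e nE /= -addn1 PoszD; ring.
Qed.

Lemma treeP j : j \notin nontree -> exists2 w, w != v0 & (pi w).1 = j.
Proof.
by rewrite inE negbK => /imsetP[w]; rewrite !inE => wv0 ->; exists w.
Qed.

Lemma nontree_pi v : v != v0 -> (pi v).1 \notin nontree.
Proof.
by move=> vv0; rewrite inE negbK; apply/imsetP; exists v => //; rewrite !inE.
Qed.

(** The ancestor comes first: [v] lies on the tree path from [w] to the root. *)
Let anc v w := fconnect par w v.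

Let par_lt v : v != v0 -> (h (par v) < h v)%N.
Proof. by move=> vv0; rewrite /par (negbTE vv0); case: (Hpi vv0). Qed.

Let anc_iter v w : anc v w -> exists n, iter n par w = v.
Proof. by move=> H; exists (findex par w v); exact: iter_findex. Qed.

Let anc_lt v w : anc v w -> v = w \/ (h v < h w)%N.
Proof.
move=> /anc_iter[n <-]; elim: n => [|n IH] /=; first by left.
have [e|/par_lt lt] := eqVneq (iter n par w) v0.
  by rewrite /par e eqxx -e.
by right; case: IH => [e|lt']; [rewrite -[X in (_ < h X)%N]e|exact: ltn_trans lt'].
Qed.

Let anc_par v w : v != w -> anc v w -> anc v (par w).
Proof.
move=> vw /anc_iter[[|n] e]; first by rewrite -e /= eqxx in vw.
by rewrite -e iterSr; exact: fconnect_iter.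
Qed.

Let anc_of_par v w : anc v (par w) -> anc v w.
Proof. by move=> H; apply: connect_trans H; exact: fconnect1. Qed.

Let anc_linear u v w : anc u w -> anc v w -> anc u v \/ anc v u.
Proof.
move=> /anc_iter[n <-] /anc_iter[m <-].
have [nm|/ltnW mn] := leqP n m.
  by right; rewrite -(subnK nm) iterD; exact: fconnect_iter.
by left; rewrite -(subnK mn) iterD; exact: fconnect_iter.
Qed.

Let anc_child_uniq u v w : u != v0 -> v != v0 -> par u = par v -> anc u w -> anc v w -> u = v.
Proof.
have main u' v' : u' != v0 -> par u' = par v' -> anc u' v' -> u' = v'.
  move=> uv0 e a; apply/eqP; apply/negPn/negP => uv.
  have := anc_lt (anc_par uv a); rewrite -e.
  have := par_lt uv0 => lt [e'|lt']; first by rewrite -e' ltnn in lt.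
  by have := ltn_trans lt lt'; rewrite ltnn.
move=> uv0 vv0 e au av; case: (anc_linear au av) => [/(main _ _ uv0 e)//|].
by move=> /(main _ _ vv0 (esym e)).
Qed.

Let top_ancestor v : v != v0 -> exists2 w, w != v0 & anc w v /\ par w = v0.
Proof.
have [n] := ubnP (h v); elim: n v => // n IH v; rewrite ltnS => hv vv0.
have [e|pv0] := eqVneq (par v) v0; first by exists v => //; split=> //; exact: connect0.
have [|w wv0 [aw pw]] := IH (par v) _ pv0; first exact: leq_trans (par_lt vv0) hv.
by exists w => //; split=> //; exact: anc_of_par.
Qed.

(** The apex is the common ancestor of the two ends of the chord that is farthest from
    the root. The root has degree one, so all other vertices descend from one child of
    it, and it is not the apex itself. [xi] is the end at the apex of an edge of the
    fundamental cycle of the chord. *)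
Lemma chord_apex e0 : v0 \in boundary G -> e0 \in nontree ->
  exists (c : V) (xi : E), [/\ c != v0, vertex_of xi = c,
    anc c (vertex_of (e0, false)) && anc c (vertex_of (e0, true)) &
    xi = (e0, false) \/
    exists y : V, [/\ y != v0, xi = opp (pi y), anc y (vertex_of (e0, false)) &
                  ~~ anc y (vertex_of (e0, true))]].
Proof.
move=> v0b e0n; set a := vertex_of (e0, false); set b := vertex_of (e0, true).
have nv0 x : x.1 \in nontree -> vertex_of x != v0.
  move=> xn; apply/eqP => xv0.
  have [e|ov0] := eqVneq (vertex_of (opp x)) v0.
    have := boundary_endpoint v0b xv0 e; case: (x) => j [] //.
  have [w wv0 [_ pw]] := top_ancestor ov0.
  have pw' : vertex_of (opp (pi w)) = v0 by move: pw; rewrite /par (negbTE wv0).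
  have e := boundary_endpoint v0b xv0 pw'.
  by have := nontree_pi wv0; move: xn; rewrite e /= => ->.
have av0 : a != v0 by exact: nv0.
have bv0 : b != v0 by exact: nv0.
have [wa wav0 [wa1 wa2]] := top_ancestor av0.
have [wb wbv0 [wb1 wb2]] := top_ancestor bv0.
have wab : wa = wb.
  apply: tree_edge_inj => //.
  have h1 : vertex_of (opp (pi wa)) = v0 by move: wa2; rewrite /par (negbTE wav0).
  have h2 : vertex_of (opp (pi wb)) = v0 by move: wb2; rewrite /par (negbTE wbv0).
  by have := congr1 fst (boundary_endpoint v0b h1 h2).
pose Q v := [&& v != v0, anc v a & anc v b].
have Qw : Q wa by rewrite /Q wav0 wa1 wab wb1.
case: (@arg_maxnP _ wa Q h Qw) => c /and3P[cv0 ca cb] cmax.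
have [e|ne] := eqVneq c a.
  by exists c, (e0, false); split=> //; [rewrite ca cb|left].
have [y [yv0 ya py]] : exists y : V, [/\ y != v0, anc y a & par y = c].
  have fc : fconnect par a c := ca.
  case E : (findex par a c) => [|k].
    by have := iter_findex fc; rewrite E /= => ac; rewrite ac eqxx in ne.
  have ek := iter_findex fc; rewrite E /= in ek.
  exists (iter k par a); split=> //; last exact: fconnect_iter.
  by apply: contra cv0 => /eqP ev; rewrite -ek ev /par eqxx.
exists c, (opp (pi y)); split=> //.
- by move: py; rewrite /par (negbTE yv0).
- by rewrite ca cb.
right; exists y; split=> //; apply/negP => yb.
have := cmax y; rewrite /Q yv0 ya yb => /(_ isT) /=.
by rewrite leqNgt -py par_lt.
Qed.

(** [value] and [der] abstract the end data of a solution: only continuity, the vertex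
    condition and uniqueness in the Cauchy problem on an edge enter the argument. *)
Section Sweep.
Variables (K : fieldType) (value der : E -> K) (al : V -> K).
Hypothesis H1 : forall x y, vertex_of x = vertex_of y -> value x = value y.
Hypothesis H2 : forall x, \sum_(y | vertex_of y == vertex_of x) der y = al (vertex_of x) * value x.
Hypothesis H3 : forall x, value x = 0 -> der x = 0 ->
  value (opp x) = 0 /\ der (opp x) = 0.

Definition zero_edge j := forall b, value (j, b) = 0 /\ der (j, b) = 0.

Lemma zero_edgeI x : value x = 0 -> der x = 0 -> zero_edge x.1.
Proof.
move=> a b c; have [d e] := H3 a b.
have [->|->] : (x.1, c) = x \/ (x.1, c) = opp x by exact: same_edge.
  by [].
by [].
Qed.

Lemma zero_edgeE x : zero_edge x.1 -> value x = 0 /\ der x = 0.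
Proof. by case: x => j b /(_ b). Qed.

(** The sum of derivatives at the vertex, which is a multiple of the value there, is
    reduced to its term at [x]. *)
Lemma kirchhoff_value x : value x = 0 ->
  (forall y, y != x -> vertex_of y = vertex_of x -> zero_edge y.1) -> zero_edge x.1.
Proof.
move=> vx Hy; apply: zero_edgeI => //.
have := H2 x; rewrite vx mulr0 (bigD1 x)//= big1 ?addr0// => y /andP[/eqP yv yx].
by case: (zero_edgeE (Hy y yx yv)).
Qed.

Lemma kirchhoff_other x y : y != x -> vertex_of y = vertex_of x ->
  (forall y, y != x -> vertex_of y = vertex_of x -> zero_edge y.1) -> zero_edge x.1.
Proof.
move=> yx yv Hy; apply: kirchhoff_value => //.
by rewrite (H1 (esym yv)); case: (zero_edgeE (Hy y yx yv)).
Qed.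

Lemma endpoint_cases x : [\/ x.1 \in nontree,
  exists2 w, w != v0 & x = pi w | exists2 w, w != v0 & x = opp (pi w)].
Proof.
have [xn|/treeP[w wv0 wx]] := boolP (x.1 \in nontree); first by apply: Or31.
have [e|e] := same_edge (esym wx); first by apply: Or32; exists w.
by apply: Or33; exists w.
Qed.

(** Induction from the vertices farthest from the root: of the edge ends at [v], all but
    the parent one carry zero already. The predicate [A], inherited by children,
    confines the sweep to some branches of the tree. *)
Lemma sweep_up (A : pred V) :
  (forall w, w != v0 -> A (vertex_of (opp (pi w))) -> A w) ->
  (forall v x, v != v0 -> A v -> vertex_of x = v -> x.1 \in nontree -> zero_edge x.1) ->
  (forall v, v != v0 -> A v -> v \in boundary G -> value (pi v) = 0) ->
  forall v, v != v0 -> A v -> zero_edge (pi v).1.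
Proof.
move=> Achild Anon Aleaf.
pose m := \max_v h v.
have hm v : (h v <= m)%N by rewrite /m (bigD1 v)//= leq_maxl.
suff main n : forall v, (m - h v <= n)%N -> v != v0 -> A v -> zero_edge (pi v).1.
  by move=> v; exact: (main (m - h v)%N).
elim: n => [|n IH] v hv vv0 Av; have [pv hp] := Hpi vv0.
  have rest y : y != pi v -> vertex_of y = vertex_of (pi v) -> zero_edge y.1.
    rewrite pv => yp yv; have [yn|[w wv0 yw]|[w wv0 yw]] := endpoint_cases y.
    - exact: (Anon v).
    - have [pw _] := Hpi wv0; move: yp; rewrite yw in yv *.
      by rewrite -yv pw eqxx.
    - have [_ hw] := Hpi wv0; move: hw; rewrite -yw yv => hw.
      have := leq_trans hw (hm w); rewrite -subn_gt0.
      by move: hv; rewrite leqn0 => /eqP ->.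
  have [vb|vb] := boolP (v \in boundary G).
    by apply: kirchhoff_value => //; exact: Aleaf.
  have [y yp yv] := other_endpoint pv vb.
  by apply: (kirchhoff_other yp) => //; rewrite pv.
have rest y : y != pi v -> vertex_of y = vertex_of (pi v) -> zero_edge y.1.
  rewrite pv => yp yv; have [yn|[w wv0 yw]|[w wv0 yw]] := endpoint_cases y.
  - exact: (Anon v).
  - have [pw _] := Hpi wv0; move: yp; rewrite yw in yv *.
    by rewrite -yv pw eqxx.
  - have [_ hw] := Hpi wv0; move: hw; rewrite -yw yv => hw.
    rewrite yw /=; apply: IH => //.
      by rewrite -ltnS (leq_trans _ hv)// ltn_sub2l// (leq_trans hw).
    by apply: Achild => //; rewrite -yw yv.
have [vb|vb] := boolP (v \in boundary G).
  by apply: kirchhoff_value => //; exact: Aleaf.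
have [y yp yv] := other_endpoint pv vb.
by apply: (kirchhoff_other yp) => //; rewrite pv.
Qed.

Lemma all_zero : (forall j, j \in nontree -> zero_edge j) ->
  (forall v, v != v0 -> zero_edge (pi v).1) -> forall j, zero_edge j.
Proof.
move=> Hn Ht j; have [/Hn//|/treeP[w wv0 <-]] := boolP (j \in nontree).
exact: Ht.
Qed.

Lemma sweep_from_leaves :
  (forall j, j \in nontree -> zero_edge j) ->
  (forall v, v != v0 -> v \in boundary G -> value (pi v) = 0) ->
  forall j, zero_edge j.
Proof.
move=> Hn Hl; apply: all_zero => // v vv0.
apply: (@sweep_up xpredT) => //.
- by move=> w x _ _ _; exact: Hn.
- by move=> w wv0 _; exact: Hl.
Qed.

(** One derivative at the apex of the fundamental cycle does the work of the two data of
    its chord: zero spreads from the root down to the apex, and from the leaves up to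
    the cycle; the derivative at the apex then starts it on its way around the
    cycle. *)
Lemma sweep_around e0 c xi : v0 \in boundary G -> e0 \in nontree ->
  c != v0 -> vertex_of xi = c ->
  anc c (vertex_of (e0, false)) && anc c (vertex_of (e0, true)) ->
  (xi = (e0, false) \/
    exists y : V, [/\ y != v0, xi = opp (pi y), anc y (vertex_of (e0, false)) &
                  ~~ anc y (vertex_of (e0, true))]) ->
  (forall x, vertex_of x \in boundary G -> value x = 0) ->
  (forall j, j \in nontree -> j != e0 -> zero_edge j) -> der xi = 0 ->
  forall j, zero_edge j.
Proof.
set a := vertex_of (e0, false); set b := vertex_of (e0, true).
move=> v0b e0n cv0 xic /andP[ca cb] xicase leaf chords dxi.
have leafpi v : v != v0 -> v \in boundary G -> value (pi v) = 0.
  by move=> vv0 vb; apply: leaf; case: (Hpi vv0) => ->.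
suff ze0 : zero_edge e0.
  apply: sweep_from_leaves => // j jn.
  by have [->//|] := eqVneq j e0; exact: chords.
have e0ab x : x.1 = e0 -> vertex_of x = a \/ vertex_of x = b.
  by case: x => j [] /= ->; [right|left].
pose A v := ~~ anc v a && ~~ anc v b.
(* off the tree paths from the root to the two ends of the chord *)
have branch : forall v, v != v0 -> A v -> zero_edge (pi v).1.
  apply: sweep_up => [w wv0 /andP[na nb]|v x vv0 /andP[na nb] xv xn|v vv0 _ vb];
    last exact: leafpi.
    have pw : vertex_of (opp (pi w)) = par w by rewrite /par (negbTE wv0).
    have := connect1 (e := frel par) (x := w) (y := par w); rewrite /= eqxx => /(_ isT) cw.
    rewrite /A; apply/andP; split; apply/negP => wx.
      by move/negP: na; apply; rewrite pw; exact: connect_trans wx cw.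
    by move/negP: nb; apply; rewrite pw; exact: connect_trans wx cw.
  apply: chords => //; apply/eqP => xe0.
  by case: (e0ab x xe0) => e; [move/negP: na|move/negP: nb]; apply; rewrite -xv e; exact: connect0.
have parE v : v != v0 -> vertex_of (opp (pi v)) = par v.
  by move=> vv0; rewrite /par (negbTE vv0).
have anc_not_par (x v : V) : v != v0 -> anc v x -> x != par v.
  move=> vv0 vx; apply/eqP => e; have := par_lt vv0; rewrite -e => lt.
  by case: (anc_lt vx) => [e'|lt']; [rewrite e' ltnn in lt|have := ltn_trans lt lt'; rewrite ltnn].
have pi_ne v : v != v0 -> par v != v0 -> pi (par v) != opp (pi v).
  move=> vv0 pv0; apply/eqP => /(congr1 fst) /= /(tree_edge_inj pv0 vv0) e.
  by have := par_lt vv0; rewrite e ltnn.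
(* passing zero from the parent edge of [par v] to the parent edge of [v] *)
have descend v : v != v0 -> par v != v0 -> zero_edge (pi (par v)).1 ->
    (forall x, x.1 = e0 -> vertex_of x != par v) ->
    (forall w, w != v0 -> par w = par v -> w != v -> A w) -> zero_edge (pi v).1.
  move=> vv0 pv0 zp ne0 sib.
  have [ppv _] := Hpi pv0.
  apply: (@kirchhoff_other (opp (pi v)) (pi (par v))).
  - exact: pi_ne.
  - by rewrite ppv parE.
  - move=> x xne; rewrite parE// => xv; have [xn|[w wv0 xw]|[w wv0 xw]] := endpoint_cases x.
    + by apply: chords => //; apply/eqP => /ne0; rewrite xv eqxx.
    + by have [pw _] := Hpi wv0; rewrite xw in xv *; rewrite -xv pw in zp.
    + rewrite xw /=; apply: branch => //; apply: sib => //.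
        by rewrite -xv xw parE.
      by apply: contra xne => /eqP <-; rewrite xw.
(* from the root down to the apex *)
have trunk v : v != v0 -> anc v a -> anc v b -> zero_edge (pi v).1.
  have [n] := ubnP (h v); elim: n v => // n IH v; rewrite ltnS => hv vv0 va vb.
  have [pv0|pv0] := eqVneq (par v) v0.
    have ov0 : vertex_of (opp (pi v)) = v0 by rewrite parE.
    have : zero_edge (opp (pi v)).1.
      apply: kirchhoff_value; first by apply: leaf; rewrite ov0.
      move=> y yne yv; rewrite ov0 in yv.
      by rewrite (boundary_endpoint v0b yv ov0) eqxx in yne.
    by [].
  apply: descend => //.
  - apply: IH => //; first exact: leq_trans (par_lt vv0) hv.
    + exact: connect_trans va (fconnect1 _ _).
    + exact: connect_trans vb (fconnect1 _ _).
  - by move=> x /e0ab[->|->]; exact: anc_not_par.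
  - move=> w wv0 wpar wv; rewrite /A; apply/andP; split; apply/negP => wx.
      by move/eqP: wv; apply; exact: anc_child_uniq wx va.
    by move/eqP: wv; apply; exact: anc_child_uniq wx vb.
have zc := trunk c cv0 ca cb.
have vc : value xi = 0.
  have [pc _] := Hpi cv0; have [v1 _] := zero_edgeE zc.
  by rewrite -v1; apply: H1; rewrite pc.
have zxi := zero_edgeI vc dxi.
case: xicase => [xe|[y [yv0 xy ya yb]]]; first by rewrite xe in zxi.
rewrite xy /= in zxi.
(* from the apex down to the end [a] of the chord, away from [b] *)
have side v : v != v0 -> anc y v -> anc v a -> zero_edge (pi v).1.
  have [n] := ubnP (h v); elim: n v => // n IH v; rewrite ltnS => hv vv0 yv va.
  have [<-//|yne] := eqVneq y v.
  have ypv : anc y (par v) by exact: anc_par.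
  have pv0 : par v != v0.
    apply: contra yv0 => /eqP pv0; rewrite pv0 in ypv.
    have [m <-] := anc_iter ypv; elim: m => // m /eqP IHm; by rewrite /= IHm /par eqxx.
  apply: descend => //.
  - apply: IH => //; first exact: leq_trans (par_lt vv0) hv.
    exact: connect_trans va (fconnect1 _ _).
  - move=> x /e0ab[->|->]; first exact: anc_not_par.
    by apply: contra yb => /eqP ->.
  - move=> w wv0 wpar wv; rewrite /A; apply/andP; split; apply/negP => wx.
      by move/eqP: wv; apply; exact: anc_child_uniq wx va.
    move/negP: yb; apply; apply: connect_trans wx _.
    by apply: connect_trans (fconnect1 _ _) _; rewrite wpar.
have av0 : a != v0.
  apply: contra yv0 => /eqP av0; rewrite av0 in ya.
  have [m <-] := anc_iter ya; elim: m => // m /eqP IHm; by rewrite /= IHm /par eqxx.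
have za : zero_edge (pi a).1 by apply: side => //; exact: connect0.
have [pa _] := Hpi av0.
apply: (@kirchhoff_other (e0, false) (pi a)) => //.
- by apply/eqP => /(congr1 fst) /= e; have := nontree_pi av0; rewrite e e0n.
- move=> x xne xv; rewrite -/a in xv.
  have [xn|[w wv0 xw]|[w wv0 xw]] := endpoint_cases x.
  + apply: chords => //; apply/eqP => xe.
    have [e|e] := @same_edge x (e0, false) xe; first by rewrite e eqxx in xne.
    have bE : b = vertex_of x by rewrite e.
    by move/negP: yb; apply; rewrite bE xv.
  + by have [pw _] := Hpi wv0; rewrite xw in xv *; rewrite -xv pw in za.
  + rewrite xw /=; apply: branch => //.
    have pwa : par w = a by rewrite -xv xw parE.
    rewrite /A; apply/andP; split; apply/negP => wx.
      by have := anc_not_par _ _ wv0 wx; rewrite pwa eqxx.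
    move/negP: yb; apply; apply: connect_trans wx _.
    by apply: connect_trans (fconnect1 _ _) _; rewrite pwa.
Qed.

End Sweep.
End Tree.
End RootedTree.

(** * Data forcing a solution to vanish *)

Section Labels.
Variables (R : realType) (G : metric_graph R).
Hypothesis hG : graph_connected G.
Local Notation V := (vertex G).
Local Notation E := (endpoint G).

(** A label is an edge end with a flag, true for the value and false for the derivative. *)
Definition edge_labels (X : {set 'I_(nedges G)}) : {set E * bool} :=
  [set ((jb.1, false), jb.2) | jb in finset.setX X [set: bool]%SET]%SET.

Lemma card_edge_labels X : (#|edge_labels X| <= 2 * #|X|)%N.
Proof.
by apply: leq_trans (leq_imset_card _ _) _; rewrite cardsX cardsT card_bool mulnC.
Qed.

Lemma mem_edge_labels (X : {set 'I_(nedges G)}) j b :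
  j \in X -> ((j, false), b) \in edge_labels X.
Proof. by move=> jX; apply/imsetP; exists (j, b) => //; rewrite !inE jX. Qed.

(** Both Cauchy data of every edge outside a spanning tree, and the values at the
    boundary vertices outside [B] except one, which is taken as the root. If [B] is
    the whole boundary there is no such vertex; the root is then taken in [B], and one
    datum is saved at one edge outside the tree by [sweep_around]. *)
Lemma forcing_labels (B : {set V}) : B \subset boundary G -> (0 < #|B|)%N ->
  exists S : {set E * bool},
  [/\ cyc G = 0 -> B = boundary G -> #|S| = 0%N,
      ~ (cyc G = 0 /\ B = boundary G) ->
        (#|S|)%:Z <= 2 * cyc G + (#|boundary G|)%:Z - (#|B|)%:Z - 1 &
      forall (K : fieldType) (value der : E -> K) (al : V -> K),
        (forall x y, vertex_of x = vertex_of y -> value x = value y) ->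
        (forall x, \sum_(y | vertex_of y == vertex_of x) der y = al (vertex_of x) * value x) ->
        (forall x, value x = 0 -> der x = 0 -> value (opp x) = 0 /\ der (opp x) = 0) ->
        (forall x, vertex_of x \in B -> value x = 0) ->
        (forall l, l \in S -> (if l.2 then value l.1 else der l.1) = 0) ->
        forall j, zero_edge value der j].
Proof.
move=> sB B0.
have chordz (X : {set 'I_(nedges G)}) (K : fieldType) (value der : E -> K) :
    (forall x, value x = 0 -> der x = 0 -> value (opp x) = 0 /\ der (opp x) = 0) ->
    (forall l, l \in edge_labels X -> (if l.2 then value l.1 else der l.1) = 0) ->
    forall j, j \in X -> zero_edge value der j.
  move=> H3 HS j jX.
  exact: (zero_edgeI H3 (HS _ (mem_edge_labels true jX)) (HS _ (mem_edge_labels false jX))).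
have [sbB|nsbB] := boolP (boundary G \subset B); last first.
  have /subsetPn[v0 v0b v0B] := nsbB.
  have [h [pi Hpi]] := rooted_tree hG v0.
  pose D := ((boundary G :\: B) :\ v0)%SET.
  pose S := (edge_labels (nontree v0 pi) :|: [set (vertex_repr v, true) | v in D])%SET.
  have cS : (#|S| <= 2 * #|nontree v0 pi| + #|D|)%N.
    apply: leq_trans (leq_card_setU _ _) _.
    by apply: leq_add; [exact: card_edge_labels|exact: leq_imset_card].
  have cD : (#|boundary G| = #|B| + #|D|.+1)%N.
    rewrite -(cardsID B (boundary G)) (finset.setIidPr sB); congr (_ + _)%N.
    by rewrite (cardsD1 v0 (boundary G :\: B)%SET) !inE v0B; move: v0b; rewrite inE => ->.
  exists S; split.
  - by move=> _ e; move: v0B; rewrite e v0b.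
  - move=> _; rewrite -(card_nontree Hpi) cD.
    move: cS; rewrite -lez_nat => /le_trans; apply.
    rewrite PoszD PoszM [(#|B| + _)%:Z]PoszD -[(#|D|.+1)]addn1 [(#|D| + 1)%:Z]PoszD.
    by rewrite le_eqVlt; apply/orP; left; apply/eqP; ring.
  - move=> K value der al H1 H2 H3 HB HS.
    apply: (sweep_from_leaves Hpi H1 H2 H3).
      by apply: chordz => // l lX; apply: HS; rewrite inE lX.
    move=> v vv0 vb; have [pv _] := Hpi v vv0.
    have [vB|vB] := boolP (v \in B); first by apply: HB; rewrite pv.
    rewrite (H1 _ (vertex_repr v)); last by rewrite pv vertex_reprK.
    apply: (HS (vertex_repr v, true)); rewrite inE; apply/orP; right.
    by apply/imsetP; exists v => //; rewrite !inE vv0 vB; move: vb; rewrite inE.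
have eB : B = boundary G by apply/eqP; rewrite finset.eqEsubset sB sbB.
have /card_gt0P[v0 v0B] := B0.
have v0b : v0 \in boundary G by rewrite -eB.
have [h [pi Hpi]] := rooted_tree hG v0.
have [n0|/card_gt0P[e0 e0n]] := posnP #|nontree v0 pi|.
  exists (finset.set0); split.
  - by rewrite cards0.
  - by case; rewrite -(card_nontree Hpi) n0.
  - move=> K value der al H1 H2 H3 HB HS.
    apply: (sweep_from_leaves Hpi H1 H2 H3).
      by move=> j; rewrite (cards0_eq n0) inE.
    by move=> v vv0 vb; have [pv _] := Hpi v vv0; apply: HB; rewrite pv eB.
have [c [xi [cv0 xic cab xicase]]] := chord_apex Hpi v0b e0n.
exists ((xi, false) |: edge_labels (nontree v0 pi :\ e0))%SET.
have cN : (#|nontree v0 pi| = #|nontree v0 pi :\ e0|%SET.+1)%N.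
  by rewrite (cardsD1 e0) e0n.
split.
- by rewrite -(card_nontree Hpi) cN.
- move=> _; rewrite -(card_nontree Hpi) eB cN.
  have : (#|((xi, false) |: edge_labels (nontree v0 pi :\ e0))%SET| <=
          1 + 2 * #|(nontree v0 pi :\ e0)%SET|)%N.
    apply: leq_trans (leq_card_setU _ _) _.
    by rewrite cards1 leq_add2l card_edge_labels.
  rewrite -lez_nat => /le_trans; apply.
  set n := #|(nontree v0 pi :\ e0)%SET|; rewrite PoszD PoszM (intS n).
  by rewrite le_eqVlt; apply/orP; left; apply/eqP; ring.
- move=> K value der al H1 H2 H3 HB HS.
  apply: (sweep_around Hpi H1 H2 H3 v0b e0n cv0 xic cab xicase).
  + by move=> x xb; apply: HB; rewrite eB.
  + move=> j jn je0; apply: (chordz (nontree v0 pi :\ e0)%SET) => //.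
      by move=> l lX; apply: HS; rewrite inE lX orbT.
    by rewrite !inE je0; move: jn; rewrite inE.
  + by apply: (HS (xi, false)); rewrite !inE eqxx.
Qed.

End Labels.

Section RankBound.
Variables (K : fieldType) (d m : nat) (L : finType).

(** The functionals of [S] are injective on the null space of [A]. *)
Lemma rank_forcing (A : 'M[K]_(m, d)) (S : {set L}) (theta : L -> 'I_d -> K) :
  (forall c : 'cV[K]_d, A *m c = 0 ->
     (forall l, l \in S -> \sum_k theta l k * c k 0 = 0) -> c = 0) ->
  (d <= \rank A + #|S|)%N.
Proof.
move=> H; pose T : 'M[K]_(#|S|, d) := \matrix_(i, k) theta (enum_val i) k.
have full : row_free (col_mx A T)^T.
  apply/inj_row_free => v vM; apply/trmx_inj; rewrite trmx0; apply: H.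
    have := congr1 trmx vM; rewrite trmx_mul trmxK mul_col_mx trmx0 => /eqP.
    by rewrite col_mx_eq0 => /andP[/eqP].
  move=> l lS; have := congr1 trmx vM; rewrite trmx_mul trmxK mul_col_mx trmx0 => /eqP.
  rewrite col_mx_eq0 => /andP[_ /eqP /matrixP /(_ (enum_rank_in lS l) 0)].
  rewrite !mxE => e; rewrite -[RHS]e; apply: eq_bigr => k _.
  by rewrite [T _ _]mxE enum_rankK_in.
move: full; rewrite /row_free mxrank_tr => /eqP {1}<-.
rewrite -addsmxE; apply: leq_trans (mxrank_adds_leqif _ _).1 _.
by rewrite leq_add2l rank_leq_row.
Qed.

End RankBound.

(** * Trace of the kernel and residue *)

Section Assembly.
Variables (R : realType) (G : metric_graph R).
Local Notation C := R[i].
Variables (q : 'I_(nedges G) -> R -> R) (alpha : vertex G -> R).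
Hypothesis hq : L1_potential q.
Local Notation G0 := (@gfun0 R G).
Variables (lambda : R) (B : {set vertex G}).
Local Notation z0 := (lambda%:C)%C.
Local Notation M := (TW_matrix q alpha B).

Section Basis.
Variables (d : nat) (phi : 'I_d -> gfun G).
Hypothesis Kphi : forall k, A_ker q alpha z0 (phi k).
Hypothesis Hfree : forall c : 'I_d -> C,
  eq_on_graph (fun j x => \sum_k c k * phi k j x) G0 -> forall k, c k = 0.
Definition trace_matrix : 'M[C]_(#|B|, d) :=
  \matrix_(i, k) vertex_val (phi k) (enum_val i).

(** A function of the kernel that vanishes on [B] is determined by its values and
    derivatives at the labels given by [forcing_labels]. *)
Lemma dim_le_rank_trace (hG : graph_connected G) (hB : B \subset boundary G)
    (hB0 : (0 < #|B|)%N) : exists s : nat,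
  [/\ (d <= \rank trace_matrix + s)%N, cyc G = 0 -> B = boundary G -> s = 0%N &
      ~ (cyc G = 0 /\ B = boundary G) ->
        s%:Z <= 2 * cyc G + (#|boundary G|)%:Z - (#|B|)%:Z - 1].
Proof.
have Hex k : exists p, bvp q alpha (phi k) p (fun j t => z0 * phi k j t) (fun=> 0).
  exact: (A_ker_bvp alpha hq z0 (phi k)).1 (Kphi k).
have [psi Hpsi] := choice Hex.
have [S [S1 S2 HS]] := forcing_labels hG hB hB0.
exists #|S|; split=> //.
pose theta (l : endpoint G * bool) k : C :=
  if l.2 then end_val (phi k) l.1 else end_der (psi k) l.1.
apply: (rank_forcing (S := S) (theta := theta)) => c cA cS.
pose cc k := c k 0.
pose f := gcomb cc phi; pose p := gcomb cc psi.
have Hf : bvp q alpha f p (fun j t => z0 * f j t) (fun=> 0).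
  have [K1 K2 K3] := bvp_comb cc Hpsi.
  have [J1 J2 J3] : bvp q alpha f p (fun j t => z0 * f j t) (fun v => \sum_k cc k * 0).
    apply: bvp_ext (And3 K1 K2 K3) => // j t _.
    by rewrite /f /gcomb mulr_sumr; apply: eq_bigr => k _; ring.
  by split=> // v; rewrite J3 big1// => k _; rewrite mulr0.
have [F1 F2 F3] := Hf.
have zeros : forall j, zero_edge (end_val f) (end_der p) j.
  apply: (HS C (end_val f) (end_der p) (fun v => (alpha v)%:C%C)).
  - by move=> x y xy; rewrite F2 [RHS]F2 xy.
  - move=> x; have /eqP := F3 (vertex_of x); rewrite subr_eq0 => /eqP.
    by rewrite -F2 /vertex_der => ->.
  - move=> [j b] v0 e0; have L0 := len_gt0 j.
    have H0 : forall t, 0 <= t <= len j -> f j t = 0 /\ p j t = 0.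
      case: b v0 e0; rewrite /end_val /end_der /= => v0 e0.
        exact: (@edge_zero_ter R (len j) (q j) L0 (hq j) z0 (f j) (p j) (F1 j) v0 e0).
      apply: (@edge_zero_org R (len j) (q j) L0 (hq j) z0 (f j) (p j) (F1 j) v0).
      by apply/eqP; rewrite -oppr_eq0; apply/eqP.
    have [a1 a2] := H0 0 (introT andP (conj (lexx _) (ltW L0))).
    have [b1 b2] := H0 (len j) (introT andP (conj (ltW L0) (lexx _))).
    by rewrite /opp /end_val /end_der /=; case: (b) => /=; rewrite ?a1 ?a2 ?b1 ?b2 ?oppr0.
  - move=> x xB; have := congr1 (fun y : 'cV_#|B| => y (enum_rank_in xB (vertex_of x)) 0) cA.
    rewrite !mxE F2 => e; rewrite -[RHS]e; apply: eq_bigr => k _.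
    by rewrite mxE enum_rankK_in// mulrC.
  - move=> [x b] lS; have := cS _ lS; rewrite /theta /=; case: b {lS} => e.
      by rewrite -[RHS]e; apply: eq_bigr => k _; rewrite mulrC.
    by rewrite end_der_comb -[RHS]e; apply: eq_bigr => k _; rewrite mulrC.
have f0 : eq_on_graph f G0.
  move=> j t tL; have [v0 e0] := zeros j false.
  have p0 : p j 0 = 0 by apply/eqP; rewrite -oppr_eq0; apply/eqP.
  by have [] := edge_zero_org (len_gt0 j) (hq j) (F1 j) v0 p0 tL.
by apply/colP => k; rewrite [RHS]mxE; exact: Hfree f0 k.
Qed.

Hypothesis Hspan : forall f, A_ker q alpha z0 f ->
  exists c : 'I_d -> C, eq_on_graph f (fun j x => \sum_k c k * phi k j x).

(** With [T] the trace matrix, the residue is [- T P T^*], where [P] is the inverse of the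
    transposed Gram matrix of the basis. As [P] is positive definite, the residue has
    the rank of [T]. *)
Lemma TW_residue : exists S : 'M[C]_#|B|,
  [/\ is_residue M z0 S, \rank S = \rank trace_matrix,
      S = 0 -> removable M z0 &
      \forall w \near (z0 : C^o)^'%classic, mx_analytic_at M w].
Proof.
have Hex k : exists p, bvp q alpha (phi k) p (fun j t => z0 * phi k j t) (fun=> 0).
  exact: (A_ker_bvp alpha hq z0 (phi k)).1 (Kphi k).
have [psi Hpsi] := choice Hex.
have cphi k := basis_gcont Hpsi k.
have [A [r [g [r0 HA Hw Hg]]]] := basis_expansion hq Hpsi Hfree Hspan.
pose Dm : 'M[C]_(d, #|B|) := \matrix_(k, l) - A (enum_val l) k.
pose S := trace_matrix *m Dm.
pose H w : 'M[C]_#|B| := \matrix_(k, l) vertex_val (g (enum_val l) w) (enum_val k).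
have dH w k l : cn (w - z0) < r -> derivable (fun u : C^o => H u k l : C^o) w 1.
  move=> wr; have [c [K K0 HK]] := Hg w (enum_val l) (enum_val k) wr.
  have rw : 0 < r - cn (w - z0) by rewrite subr_gt0.
  apply: (@quadratic_derivable R (fun u => H u k l) w c K _ rw K0) => u uw.
  rewrite !mxE; apply: HK.
  by have := cnD (u - w) (w - z0); rewrite addrA subrK; lra.
have aH w : cn (w - z0) < r -> mx_analytic_at H w.
  move=> wr k l; apply/near_cnP; exists (r - cn (w - z0)); first by rewrite subr_gt0.
  move=> u uw; apply: dH.
  by have := cnD (u - w) (w - z0); rewrite addrA subrK; lra.
have z0r : cn (z0 - z0) < r by rewrite subrr cn0.
have ME w : cn (w - z0) < r -> w != z0 -> M w = (w - z0)^-1 *: S + H w.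
  move=> wr wz; have [res ex val] := Hw w wr wz.
  rewrite /TW_matrix; case: asboolP => [sp|_]; first by case: (sp res).
  apply/matrixP => k l; rewrite !mxE.
  set f := xget _ _.
  have Hf : TW_solution q alpha w (enum_val l) f.
    rewrite /f; case: xgetP => [f' _ //|none].
    by have [f' Hf'] := ex (enum_val l); case: (none f').
  rewrite (val _ _ Hf) addrC; congr (_ + _); rewrite -mulrN; congr (_ * _).
  by rewrite -sumrN; apply: eq_bigr => i _; rewrite !mxE; ring.
have nearM : \forall w \near (z0 : C^o)^'%classic, M w = (w - z0)^-1 *: S + H w.
  by apply/dnear_cnP; exists r => // w wr wz; exact: ME.
exists S; split.
- exact: simple_pole_residue (aH _ z0r) nearM.
- apply/eqP; rewrite eqn_leq mxrankM_maxl /=.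
  rewrite -(mxrank_map (@conjc R) trace_matrix) -(mxrank_tr S).
  (* a row annihilated by the transposed residue gives a combination of the basis
     that is orthogonal to itself *)
  have sub : (kermx S^T <= kermx (map_mx (@conjc R) trace_matrix))%MS.
    apply/rV_subP => y /sub_kermxP yS; apply/sub_kermxP.
    pose a k := \sum_l y 0 l * A (enum_val l) k.
    have aS (i : 'I_#|B|) : \sum_k a k * vertex_val (phi k) (enum_val i) = 0.
      have := congr1 (fun x : 'rV_#|B| => x 0 i) yS; rewrite [RHS]mxE => e.
      transitivity (- (y *m S^T) 0 i); last by rewrite e oppr0.
      rewrite mxE -sumrN /a (eq_bigr (fun k => \sum_l y 0 l * A (enum_val l) k *
        vertex_val (phi k) (enum_val i))); last by move=> k _; rewrite mulr_suml.
      rewrite exchange_big; apply: eq_bigr => l _ /=.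
      rewrite !mxE mulr_sumr -sumrN; apply: eq_bigr => k _; rewrite !mxE.
      by ring.
    have pa k : inner (gcomb a phi) (phi k) =
        \sum_l y 0 l * (vertex_val (phi k) (enum_val l))^*%C.
      transitivity (\sum_l y 0 l * inner (gcomb (A (enum_val l)) phi) (phi k)); last first.
        by apply: eq_bigr => l _; rewrite HA.
      rewrite inner_comb// /a.
      rewrite (eq_bigr (fun i => \sum_l y 0 l * A (enum_val l) i * inner (phi i) (phi k)));
        last by move=> i _; rewrite mulr_suml.
      rewrite exchange_big; apply: eq_bigr => l _ /=; rewrite inner_comb// mulr_sumr.
      by apply: eq_bigr => i _; rewrite mulrA.
    have a0 : forall k, a k = 0.
      apply: Hfree; apply: inner_eq0; first exact: gcont_comb.
      rewrite inner_combr//; last exact: gcont_comb.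
      transitivity (\sum_k \sum_l (a k)^*%C * (y 0 l * (vertex_val (phi k) (enum_val l))^*%C)).
        by apply: eq_bigr => k _; rewrite pa mulr_sumr.
      rewrite exchange_big big1// => l _ /=.
      transitivity (y 0 l * (\sum_k a k * vertex_val (phi k) (enum_val l))^*%C).
        rewrite (big_morph (@conjc R) (id1 := 0) (op1 := +%R)); last first.
        + by rewrite conjc0.
        + by move=> u v; apply: complexP; rewrite !cE; ring.
        rewrite mulr_sumr; apply: eq_bigr => k _.
        by apply: complexP; rewrite !cE; ring.
      by rewrite aS conjc0 mulr0.
    apply/rowP => k; rewrite mxE [RHS]mxE.
    transitivity (inner (gcomb a phi) (phi k)).
      by rewrite pa; apply: eq_bigr => l _; rewrite !mxE.
    rewrite inner_comb// big1// => i _; by rewrite a0 mul0r.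
  have := mxrankS sub; rewrite !mxrank_ker => h.
  have h1 := rank_leq_row S^T; have h2 := rank_leq_row (map_mx (@conjc R) trace_matrix).
  by move: h; rewrite leq_sub2lE.
- move=> S0; exists H; first exact: aH.
  by apply/dnear_cnP; exists r => // w wr wz; rewrite ME// S0 scaler0 add0r.
- apply/dnear_cnP; exists r => // w wr wz k l.
  have cwz : 0 < cn (w - z0).
    rewrite lt_neqAle cn_ge0 andbT eq_sym; apply: contra wz => /eqP e.
    by rewrite -subr_eq0; apply/eqP/cn_eq0; rewrite e.
  pose s := Num.min (r - cn (w - z0)) (cn (w - z0)).
  have s0 : 0 < s by rewrite lt_min subr_gt0 wr cwz.
  have inside u : cn (u - w) < s -> cn (u - z0) < r /\ u != z0.
    rewrite lt_min => /andP[u1 u2]; split.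
      by have := cnD (u - w) (w - z0); rewrite addrA subrK; lra.
    by apply: contraTneq u2 => ->; rewrite -leNgt -cnN opprB.
  apply/near_cnP; exists s => // u us; have [ur uz] := inside u us.
  have near_u : \forall x \near (u : C^o), (x - z0)^-1 * S k l + H x k l = M x k l.
    apply/near_cnP; exists (s - cn (u - w)); first by rewrite subr_gt0.
    move=> x xu; have xs : cn (x - w) < s.
      by have := cnD (x - u) (u - w); rewrite addrA subrK; lra.
    have [xr xz] := inside x xs.
    by rewrite ME// !mxE.
  have dP := @simple_pole_derivable R z0 u (S k l) (fun x => H x k l) uz (dH u k l ur).
  by apply: (@near_eq_derivable C C^o C^o _ (fun x => M x k l) u 1 _ dP); exact: near_u.
Qed.

End Basis.
End Assembly.

Theorem theorem3p5 (R : realType) (G : metric_graph R)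
    (hG : graph_connected G)
    (q : 'I_(nedges G) -> R -> R) (hq : L1_potential q)
    (alpha : vertex G -> R)
    (B : {set vertex G}) (hB : B \subset boundary G) (hB0 : (0 < #|B|)%N)
    (lambda : R) :
  let z : R[i] := (lambda%:C)%C in
  let M := TW_matrix q alpha B in
  let defect : int :=
    2 * cyc G + (#|boundary G|)%:Z - (#|B|)%:Z - 1 in
  [/\ pole M z -> A_eigenvalue q alpha z,
      A_eigenvalue q alpha z -> (dim_ker q alpha z)%:Z > defect -> pole M z,
      cyc G = 0 -> B = boundary G ->
        dim_ker q alpha z = \rank (residue M z) &
      ~ (cyc G = 0 /\ B = boundary G) ->
        (\rank (residue M z) <= dim_ker q alpha z)%N /\
        (dim_ker q alpha z)%:Z <= (\rank (residue M z))%:Z + defect].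
Proof.
move=> z M defect.
have [d Hd] := ker_has_dim alpha hq z.
have dE := dim_kerE Hd.
have [phi [Kphi Hfree Hspan]] := Hd.
have [S [resS rkS remS anM]] := TW_residue hq B Kphi Hfree Hspan.
have [s [ds s0 sdef]] := dim_le_rank_trace hq Kphi Hfree hG hB hB0.
rewrite dE (residueE resS) rkS.
have rk_d : (\rank (trace_matrix B phi) <= d)%N by exact: rank_leq_col.
have S0d : S = 0 -> (d <= s)%N.
  by move=> S0; move: ds; rewrite -rkS S0 mxrank0.
have pos : A_eigenvalue q alpha z -> (0 < d)%N.
  move=> [f Kf fn0]; rewrite lt0n; apply/eqP => d0; apply: fn0.
  have [c fc] := Hspan f Kf; move=> j t tL; rewrite fc// big1// => k _.
  by exfalso; case: k; rewrite d0.
split.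
- move=> [_ notrem]; apply: contrapT => nev; apply: notrem; apply: remS.
  apply/eqP; rewrite -mxrank_eq0 rkS -leqn0; apply: leq_trans rk_d _.
  rewrite leqNgt; apply/negP => dpos; apply: nev.
  pose k0 := Ordinal dpos; exists (phi k0) => // phi0.
  have := Hfree (fun k => (k == k0)%:R) _ k0; rewrite eqxx => /(_ _)/eqP.
  rewrite oner_eq0 => H; suff : false by []. apply: H => j t tL.
  rewrite big1// => k _.
  by have [->|_] := eqVneq k k0; [rewrite phi0// mulr0|rewrite mul0r].
- move=> ev ddef; split=> // rem.
  have Sz : S = 0 by apply: residue_unique resS _; exact: removable_residue.
  have := S0d Sz; have dpos := pos ev.
  have [[c0 Bb]|nt] := pselect (cyc G = 0 /\ B = boundary G).
    by rewrite (s0 c0 Bb) leqNgt dpos.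
  have := sdef nt => h1; rewrite -lez_nat => h2.
  by have := lt_le_trans ddef (le_trans h2 h1); rewrite ltxx.
- move=> c0 Bb; apply/eqP; rewrite eqn_leq rk_d andbT.
  by rewrite (s0 c0 Bb) addn0 in ds.
- move=> nt; split=> //.
  have := sdef nt => h1; move: ds; rewrite -lez_nat PoszD => h2.
  by apply: le_trans h2 _; rewrite lerD2l.
Qed.
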